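(* Let $K$ be a field and let $\Lambda=K\mathcal{Q}/I$ be a $(D,A)$-stacked monomial algebra with $D>2$, $A>1$ and $D\neq 2A$. Let $\Delta$, $I_\Delta\subseteq K\Delta$ and $\mathcal{H}_\Delta\subseteq K\Delta$ be as defined in the context, and let $>$ be the left length lexicographic order on the set $\mathcal{B}$ of all paths of $\Delta$ determined by $$a_1>\cdots>a_r>b_1>\cdots>b_s>c_1>\cdots>c_t>e_1>\cdots>e_m,$$ where $f^0=\{e_1,\dots,e_m\}$, $f^1=\{a_1,\dots,a_r\}$, $f^2=\{b_1,\dots,b_s\}$, $f^3=\{c_1,\dots,c_t\}$. Then, with respect to $>$, the set $\mathcal{H}_\Delta$ is a quadratic reduced Gröbner basis of $I_\Delta$.
   Context: Setting. $\mathcal{Q}$ is a finite quiver (paths read left to right; a path $p$ starts at $s(p)$, ends at $t(p)$, has length $\ell(p)$), $I$ an admissible ideal generated by paths, $\Lambda=K\mathcal{Q}/I$ finite-dimensional, with the length grading $\Lambda=\Lambda_0\oplus\Lambda_1\oplus\cdots$ and graded radical $\mathfrak{r}=\Lambda_1\oplus\Lambda_2\oplus\cdots$. $\Lambda$ is a $(D,A)$-stacked monomial algebra ($D\geqslant 2,A\geqslant 1$ integers) if, for all $0\leqslant n\leqslant\operatorname{gldim}\Lambda$, the $n$th projective in a minimal graded projective resolution of the right $\Lambda$-module $\Lambda_0\cong\Lambda/\mathfrak{r}$ is generated in degree $\delta(n)$, with $\delta(0)=0$, $\delta(1)=1$, $\delta(n)=\frac n2D$ for $n\geqslant2$ even,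 $\delta(n)=\frac{n-1}2D+A$ for $n\geqslant3$ odd. Overlaps. A path $q$ overlaps a path $p$ with overlap $pu$ if there are paths $u,v$ with $pu=vq$ and $1\leqslant\ell(u)<\ell(q)$ ($\ell(v)=0$ allowed). Let $\mathcal{R}^0$ be the set of vertices, $\mathcal{R}^1$ the set of arrows of $\mathcal{Q}$, and $\mathcal{R}^2$ the minimal generating set of paths for $I$. For $n\geqslant3$, $\mathcal{R}^n$ is the set of all paths $R^n=R^{n-1}u$ such that $R^{n-1}\in\mathcal{R}^{n-1}$, $R^{n-1}=R^{n-2}p$ with $R^{n-2}\in\mathcal{R}^{n-2}$ and $p$ a path, some $R^2\in\mathcal{R}^2$ overlaps $p$ with overlap $pu$, and no proper prefix of $pu$ is an overlap of an element of $\mathcal{R}^2$ with $p$. Basis of Ext. The minimal graded projective resolution of $\Lambda_0$ has $P^n=\bigoplus_{R^n\in\mathcal{R}^n}t(R^n)\Lambda$ with $d^n:t(R^n)\mapsto t(R^{n-1})p$ where $R^n=R^{n-1}p$. Listing $\mathcal{R}^n=\{R^n_i\}$, let $f^n=\{f^n_i\}$ be the basis of $\operatorname{Ext}^n_\Lambda(\Lambda_0,\Lambda_0)$ with $f^n_i:P^n\to\Lambda_0$, $t(R^n_i)\mapsto t(R^n_i)+\mathfrak{r}$, $t(R^n_j)\mapsto0$ for $j\neq i$. Products in the Ext algebra (right modules, maps composed right to left) satisfy: $f^m_jf^n_i\neq0$ if and only if $R^n_iR^m_j=R^{n+m}_k\in\mathcal{R}^{n+m}$ for some $k$, and then $f^m_jf^n_i=f^{n+m}_k$.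 Quiver $\Delta$ and ideal $I_\Delta$. $\Delta$ has vertex set $f^0$ and arrow set $f^1\cup f^2\cup f^3$; an arrow $f^n_i$ corresponding to $R^n_i$ from $e$ to $e'$ in $\mathcal{Q}$ satisfies $f^n_i=f^0_{e'}f^n_if^0_e$, i.e. in $\Delta$ it goes from (the vertex corresponding to) $e'$ to $e$, paths in $\Delta$ being read left to right. $I_\Delta$ is the ideal of $K\Delta$ generated by the paths $f^{n_1}_{i_1}\cdots f^{n_r}_{i_r}$ for which $R^{n_r}_{i_r}\cdots R^{n_1}_{i_1}\notin\mathcal{R}^{n_1+\cdots+n_r}$, and by the elements $f^{n_1}_{i_1}\cdots f^{n_r}_{i_r}-f^{m_1}_{j_1}\cdots f^{m_s}_{j_s}$ for which $R^{n_r}_{i_r}\cdots R^{n_1}_{i_1}=R^{m_s}_{j_s}\cdots R^{m_1}_{j_1}$ as paths in $K\mathcal{Q}$ and $n_1+\cdots+n_r=m_1+\cdots+m_s$ (all $n_i,m_i\in\{1,2,3\}$). The set $\mathcal{H}_\Delta$. It is known that if $bc\neq0$ in $\operatorname{Ext}^5_\Lambda(\Lambda_0,\Lambda_0)$ ($b\in f^2,c\in f^3$) then $bc=c'b'$ there for some $b'\in f^2,c'\in f^3$. $\mathcal{H}_\Delta$ consists of all (composable) paths in $K\Delta$ of the form $aa',ab,ba,ac,ca,cc'$, together with: $bb'$ whenever $bb'=0$ in $\operatorname{Ext}^4_\Lambda(\Lambda_0,\Lambda_0)$; $bc$ whenever $bc=0$ in $\operatorname{Ext}^5_\Lambda(\Lambda_0,\Lambda_0)$;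 $cb$ whenever $cb=0$ in $\operatorname{Ext}^5_\Lambda(\Lambda_0,\Lambda_0)$; and $bc-c'b'$ whenever $bc\neq0$ and $bc=c'b'$ in $\operatorname{Ext}^5_\Lambda(\Lambda_0,\Lambda_0)$; for all $a,a'\in f^1$, $b,b'\in f^2$, $c,c'\in f^3$. Gröbner bases. Left length lexicographic order: given a total order on vertices and arrows with every vertex below every arrow, for paths $p=\alpha_1\cdots\alpha_n$, $q=\beta_1\cdots\beta_m$ (products of arrows), $p>q$ if $n>m$, or $n=m$ and for some $i$, $\alpha_j=\beta_j$ for $j<i$ and $\alpha_i>\beta_i$. For $0\neq x\in K\Delta$, $\operatorname{Tip}(x)$ is the largest path occurring in $x$ with non-zero coefficient. A Gröbner basis of an ideal $J$ is a non-empty subset $G\subseteq J$ such that the tip of each non-zero element of $J$ is divisible by (i.e. contains as a subpath) the tip of some element of $G$. It is reduced if each element of $G$ has tip coefficient $1$ and no path occurring in an element $g\in G$ is divisible by the tip of another element of $G$. Quadratic means that its elements are linear combinations of paths of length $2$.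
   Formalization: Since a Gröbner basis is required to be non-empty, the claim fails when the set H_Δ is empty (e.g. one vertex, no arrows); the formal statement adds exactly this case as an alternative: H_Δ is empty and I_Δ = 0. *)

(* Defs.v *)
From HB Require Import structures.
From mathcomp Require Import all_boot all_algebra finmap.
From mathcomp Require Import boolp classical_sets.
From mathcomp Require Import multinomials.monalg.
Set Implicit Arguments.
Unset Strict Implicit.
Unset Printing Implicit Defensive.
Import GRing.Theory.
Local Open Scope ring_scope.

Record quiver := Quiver {
  vertex : finType;
  arrow : choiceType;
  src : arrow -> vertex;
  tgt : arrow -> vertex }.

Section Paths.
Variable Q : quiver.

Fixpoint chain (v : vertex Q) (s : seq (arrow Q)) : bool :=
  if s is a :: s' then (src a == v) && chain (tgt a) s' else true.

Record qpath := QPath { pdata : vertex Q * seq (arrow Q); _ : chain pdata.1 pdata.2 }.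
HB.instance Definition _ := [isSub for pdata].
HB.instance Definition _ := [Choice of qpath by <:].

Definition pstart (p : qpath) : vertex Q := (pdata p).1.
Definition parrows (p : qpath) : seq (arrow Q) := (pdata p).2.
Definition pend (p : qpath) : vertex Q := last (pstart p) (map (@tgt Q) (parrows p)).
Definition plen (p : qpath) : nat := size (parrows p).

Definition pvertex (v : vertex Q) : qpath := @QPath (v, [::]) isT.
Lemma parrow_subproof (a : arrow Q) : chain (src a) [:: a].
Proof. by rewrite /= eqxx. Qed.
Definition parrow (a : arrow Q) : qpath := @QPath (src a, [:: a]) (parrow_subproof a).

Definition pcomp (p q : qpath) : option qpath :=
  if pend p == pstart q then insub (pstart p, parrows p ++ parrows q) else None.

Lemma chain_cat v s1 s2 :
  chain v (s1 ++ s2) = chain v s1 && chain (last v (map (@tgt Q) s1)) s2.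
Proof. by elim: s1 v => //= a s IH v; rewrite IH andbA. Qed.

Lemma pcompP p q r : pcomp p q = Some r <->
  [/\ pend p = pstart q, pstart r = pstart p & parrows r = parrows p ++ parrows q].
Proof.
rewrite /pcomp; split.
  case: eqP => // e; case: insubP => // u _ hu [<-].
  have hu' : pdata u = (pstart p, parrows p ++ parrows q) := hu.
  by rewrite /pstart /parrows hu'.
case=> e hs ha; rewrite e eqxx -hs -ha.
have -> : (pstart r, parrows r) = val r by rewrite /pstart /parrows; case: (r) => -[].
by rewrite valK.
Qed.

Lemma pchain p : chain (pstart p) (parrows p).
Proof. by case: p. Qed.

Lemma pcomp_some p q : pend p = pstart q -> exists r, pcomp p q = Some r.
Proof.
move=> e; rewrite /pcomp e eqxx.
case: insubP; first by move=> u _ _; exists u.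
by rewrite /= chain_cat pchain -[last _ _]/(pend p) e pchain.
Qed.

Lemma pcomp_none p q : pend p <> pstart q -> pcomp p q = None.
Proof. by rewrite /pcomp => /eqP /negPf ->. Qed.

Lemma pend_comp p q r : pcomp p q = Some r -> pend r = pend q.
Proof.
case/pcompP => e hs ha; rewrite /pend hs ha map_cat last_cat.
by rewrite -[last (pstart p) _]/(pend p) e.
Qed.

Lemma pcompA p q r :
  obind (pcomp p) (pcomp q r) = obind (fun x => pcomp x r) (pcomp p q).
Proof.
have [e1|n1] := eqVneq (pend p) (pstart q); last first.
  rewrite [pcomp p q]pcomp_none /=; last exact/eqP.
  case E: (pcomp q r) => [x|] //=; apply: pcomp_none.
  by case/pcompP: E => _ -> _; apply/eqP.
have [x Ex] := pcomp_some e1; rewrite Ex /=.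
have [e2|n2] := eqVneq (pend q) (pstart r); last first.
  rewrite [pcomp q r]pcomp_none /=; last exact/eqP.
  by rewrite pcomp_none // (pend_comp Ex); apply/eqP.
have [y Ey] := pcomp_some e2; rewrite Ey /=.
have e3 : pend p = pstart y by case/pcompP: Ey => _ -> _.
have [z Ez] := pcomp_some e3; rewrite Ez; symmetry; apply/pcompP.
case/pcompP: Ez => _ h1 h2; case/pcompP: Ey => _ h3 h4; case/pcompP: Ex => _ h5 h6.
split; first by rewrite (pend_comp (q:=q) (p:=p)) //; apply/pcompP.
  by rewrite h1 h5.
by rewrite h2 h4 h6 catA.
Qed.

Lemma pcomp_vl v q : pcomp (pvertex v) q = if v == pstart q then Some q else None.
Proof.
have [->|n] := eqVneq v (pstart q); first by apply/pcompP.
by rewrite pcomp_none //; apply/eqP.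
Qed.

Lemma pcomp_vr p v : pcomp p (pvertex v) = if v == pend p then Some p else None.
Proof.
have [->|n] := eqVneq v (pend p); first by apply/pcompP; split=> //; rewrite cats0.
by rewrite pcomp_none //; apply/eqP; rewrite eq_sym.
Qed.

Definition subpath (q p : qpath) : Prop :=
  exists u v w, pcomp u q = Some w /\ pcomp w v = Some p.

Definition proper_prefix (q p : qpath) : Prop :=
  exists2 u, pcomp q u = Some p & (0 < plen u)%N.

Definition overlaps (q p x : qpath) : Prop :=
  exists u v, [/\ pcomp p u = Some x, pcomp v q = Some x & (1 <= plen u < plen q)%N].

End Paths.

Definition pathalg (K : fieldType) (Q : quiver) := {malg K[qpath Q]}.
HB.instance Definition _ K Q := GRing.Lmodule.on (pathalg K Q).

HB.lock Definition pelt (K : fieldType) (Q : quiver) (p : qpath Q) : pathalg K Q :=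
  << p >>.

Definition pelt_opt (K : fieldType) (Q : quiver) (o : option (qpath Q)) : pathalg K Q :=
  if o is Some p then pelt K p else 0.

HB.lock Definition pamul (K : fieldType) (Q : quiver) (x y : pathalg K Q) : pathalg K Q :=
  \sum_(p <- msupp x) \sum_(q <- msupp y) (x@_p * y@_q) *: pelt_opt K (pcomp p q).

Section PathAlgebra.
Variables (K : fieldType) (Q : quiver).
Local Notation pathalg := (pathalg K Q).
Local Notation pelt := (pelt K).
Local Notation pelt_opt := (pelt_opt K).
Local Notation pamul := (@pamul K Q).

Definition paone : pathalg := \sum_v pelt (pvertex v).

Lemma msum_wid (V : lmodType K) (h : qpath Q -> V) (x : pathalg) (d : {fset qpath Q}) :
  (msupp x `<=` d)%fset ->
  \sum_(p <- msupp x) x@_p *: h p = \sum_(p <- d) x@_p *: h p.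
Proof.
move=> le; rewrite (big_fset_incl _ le) // => p _ /mcoeff_outdom ->.
by rewrite scale0r.
Qed.

Lemma msum_lin (V : lmodType K) (h : qpath Q -> V) (a : K) (x y : pathalg) :
  \sum_(p <- msupp (a *: x + y)) (a *: x + y)@_p *: h p =
  a *: (\sum_(p <- msupp x) x@_p *: h p) + \sum_(p <- msupp y) y@_p *: h p.
Proof.
pose d := (msupp (a *: x + y) `|` (msupp x `|` msupp y))%fset.
rewrite (@msum_wid _ _ _ d) ?fsubsetUl //.
rewrite (@msum_wid _ _ x d); last first.
  by rewrite /d; apply: fsubset_trans (fsubsetUr _ _); apply: fsubsetUl.
rewrite (@msum_wid _ _ y d); last first.
  by rewrite /d; apply: fsubset_trans (fsubsetUr _ _); apply: fsubsetUr.
rewrite scaler_sumr -big_split /=; apply: eq_bigr => p _.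
by rewrite mcoeffD mcoeffZ scalerDl scalerA.
Qed.

Lemma pamulE x y : pamul x y =
  \sum_(p <- msupp x) x@_p *: (\sum_(q <- msupp y) y@_q *: pelt_opt (pcomp p q)).
Proof.
rewrite pamul.unlock; apply: eq_bigr => p _; rewrite scaler_sumr; apply: eq_bigr => q _.
by rewrite scalerA.
Qed.

Lemma pamul_linl a x y z : pamul (a *: x + y) z = a *: pamul x z + pamul y z.
Proof. by rewrite !pamulE msum_lin. Qed.

Lemma pamul_linr a x y z : pamul z (a *: x + y) = a *: pamul z x + pamul z y.
Proof.
rewrite !pamulE scaler_sumr -big_split /=; apply: eq_bigr => p _.
by rewrite msum_lin scalerDr !scalerA mulrC.
Qed.

Lemma pamulDl : left_distributive pamul +%R.
Proof. by move=> x y z; rewrite -[x]scale1r pamul_linl !scale1r. Qed.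
Lemma pamulDr : right_distributive pamul +%R.
Proof. by move=> z x y; rewrite -[x]scale1r pamul_linr !scale1r. Qed.
Lemma pamul0l x : pamul 0 x = 0.
Proof. by rewrite pamulE msupp0 big_seq_fset0. Qed.
Lemma pamul0r x : pamul x 0 = 0.
Proof. by rewrite pamulE big1 // => p _; rewrite msupp0 big_seq_fset0 scaler0. Qed.
Lemma pamulZl a x y : pamul (a *: x) y = a *: pamul x y.
Proof. by rewrite -[a *: x]addr0 pamul_linl pamul0l addr0. Qed.
Lemma pamulZr a x y : pamul x (a *: y) = a *: pamul x y.
Proof. by rewrite -[a *: y]addr0 pamul_linr pamul0r addr0. Qed.
Lemma pamul_suml (J : Type) (r : seq J) (F : J -> pathalg) y :
  pamul (\sum_(j <- r) F j) y = \sum_(j <- r) pamul (F j) y.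
Proof.
by elim: r => [|j r IH]; rewrite ?big_nil ?pamul0l // !big_cons pamulDl IH.
Qed.
Lemma pamul_sumr (J : Type) (r : seq J) (F : J -> pathalg) y :
  pamul y (\sum_(j <- r) F j) = \sum_(j <- r) pamul y (F j).
Proof.
by elim: r => [|j r IH]; rewrite ?big_nil ?pamul0r // !big_cons pamulDr IH.
Qed.

Lemma pathalgE (x : pathalg) : x = \sum_(p <- msupp x) x@_p *: pelt p.
Proof.
have scaleU (c : K) (p : qpath Q) : << c *g p >> = c *: << p >> :> {malg K[qpath Q]}.
  by apply/malgP => q; rewrite mcoeffZ [LHS]mcoeffU [X in _ * X]mcoeffU mulr_natr.
by rewrite {1}[x]monalgE; apply: eq_bigr => p _; rewrite pelt.unlock; apply: scaleU.
Qed.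

Lemma msupp_pelt (p : qpath Q) : msupp (pelt p) = [fset p]%fset.
Proof. by rewrite pelt.unlock msuppU oner_eq0. Qed.
Lemma mcoeff_pelt (p : qpath Q) : (pelt p)@_p = 1.
Proof. by rewrite pelt.unlock mcoeffUU. Qed.

Lemma pamulU p q : pamul (pelt p) (pelt q) = pelt_opt (pcomp p q).
Proof.
by rewrite pamulE !msupp_pelt !big_seq_fset1 !mcoeff_pelt !scale1r.
Qed.

Lemma pamulUo p o : pamul (pelt p) (pelt_opt o) = pelt_opt (obind (pcomp p) o).
Proof. by case: o => [q|] /=; rewrite ?pamulU ?pamul0r. Qed.
Lemma pamuloU o q : pamul (pelt_opt o) (pelt q) = pelt_opt (obind (fun x => pcomp x q) o).
Proof. by case: o => [p|] /=; rewrite ?pamulU ?pamul0l. Qed.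

Lemma pathalg_ind (P : pathalg -> Prop) :
  P 0 -> (forall a p x, P x -> P (a *: pelt p + x)) -> forall x, P x.
Proof.
move=> P0 PS x; have := pathalgE x.
move: (enum_fset _) (fun p => x@_p) => s c ->.
elim: s => [|p s IH]; first by rewrite big_nil.
by rewrite big_cons; exact: (PS _ p).
Qed.

Lemma pacongr a (u v w : pathalg) : u = v -> a *: u + w = a *: v + w.
Proof. by move=> ->. Qed.

Lemma pamulA : associative pamul.
Proof.
move=> x y z; elim/pathalg_ind: x => [|a p x IHx]; first by rewrite !pamul0l.
rewrite !pamul_linl IHx; apply: pacongr => {IHx x}.
elim/pathalg_ind: y => [|b q y IHy]; first by rewrite !(pamul0l, pamul0r).
rewrite !(pamul_linl, pamul_linr) IHy; apply: pacongr => {IHy y}.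
elim/pathalg_ind: z => [|c r z IHz]; first by rewrite !pamul0r.
rewrite !pamul_linr IHz; apply: pacongr.
by rewrite (pamulU q r) (pamulU p q) pamulUo pamuloU pcompA.
Qed.

Lemma pamul1l : left_id paone pamul.
Proof.
move=> x; elim/pathalg_ind: x => [|a p x IHx]; first by rewrite pamul0r.
rewrite pamul_linr IHx; apply: pacongr.
rewrite /paone pamul_suml (bigD1 (pstart p)) //=.
rewrite pamulU pcomp_vl eqxx /= big1 ?addr0 // => v n.
by rewrite pamulU pcomp_vl (negPf n).
Qed.

Lemma pamul1r : right_id paone pamul.
Proof.
move=> x; elim/pathalg_ind: x => [|a p x IHx]; first by rewrite pamul0l.
rewrite pamul_linl IHx; apply: pacongr.
rewrite /paone pamul_sumr (bigD1 (pend p)) //=.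
rewrite pamulU pcomp_vr eqxx /= big1 ?addr0 // => v n.
by rewrite pamulU pcomp_vr (negPf n).
Qed.

HB.instance Definition _ := GRing.Zmodule_isPzRing.Build pathalg
  pamulA pamul1l pamul1r pamulDl pamulDr.
End PathAlgebra.

HB.mixin Record isTwoSidedIdeal (R : pzRingType) (J : {pred R}) := {
  tsideal_mull : forall a x, x \in J -> a * x \in J;
  tsideal_mulr : forall a x, x \in J -> x * a \in J }.
#[short(type="tsideal")]
HB.structure Definition TwoSidedIdeal (R : pzRingType) :=
  {J of GRing.ZmodClosed R J & isTwoSidedIdeal R J}.

Section GeneratedIdeal.
Variables (R : pzRingType) (S : set R).

Definition ideal_gen : {pred R} :=
  [pred x | `[< forall J : tsideal R, (forall y, S y -> y \in J) -> x \in J >]].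

Lemma ideal_gen_zmod : zmod_closed ideal_gen.
Proof.
split; first by apply/asboolP => J _; exact: rpred0.
move=> x y /asboolP hx /asboolP hy; apply/asboolP => J hJ.
by apply: rpredB; [exact: hx|exact: hy].
Qed.
HB.instance Definition _ := GRing.isZmodClosed.Build R ideal_gen ideal_gen_zmod.

Lemma ideal_gen_mull a x : x \in ideal_gen -> a * x \in ideal_gen.
Proof. by move=> /asboolP hx; apply/asboolP => J hJ; apply/tsideal_mull/hx. Qed.
Lemma ideal_gen_mulr a x : x \in ideal_gen -> x * a \in ideal_gen.
Proof. by move=> /asboolP hx; apply/asboolP => J hJ; apply/tsideal_mulr/hx. Qed.
HB.instance Definition _ :=
  isTwoSidedIdeal.Build R ideal_gen ideal_gen_mull ideal_gen_mulr.
End GeneratedIdeal.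

(* A right R-module is a left module over the opposite ring R^c: for m in
   M : lmodType R^c, the term a *: m stands for the product m a. *)
Notation rmodType R := (lmodType R^c).

Section Quotient.
Variables (R : pzRingType) (J : tsideal R).
Local Open Scope quotient_scope.

Definition quo := Quotient.quot J.
HB.instance Definition _ := GRing.Zmodule.on quo.

Definition qpi (x : R) : quo := \pi_(Quotient.quot J) x.

Lemma qpi_eq x y : qpi x = qpi y <-> x - y \in J.
Proof. by rewrite Quotient.idealrBE; split=> [/eqP|/eqP]. Qed.
Lemma qpi_surj (x : quo) : exists y, x = qpi y.
Proof. by exists (repr (x : Quotient.quot J)); rewrite /qpi reprK. Qed.
Lemma qpiD : {morph qpi : x y / x + y}.
Proof. by move=> x y; rewrite /qpi (Quotient.pi_add J). Qed.
Lemma qpiB : {morph qpi : x y / x - y}.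
Proof. by move=> x y; rewrite /qpi (Quotient.pi_add J) (Quotient.pi_opp J). Qed.

Definition quo_repr (x : quo) : R := repr (x : Quotient.quot J).
Lemma quo_reprK x : qpi (quo_repr x) = x.
Proof. exact: reprK. Qed.
Lemma quo_reprB x : quo_repr (qpi x) - x \in J.
Proof. by apply/qpi_eq; rewrite quo_reprK. Qed.

Definition quo_mul (x y : quo) : quo := qpi (quo_repr x * quo_repr y).
Lemma qpiM_def x y : quo_mul (qpi x) (qpi y) = qpi (x * y).
Proof.
apply/qpi_eq.
have -> : quo_repr (qpi x) * quo_repr (qpi y) - x * y =
    (quo_repr (qpi x) - x) * quo_repr (qpi y) + x * (quo_repr (qpi y) - y).
  by rewrite mulrBl mulrBr addrA subrK.
by apply: rpredD; [apply: tsideal_mulr|apply: tsideal_mull]; exact: quo_reprB.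
Qed.

Lemma quo_mulA : associative quo_mul.
Proof.
move=> x y z; rewrite -(quo_reprK x) -(quo_reprK y) -(quo_reprK z).
by rewrite !qpiM_def mulrA.
Qed.
Lemma quo_mul1l : left_id (qpi 1) quo_mul.
Proof. by move=> x; rewrite -(quo_reprK x) qpiM_def mul1r. Qed.
Lemma quo_mul1r : right_id (qpi 1) quo_mul.
Proof. by move=> x; rewrite -(quo_reprK x) qpiM_def mulr1. Qed.
Lemma quo_mulDl : left_distributive quo_mul +%R.
Proof.
move=> x y z; rewrite -(quo_reprK x) -(quo_reprK y) -(quo_reprK z).
by rewrite -qpiD !qpiM_def -qpiD mulrDl.
Qed.
Lemma quo_mulDr : right_distributive quo_mul +%R.
Proof.
move=> x y z; rewrite -(quo_reprK x) -(quo_reprK y) -(quo_reprK z).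
by rewrite -qpiD !qpiM_def -qpiD mulrDr.
Qed.
HB.instance Definition _ := GRing.Zmodule_isPzRing.Build quo
  quo_mulA quo_mul1l quo_mul1r quo_mulDl quo_mulDr.

Lemma qpiM : {morph qpi : x y / x * y}.
Proof. by move=> x y; exact: esym (qpiM_def x y). Qed.

Definition quo_scale (a : R^c) (x : quo) : quo := x * qpi a.
Lemma quo_scaleA a b x : quo_scale a (quo_scale b x) = quo_scale (a * b) x.
Proof. by rewrite /quo_scale -mulrA -qpiM. Qed.
Lemma quo_scale1 : left_id 1 quo_scale.
Proof. by move=> x; exact: mulr1. Qed.
Lemma quo_scaleDr : right_distributive quo_scale +%R.
Proof. by move=> a x y; exact: mulrDl. Qed.
Lemma quo_scaleDl x : {morph quo_scale^~ x : a b / a + b}.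
Proof. by move=> a b; rewrite /quo_scale qpiD mulrDr. Qed.
HB.instance Definition _ := GRing.Zmodule_isLmodule.Build R^c quo
  quo_scaleA quo_scale1 quo_scaleDr quo_scaleDl.
End Quotient.

(* The free right R-module on T; x@_k is the coordinate of x at k. *)
Section FreeRightModule.
Variables (R : pzRingType) (T : choiceType).

Definition rfree := {malg R[T]}.
HB.instance Definition _ := GRing.Zmodule.on rfree.

Definition rfree_scale (a : R^c) (x : rfree) : rfree :=
  [malg k in msupp x => x@_k * (a : R)].
Lemma rfree_scaleE a x k : (rfree_scale a x)@_k = x@_k * (a : R).
Proof.
rewrite /rfree_scale mcoeffE; case: ifPn => // /mcoeff_outdom ->.
by rewrite mul0r.
Qed.
Lemma rfree_scaleA a b x : rfree_scale a (rfree_scale b x) = rfree_scale (a * b) x.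
Proof. by apply/malgP => k; rewrite !rfree_scaleE mulrA. Qed.
Lemma rfree_scale1 : left_id 1 rfree_scale.
Proof. by move=> x; apply/malgP => k; rewrite rfree_scaleE mulr1. Qed.
Lemma rfree_scaleDr : right_distributive rfree_scale +%R.
Proof.
by move=> a x y; apply/malgP => k; rewrite !(rfree_scaleE, mcoeffD) mulrDl.
Qed.
Lemma rfree_scaleDl x : {morph rfree_scale^~ x : a b / a + b}.
Proof.
by move=> a b; apply/malgP => k; rewrite !(rfree_scaleE, mcoeffD) mulrDr.
Qed.
HB.instance Definition _ := GRing.Zmodule_isLmodule.Build R^c rfree
  rfree_scaleA rfree_scale1 rfree_scaleDr rfree_scaleDl.
End FreeRightModule.

Section GradedModules.
Variables (L : pzRingType) (Lgr : nat -> set L) (rad : tsideal L).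

Record module_grading (M : rmodType L) (gr : int -> set M) : Prop := {
  grading0 : forall i, gr i 0;
  gradingD : forall i x y, gr i x -> gr i y -> gr i (x + y);
  gradingZ : forall i j x (a : L), gr i x -> Lgr j a -> gr (i + j%:Z) ((a : L^c) *: x);
  grading_sum : forall x, exists (s : seq int) (c : int -> M),
    (forall i, gr i (c i)) /\ x = \sum_(i <- s) c i;
  grading_direct : forall (s : seq int) (c : int -> M), uniq s ->
    (forall i, gr i (c i)) -> \sum_(i <- s) c i = 0 -> forall i, i \in s -> c i = 0 }.

Definition generated_in (M : rmodType L) (gr : int -> set M) (j : int) : Prop :=
  forall x : M, exists s : seq (L * M),
    (forall y, y \in s -> gr j y.2) /\ x = \sum_(y <- s) (y.1 : L^c) *: y.2.

Definition in_mulrad (M : rmodType L) (x : M) : Prop :=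
  exists s : seq (L * M),
    (forall y, y \in s -> y.1 \in rad) /\ x = \sum_(y <- s) (y.1 : L^c) *: y.2.

Definition projective (M : rmodType L) : Prop :=
  forall (X Y : rmodType L) (g : {linear X -> Y}) (f : {linear M -> Y}),
    (forall y, exists x, g x = y) -> exists h : {linear M -> X}, forall m, g (h m) = f m.

(* The module L / rad being resolved is graded in degree 0. *)
Record minimal_graded_projective_resolution (P : nat -> rmodType L)
    (gr : forall n, int -> set (P n)) (d : forall n, {linear P n.+1 -> P n})
    (eps : {linear P 0 -> (quo rad : rmodType L)}) : Prop := {
  mgpr_graded : forall n, module_grading (gr n);
  mgpr_projective : forall n, projective (P n);
  mgpr_d_degree : forall n i x, gr n.+1 i x -> gr n i (d n x);
  mgpr_eps_degree : forall i x, gr 0%N i x -> i <> 0 -> eps x = 0;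
  mgpr_eps_surj : forall y, exists x, eps x = y;
  mgpr_exact0 : forall x, eps x = 0 <-> exists y, x = d 0%N y;
  mgpr_exact : forall n x, d n x = 0 <-> exists y, x = d n.+1 y;
  mgpr_minimal : forall n x, in_mulrad (d n x) }.

End GradedModules.

Section Quotients.
Variables (K : fieldType) (Q : quiver) (I : tsideal (pathalg K Q)).
Local Notation Lam := (quo I).

Definition lam_gr (j : nat) : set Lam :=
  fun y => exists2 x : pathalg K Q, (forall p, p \in msupp x -> plen p = j) & y = qpi I x.

(* The sum of the Lambda_j with j >= 1 is an ideal, so it is the ideal these
   components generate. *)
Definition lam_rad : tsideal Lam :=
  ideal_gen (fun y => exists2 j, (0 < j)%N & lam_gr j y).

Definition lam0 : rmodType Lam := quo lam_rad.

Definition delta (D A n : nat) : nat :=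
  (if n == 0 then 0
   else if n == 1 then 1
   else if odd n then n./2 * D + A else n./2 * D)%N.

(* A minimal graded projective resolution is unique up to isomorphism, hence the
   universal quantifier; for n > gldim its nth term is 0, which is generated in
   every degree, so n needs no upper bound. *)
Definition stacked (D A : nat) : Prop :=
  forall (P : nat -> rmodType Lam) (gr : forall n, int -> set (P n))
    (d : forall n, {linear P n.+1 -> P n}) (eps : {linear P 0 -> lam0}),
    minimal_graded_projective_resolution lam_gr gr d eps ->
    forall n, generated_in (gr n) (delta D A n)%:Z.

(* The elements all of whose paths have length at least k form the kth power of
   the arrow ideal. *)
Definition arrow_power (k : nat) : set (pathalg K Q) :=
  fun x => forall p, p \in msupp x -> (k <= plen p)%N.

Definition admissible : Prop :=
  (forall x, x \in I -> arrow_power 2 x) /\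
  exists2 N, (2 <= N)%N & forall x, arrow_power N x -> x \in I.

Definition generated_by_paths (S : set (qpath Q)) : Prop :=
  forall x, (x \in I) = (x \in ideal_gen (fun y => exists2 p, S p & y = pelt K p)).

Definition minimal_generating_paths (S : set (qpath Q)) : Prop :=
  generated_by_paths S /\
  forall S' : set (qpath Q), (forall p, S' p -> S p) -> generated_by_paths S' ->
    forall p, S p -> S' p.
End Quotients.

Definition finite_quiver (Q : quiver) : Prop :=
  exists s : seq (arrow Q), forall a, a \in s.

Section Overlaps.
Variables (Q : quiver) (R2 : set (qpath Q)).

Definition next_paths (Rn2 Rn1 : set (qpath Q)) : set (qpath Q) := fun x =>
  exists r r' p u pu,
    [/\ Rn1 r, Rn2 r', pcomp r' p = Some r, pcomp r u = Some x & pcomp p u = Some pu] /\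
    (exists2 q, R2 q & overlaps q p pu) /\
    (forall y q, proper_prefix y pu -> R2 q -> ~ overlaps q p y).

Fixpoint Rset (n : nat) : set (qpath Q) :=
  match n with
  | 0 => fun p => plen p = 0%N
  | 1 => fun p => plen p = 1%N
  | S (S k as m) => if k is 0 then R2 else next_paths (Rset k) (Rset m)
  end.
End Overlaps.

Section Cut.
Variable Q : quiver.
Implicit Type p : qpath Q.

Lemma ptake_subproof i p : chain (pstart p) (take i (parrows p)).
Proof. by have := pchain p; rewrite -{1}(cat_take_drop i (parrows p)) chain_cat => /andP[]. Qed.
Definition ptake i p : qpath Q :=
  @QPath Q (pstart p, take i (parrows p)) (ptake_subproof i p).

Lemma pdrop_subproof i p : chain (pend (ptake i p)) (drop i (parrows p)).
Proof. by have := pchain p; rewrite -{1}(cat_take_drop i (parrows p)) chain_cat => /andP[]. Qed.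
Definition pdrop i p : qpath Q :=
  @QPath Q (pend (ptake i p), drop i (parrows p)) (pdrop_subproof i p).
End Cut.

Section Resolution.
Variables (K : fieldType) (Q : quiver) (I : tsideal (pathalg K Q)).
Variable R2 : set (qpath Q).
Local Notation Lam := (quo I).
Local Notation Rtype n := (set_type (Rset R2 n)).
Local Notation lam0 := (lam0 I).
Local Notation inLam p := (qpi I (pelt K p)).

(* P^n is the submodule of the free module on R^n whose coordinate at R lies in
   t(R) Lambda. *)
Definition res_pred n : {pred rfree Lam (Rtype n)} :=
  [pred x | `[< forall k, inLam (pvertex (pend (val k))) * x@_k = x@_k >]].

Lemma res_submod n : GRing.submod_closed (@res_pred n).
Proof.
split; first by apply/asboolP => k; rewrite mcoeff0 mulr0.
move=> a x y /asboolP hx /asboolP hy; apply/asboolP => k.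
have E : (a *: x + y)@_k = x@_k * (a : Lam) + y@_k.
  by rewrite mcoeffD; congr (_ + _); exact: rfree_scaleE.
by rewrite E mulrDr mulrA hx hy.
Qed.
HB.instance Definition _ n :=
  GRing.isSubmodClosed.Build _ _ (@res_pred n) (@res_submod n).

Definition res n := {x : rfree Lam (Rtype n) | x \in @res_pred n}.
HB.instance Definition _ n := Choice.on (res n).
HB.instance Definition _ n := SubChoice.on (res n).
HB.instance Definition _ n := [SubChoice_isSubLmodule of res n by <:].

(* On the generator t(R) of the summand indexed by R = R' p in R^(n+1), with R'
   in R^n, the differential takes the value t(R') p. *)
Definition res_d_val n (x : res n.+1) : rfree Lam (Rtype n) :=
  \sum_(k <- msupp (val x)) \sum_(i < (plen (val k)).+1)
    if insub (ptake i (val k)) is Some k' then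
      << inLam (pdrop i (val k)) * (val x)@_k *g k' >>
    else 0.

Lemma res_d_subproof n (x : res n.+1) : res_d_val x \in @res_pred n.
Proof.
rewrite /res_d_val; apply: rpred_sum => k _; apply: rpred_sum => i _.
case: insubP => [k' _ ek'|_]; last exact: rpred0.
apply/asboolP => j; rewrite mcoeffU; case: eqP => [<-|_]; last by rewrite mulr0n mulr0.
rewrite mulr1n mulrA; congr (_ * _); rewrite -qpiM.
suff -> : pelt K (pvertex (pend (val k'))) * pelt K (pdrop i (val k)) =
    pelt K (pdrop i (val k)) by [].
by rewrite [LHS]pamulU pcomp_vl [val k']ek' eqxx.
Qed.
Definition res_d n (x : res n.+1) : res n := exist _ (res_d_val x) (res_d_subproof x).

Definition res_eps (x : res 0) : lam0 :=
  \sum_(k <- msupp (val x)) qpi (lam_rad I) (val x)@_k.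

Definition dual_basis n (k : Rtype n) (x : res n) : lam0 :=
  qpi (lam_rad I) (val x)@_k.

(* Ext^(n+1): maps on P^(n+1) up to coboundaries. *)
Definition ext_eq n (h h' : res n.+1 -> lam0) : Prop :=
  exists u : {linear res n -> lam0}, forall x, h x - h' x = u (res_d x).

Definition chain_lift n (f : res n -> lam0)
    (phi : forall k, {linear res (k + n) -> res k}) : Prop :=
  (forall x, res_eps (phi 0%N x) = f x) /\
  (forall k (x : res (k.+1 + n)), res_d (phi k.+1 x) = phi k (res_d x)).

(* h represents the Yoneda product g f, maps being composed right to left. *)
Definition ext_mul m n (g : res m -> lam0) (f : res n -> lam0)
    (h : res (m + n) -> lam0) : Prop :=
  exists2 phi : forall k, {linear res (k + n) -> res k},
    chain_lift f phi & forall x, h x = g (phi m x).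

Definition mul_b_b_zero (b b' : Rtype 2) : Prop :=
  exists2 h : res 4 -> lam0,
    ext_mul (m:=2) (n:=2) (dual_basis b) (dual_basis b') h & ext_eq h (fun=> 0).
Definition mul_b_c_zero (b : Rtype 2) (c : Rtype 3) : Prop :=
  exists2 h : res 5 -> lam0,
    ext_mul (m:=2) (n:=3) (dual_basis b) (dual_basis c) h & ext_eq h (fun=> 0).
Definition mul_c_b_zero (c : Rtype 3) (b : Rtype 2) : Prop :=
  exists2 h : res 5 -> lam0,
    ext_mul (m:=3) (n:=2) (dual_basis c) (dual_basis b) h & ext_eq h (fun=> 0).
Definition mul_b_c_eq (b : Rtype 2) (c c' : Rtype 3) (b' : Rtype 2) : Prop :=
  exists h h' : res 5 -> lam0,
    [/\ ext_mul (m:=2) (n:=3) (dual_basis b) (dual_basis c) h,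
        ext_mul (m:=3) (n:=2) (dual_basis c') (dual_basis b') h' & ext_eq h h'].

End Resolution.

Section Delta.
Variables (Q : quiver) (R2 : set (qpath Q)).
Local Notation Rtype n := (set_type (Rset R2 n)).

Definition delta_arrow : choiceType := (Rtype 1 + Rtype 2 + Rtype 3)%type.

Definition darrow_deg (x : delta_arrow) : nat :=
  match x with inl (inl _) => 1 | inl (inr _) => 2 | inr _ => 3 end.
Definition darrow_path (x : delta_arrow) : qpath Q :=
  match x with inl (inl a) => val a | inl (inr b) => val b | inr c => val c end.

Definition Delta : quiver :=
  @Quiver (vertex Q) delta_arrow
    (fun x => pend (darrow_path x)) (fun x => pstart (darrow_path x)).

Definition arr1 (a : Rtype 1) : arrow Delta := inl (inl a).
Definition arr2 (b : Rtype 2) : arrow Delta := inl (inr b).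
Definition arr3 (c : Rtype 3) : arrow Delta := inr c.

Definition dpath_deg (w : qpath Delta) : nat :=
  \sum_(x <- parrows w) darrow_deg x.

(* For w = x_1 .. x_r this is the path R(x_r) .. R(x_1) of Q, where R(x) is the
   path underlying the arrow x. *)
Definition dpath_path (w : qpath Delta) : option (qpath Q) :=
  foldr (fun x o => obind (fun p => pcomp p (darrow_path x)) o)
    (Some (pvertex (pend w : vertex Q))) (parrows w).

Variable K : fieldType.

Inductive delta_relation : pathalg K Delta -> Prop :=
| DeltaZero (w : qpath Delta) :
    (0 < plen w)%N ->
    ~ (exists2 p, dpath_path w = Some p & Rset R2 (dpath_deg w) p) ->
    delta_relation (pelt K w)
| DeltaComm (w w' : qpath Delta) :
    (0 < plen w)%N -> (0 < plen w')%N ->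
    dpath_path w = dpath_path w' -> dpath_deg w = dpath_deg w' ->
    delta_relation (pelt K w - pelt K w').

Definition I_Delta : tsideal (pathalg K Delta) := ideal_gen delta_relation.

Variable I : tsideal (pathalg K Q).

Definition path2 (x y : arrow Delta) (w : qpath Delta) : Prop :=
  pcomp (parrow x) (parrow y) = Some w.

Inductive H_Delta : pathalg K Delta -> Prop :=
| H_aa a a' w : path2 (arr1 a) (arr1 a') w -> H_Delta (pelt K w)
| H_ab a b w : path2 (arr1 a) (arr2 b) w -> H_Delta (pelt K w)
| H_ba b a w : path2 (arr2 b) (arr1 a) w -> H_Delta (pelt K w)
| H_ac a c w : path2 (arr1 a) (arr3 c) w -> H_Delta (pelt K w)
| H_ca c a w : path2 (arr3 c) (arr1 a) w -> H_Delta (pelt K w)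
| H_cc c c' w : path2 (arr3 c) (arr3 c') w -> H_Delta (pelt K w)
| H_bb b b' w : path2 (arr2 b) (arr2 b') w -> mul_b_b_zero I b b' -> H_Delta (pelt K w)
| H_bc b c w : path2 (arr2 b) (arr3 c) w -> mul_b_c_zero I b c -> H_Delta (pelt K w)
| H_cb c b w : path2 (arr3 c) (arr2 b) w -> mul_c_b_zero I c b -> H_Delta (pelt K w)
| H_bccb b c c' b' w w' :
    path2 (arr2 b) (arr3 c) w -> path2 (arr3 c') (arr2 b') w' ->
    ~ mul_b_c_zero I b c -> mul_b_c_eq I b c c' b' ->
    H_Delta (pelt K w - pelt K w').

(* The order a_1 > .. > a_r > b_1 > .. > b_s > c_1 > .. > c_t > e_1 > .. > e_m,
   for arbitrary enumerations of f^0, f^1, f^2 and f^3. *)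
Definition delta_letter_order (gt : rel (vertex Delta + arrow Delta)) : Prop :=
  [/\ irreflexive gt, transitive gt,
      forall x y, x != y -> gt x y || gt y x,
      forall (x y : delta_arrow), (darrow_deg x < darrow_deg y)%N -> gt (inr x) (inr y) &
      forall (x : arrow Delta) (v : vertex Delta), gt (inr x) (inl v)].

End Delta.
Arguments H_Delta {Q} R2 {K} I _.

Section Groebner.
Variables (K : fieldType) (Q : quiver).
Variable gt : rel (vertex Q + arrow Q).

Definition letters (p : qpath Q) : seq (vertex Q + arrow Q) :=
  if parrows p is [::] then [:: inl (pstart p)] else map inr (parrows p).

Definition path_gt (p q : qpath Q) : Prop :=
  (plen q < plen p)%N \/
  plen p = plen q /\
  exists s x y t u, [/\ letters p = s ++ x :: t, letters q = s ++ y :: u & gt x y].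

Definition is_tip (x : pathalg K Q) (p : qpath Q) : Prop :=
  p \in msupp x /\ forall q, q \in msupp x -> q <> p -> path_gt p q.

Definition groebner_basis (J : {pred pathalg K Q}) (G : set (pathalg K Q)) : Prop :=
  [/\ exists g, G g,
      forall g, G g -> g \in J &
      forall x, x \in J -> x <> 0 ->
        exists g p q, [/\ G g, is_tip g q, is_tip x p & subpath q p]].

Definition reduced (G : set (pathalg K Q)) : Prop :=
  (forall g, G g -> exists2 p, is_tip g p & g@_p = 1) /\
  (forall g h p q, G g -> G h -> h <> g -> p \in msupp g -> is_tip h q -> ~ subpath q p).

Definition quadratic (G : set (pathalg K Q)) : Prop :=
  forall g, G g -> forall p, p \in msupp g -> plen p = 2%N.

Definition quadratic_reduced_groebner_basis (J : {pred pathalg K Q})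
    (G : set (pathalg K Q)) : Prop :=
  [/\ groebner_basis J G, reduced G & quadratic G].
End Groebner.

(* Main.v *)
(* The explicit modules t(R)Lambda form a minimal graded resolution, because a
   path killed by the differential contains a relation overlapping the end of an
   element of R^n, and the first such relation gives an element of R^(n+1). So
   the stacked hypothesis says that every element of R^n has length delta(n).
   Hence a path of length delta(n) lies in R^n exactly when it carries relations
   starting at 0, A, D, D + A, 2D, ... and R^4 nonempty forces D > 2A. Comparing
   lengths, the only products of generators of Delta lying in some R^n are
   single letters, powers b .. b and words b .. b c b .. b, and these are
   detected by their consecutive pairs.
   Summing coefficients over the paths of Delta with the same underlying path
   and the same degree gives functionals vanishing on I_Delta. A path containing
   no tip of H_Delta has the form a, b .. b or c b .. b, its underlying path lies
   in R^n, and it is the least in its fibre, so it cannot be the tip of an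
   element of I_Delta.
   The vanishing of the Ext products in H_Delta is decided by following one
   coefficient through an arbitrary lift of a cocycle. *)

From HB Require Import structures.
Require Import Defs.
From mathcomp Require Import zify.
From mathcomp Require Import all_boot all_algebra finmap.
From mathcomp Require Import boolp classical_sets.
From mathcomp Require Import multinomials.monalg.
Set Implicit Arguments.
Unset Strict Implicit.
Unset Printing Implicit Defensive.

(** * Words and overlaps *)

(** Coefficients can be followed because no element of R^n is a proper prefix of another: under the
    differential a given path then receives a contribution from one summand only, and nothing
    cancels. Exactness and the values of lifts are read off path by path. The obstacle is that R^n
    is defined greedily, each step taking the first overlap, and this is not visibly inherited by
    suffixes or preserved by gluing. Stacked lengths replace it by conditions on the positions of
    relations, which can be shifted and glued. The delicate shift is by an odd degree: it asks for a
    relation at distance 2A from a multiple of D, which no position delta(j) - D supplies. It comes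
    from the relations at distances A and D, whose gap D - A is itself the distance of two
    overlapping relations. *)

Lemma cat_le_split (X : Type) (s1 s2 t1 t2 : seq X) :
  s1 ++ t1 = s2 ++ t2 -> (size s1 <= size s2)%N ->
  exists d, s2 = s1 ++ d /\ t1 = d ++ t2.
Proof.
elim: s1 s2 => [|x s1 IH] [|y s2] //=; try by move=> -> _; exists [::].
- by move=> -> _; exists (y :: s2).
- by case=> <- /IH {}IH /IH [d [-> ->]]; exists d.
Qed.

Section Chains.
Variables (X : Type) (T : seq X -> Prop).

Definition bad (s : seq X) := exists l1 l l2, T l /\ s = l1 ++ l ++ l2.

Definition next_words (A B : seq X -> Prop) (s : seq X) := exists r p u,
  [/\ A r, B (r ++ p), s = r ++ p ++ u,
      exists v q, [/\ T q, p ++ u = v ++ q & (1 <= size u < size q)%N] &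
      forall u1 u2 v q, u = u1 ++ u2 -> (0 < size u2)%N -> T q ->
        p ++ u1 = v ++ q -> (1 <= size u1 < size q)%N -> False].

(* R^n on words of arrows; for n > 0 the word determines the path. *)
Fixpoint RL (n : nat) : seq X -> Prop :=
  match n with
  | 0 => fun s => size s = 0%N
  | 1 => fun s => size s = 1%N
  | S (S k as m) => if k is 0 then T else next_words (RL k) (RL m)
  end.

Lemma bad_cat l1 s l2 : bad s -> bad (l1 ++ s ++ l2).
Proof.
by move=> [a [l [b [Tl ->]]]]; exists (l1 ++ a), l, (b ++ l2); rewrite -!catA.
Qed.

Hypothesis T_size : forall l, T l -> (1 < size l)%N.
Hypothesis T_anti : forall l1 l l2, T l -> T (l1 ++ l ++ l2) -> l1 = [::] /\ l2 = [::].

(** The induction carries two consecutive degrees, as R^(n+2) refers to both. Once [r ++ p] agrees,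
    the shorter of two tails [u] would be an earlier overlap for the longer one, against its
    minimality. In degree 2 this is the antichain property of the relations. *)
Lemma RL_prefix_free n s1 s2 t1 t2 :
  RL n s1 -> RL n s2 -> s1 ++ t1 = s2 ++ t2 -> s1 = s2 /\ t1 = t2.
Proof.
pose PF n := forall s1 s2 t1 t2,
  RL n s1 -> RL n s2 -> s1 ++ t1 = s2 ++ t2 -> s1 = s2 /\ t1 = t2.
suff H : PF n /\ PF n.+1 by case: H => H _; exact: H.
elim: n {s1 s2 t1 t2} => [|n [IH0 IH1]].
  split=> s1 s2 t1 t2; first by move=> /size0nil -> /size0nil ->.
  by case: s1 => [|x [|? ?]] //; case: s2 => [|y [|? ?]] //= _ _ [-> ->].
split=> // s1 s2 t1 t2.
wlog le : s1 s2 t1 t2 / (size s1 <= size s2)%N => [W H1 H2 e|].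
  case/orP: (leq_total (size s1) (size s2)) => le; first exact: W.
  by case: (W _ _ _ _ le H2 H1 (esym e)).
case: n IH0 IH1 => [|n] IH0 IH1 H1 H2 e.
  have [d [e1 e2]] := cat_le_split e le; rewrite e2.
  by move: H2; rewrite e1 => /(T_anti (l1 := [::]) H1) [_ ->]; rewrite cats0.
case: H1 le e => r [p [u [Hr Hrp -> [v [q [Tq epu su]]] _]]] le e.
case: H2 e le => r' [p' [u' [Hr' Hrp' -> _ mn]]] e le.
have [e1 e2] := IH1 (r ++ p) (r' ++ p') (u ++ t1) (u' ++ t2) Hrp Hrp'
  ltac:(by rewrite -!catA; rewrite -!catA in e).
have [er ep] := IH0 _ _ _ _ Hr Hr' e1.
subst r' p'.
have [d [eu ed]] := cat_le_split e2 ltac:(by move: le; rewrite !size_cat; lia).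
case: d eu ed => [|x d] eu ed; first by rewrite eu cats0 ed.
by case: (mn u (x :: d) v q eu).
Qed.

(** The last relation of [s] reaches back into [p], so a relation inside the final piece would be a
    proper factor of it. Hence the entries of the differential are paths of positive length that
    survive in Lambda. *)
Lemma RL_prefix n s : RL n.+1 s -> exists r q,
  [/\ s = r ++ q, RL n r, ~ bad q & (0 < size q)%N].
Proof.
case: n => [|[|n]].
- case: s => [|x [|? ?]] //= _; exists [::], [:: x]; split=> //.
  by move=> [l1 [l [l2 [/T_size Tl /(congr1 size)]]]]; rewrite !size_cat /=; lia.
- move=> /= Ts; case: s Ts (T_size Ts) => [|x q] //= Ts sq.
  exists [:: x], q; split=> //.
  move=> [l1 [l [l2 [Tl e]]]].
  by case: (T_anti (l1 := x :: l1) (l2 := l2) Tl) => //; rewrite /= -e.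
- move=> [r [p [u [Hr Hrp -> [v [q [Tq epu su]]] _]]]].
  exists (r ++ p), u; split; rewrite ?catA //; last by lia.
  move=> [l1 [l [l2 [Tl e]]]].
  have [||d [eq eu]] := @cat_le_split _ v p q u; rewrite ?epu //.
    by have := congr1 size epu; rewrite !size_cat; lia.
  have [] := T_anti (l1 := d ++ l1) (l2 := l2) Tl.
    by rewrite -catA -e -eu.
  move=> /(congr1 size); rewrite size_cat /= => s0.
  by have := congr1 size eu; rewrite size_cat; lia.
Qed.

(** The source of d d = 0: two consecutive steps together contain a relation. *)
Lemma RL_overlap n s : RL n.+2 s -> exists r p u,
  [/\ s = r ++ p ++ u, RL n r, RL n.+1 (r ++ p) & bad (p ++ u)].
Proof.
case: n => [|n].
  move=> /= Ts; case: s Ts (T_size Ts) => [|x q] //= Ts _.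
  by exists [::], [:: x], q; split=> //; exists [::], (x :: q), [::]; rewrite cats0.
move=> [r [p [u [Hr Hrp -> [v [q [Tq epu su]]] _]]]].
by exists r, p, u; split=> //; exists v, q, [::]; rewrite cats0.
Qed.

(** The combinatorial form of exactness. A relation in [q ++ z] lies in neither factor, so it
    straddles the boundary; the shortest [u] at which such a relation ends gives the next element of
    the chain. *)
Lemma RL_ext n r q z : RL n.+1 (r ++ q) -> RL n r -> ~ bad q -> bad (q ++ z) ->
  ~ bad z -> exists u z', z = u ++ z' /\ RL n.+2 (r ++ q ++ u).
Proof.
move=> Hrq Hr nq [l1 [l [l2 [Tl e]]]] nz.
have s1 : (size l1 < size q)%N.
  rewrite ltnNge; apply/negP => le.
  have [d [_ ez]] := cat_le_split e le; case: nz.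
  by exists d, l, l2.
have s2 : (size q < size (l1 ++ l))%N.
  rewrite ltnNge; apply/negP => le; rewrite catA in e.
  have [d [eq _]] := cat_le_split (esym e) le; case: nq.
  by exists l1, l, d; rewrite eq -catA.
case: n Hrq Hr => [|n] Hrq Hr.
  (* Here [r] is empty and [q] a single arrow: the straddling relation begins with that arrow and is
     itself the element of R^2. *)
  move: Hrq; rewrite (size0nil Hr) /=.
  case: q nq s1 s2 e => [|x [|? ?]] //= nq s1 s2 e _.
  move: e s2; rewrite (_ : l1 = [::]) /=; last by case: l1 s1.
  case: l Tl => [|y u] //= Tl [-> ->] _.
  by exists u, l2.
pose P m := `[< exists u z' v w, [/\ size u = m, z = u ++ z', T w, q ++ u = v ++ w
   & (1 <= size u < size w)%N] >].
have exP : exists m, P m.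
  rewrite catA in e.
  have [d [ed ez]] := cat_le_split e (ltnW s2).
  exists (size d); apply/asboolP; exists d, l2, l1, l; split=> //.
  by have := congr1 size ed; rewrite !size_cat in s2 *; lia.
have [m /asboolP[u [z' [v [w [su ez Tw ew bw]]]]] mn] := ex_minnP exP.
exists u, z'; split=> //; exists r, q, u; split=> //; first by exists v, w.
move=> u1 u2 v' w' eu su2 Tw' ew' bw'.
have /mn : P (size u1).
  by apply/asboolP; exists u1, (u2 ++ z'), v', w'; split=> //; rewrite ez eu -catA.
by rewrite -su eu size_cat; lia.
Qed.

(** Prefix-freeness makes the decomposition unique, so what [RL_overlap] and [RL_prefix] say of some
    decomposition holds for the given one. *)
Lemma RL_next_size n r q u : RL n.+1 (r ++ q) -> RL n r -> RL n.+2 (r ++ q ++ u) ->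
  bad (q ++ u) /\ (0 < size u)%N.
Proof.
move=> Hrq Hr H; split.
  have [r' [p [u' [e H0 H1 Hb]]]] := RL_overlap H.
  rewrite catA in e; rewrite [in RHS]catA in e.
  have [e1 e2] := RL_prefix_free Hrq H1 e.
  by have [_ ->] := RL_prefix_free Hr H0 e1; rewrite e2.
have [r' [q' [e H1 _ sq]]] := RL_prefix H.
by rewrite catA in e; have [_ ->] := RL_prefix_free Hrq H1 e.
Qed.

End Chains.

(** * Stacked lengths *)

Lemma delta_even D A k : delta D A k.*2 = (k * D)%N.
Proof.
case: k => [|k]; first by rewrite mul0n.
by rewrite /delta doubleS /= odd_double /= doubleK.
Qed.

Lemma delta_odd D A k : delta D A k.+1.*2.+1 = (k.+1 * D + A)%N.
Proof. by rewrite /delta doubleS /= odd_double /= uphalf_double. Qed.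

Lemma double_half_spec n : n = n./2.*2 \/ n = n./2.*2.+1.
Proof. by rewrite -[n in n = _ \/ _]odd_double_half -[n in _ \/ n = _]odd_double_half; case: odd; [right|left]. Qed.

(* a, b and c count the letters of degree 1, 2 and 3 of a word of Delta. *)
Lemma stacked_shape_arith D A a b c : (2 < D)%N -> (1 < A)%N -> D <> (2 * A)%N ->
  ((3 < a + 2 * b + 3 * c)%N -> (2 * A < D)%N) ->
  (a + b * D + c * (D + A))%N = delta D A (a + 2 * b + 3 * c) ->
  (a = 1 /\ b = 0 /\ c = 0)%N \/ (a = 0 /\ c <= 1)%N.
Proof.
move=> D2 A1 DA; move En: (a + 2 * b + 3 * c)%N => n HA.
case: (leqP n 3) HA => [n3 _ | n3 /(_ isT) HA].
  case: n n3 En => [|[|[|[|n]]]] // _ En.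
  - by move=> _; lia.
  - by move=> _; lia.
  - have [[-> [-> ->]]|[-> [-> ->]]] : (a = 2 /\ b = 0 /\ c = 0)%N \/ (a = 0 /\ b = 1 /\ c = 0)%N by lia.
      by rewrite (delta_even D A 1); lia.
    by lia.
  - have [[-> [-> ->]]|[[-> [-> ->]]|[-> [-> ->]]]] : (a = 3 /\ b = 0 /\ c = 0)%N \/ (a = 1 /\ b = 1 /\ c = 0)%N \/ (a = 0 /\ b = 0 /\ c = 1)%N by lia.
    + by rewrite (delta_odd D A 0); lia.
    + by rewrite (delta_odd D A 0); lia.
    + by lia.
(* Doubling the length equation clears the halves in [delta]. What remains is this equation, with
   [c] lowered by one when the degree is odd; [2 < D] and [2 * A < D] leave only zero. *)
have key x y : (2 * x + 2 * y * A = x * D + y * D)%N -> x = 0%N /\ y = 0%N.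
  by have := leq_mul (leqnn x) D2; have := leq_mul (leqnn y) HA; lia.
case: (double_half_spec n) En n3 => ->; case: n./2 => [|k] // En n3; rewrite ?delta_even ?delta_odd => E.
  have E2 : (2 * (a + b * D + c * (D + A)) = (a + 2 * b + 3 * c) * D)%N.
    by rewrite En E -muln2; lia.
  by have [|-> ->] := key a c; [lia|right].
have E2 : (2 * (a + b * D + c * (D + A)) + D = (a + 2 * b + 3 * c) * D + 2 * A)%N.
  by rewrite En E -muln2; lia.
right; case: c {En E} E2 => [|c] E2; last by have [|-> ->] := key a c; [lia|].
case: a E2 => [|a] // E2.
by have := leq_mul (leqnn a) D2; lia.
Qed.

(** The value j = 1 is an exception because [delta] is 1 there, not the A that the odd formula would
    give. *)
Lemma delta_shift D A k j : j <> 1%N -> delta D A (k.*2 + j) = (k * D + delta D A j)%N.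
Proof.
case: (double_half_spec j) => ->; case: j./2 => [|i] // _.
- by rewrite addn0 !delta_even; lia.
- by rewrite -doubleD !delta_even; lia.
by rewrite addnS -doubleD addnS !delta_odd; lia.
Qed.

Lemma delta_geD D A j : (2 <= j)%N -> (D <= delta D A j)%N.
Proof.
case: (double_half_spec j) => ->; case: j./2 => [|i] // _.
  by rewrite delta_even; lia.
by rewrite delta_odd; lia.
Qed.

Lemma cat_size_inj (X : Type) (s1 s2 t1 t2 : seq X) :
  size s1 = size s2 -> s1 ++ t1 = s2 ++ t2 -> s1 = s2 /\ t1 = t2.
Proof.
move=> es e; split; first by rewrite -(take_size_cat t1 (erefl (size s1))) e es take_size_cat.
by rewrite -(drop_size_cat t1 (erefl (size s1))) e es drop_size_cat.
Qed.

(** * Positions of relations in elements of R^n *)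

Section Stacked.
Variables (X : Type) (T : seq X -> Prop) (D A : nat).
Local Notation RL := (RL T).
Local Notation bad := (bad T).
Local Notation delta := (delta D A).
Hypotheses (D_gt2 : (2 < D)%N) (A_gt1 : (1 < A)%N) (D_neq2A : D <> (2 * A)%N).
Hypothesis T_anti : forall l1 l l2, T l -> T (l1 ++ l ++ l2) -> l1 = [::] /\ l2 = [::].
Hypothesis RL_size : forall n s, RL n s -> size s = delta n.

Lemma T_sizeD l : T l -> size l = D.
Proof. by move=> /(@RL_size 2); rewrite (delta_even D A 1) mul1n. Qed.

Lemma T_size_gt1 l : T l -> (1 < size l)%N.
Proof. by move=> /T_sizeD ->; lia. Qed.

Lemma bad_size s : bad s -> (D <= size s)%N.
Proof. by move=> [l1 [l [l2 [/T_sizeD <- ->]]]]; rewrite !size_cat; lia. Qed.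

(** [T (take D (drop i s))] encodes a relation starting at position [i]. As every relation has
    length D, it also guarantees that D letters are available there. *)
Lemma T_take_size i s : T (take D (drop i s)) -> (i + D <= size s)%N.
Proof. by move=> /T_sizeD; rewrite size_take_min size_drop; lia. Qed.

Lemma bad_of_T i s : T (take D (drop i s)) -> bad s.
Proof.
move=> H; exists (take i s), (take D (drop i s)), (drop D (drop i s)).
by rewrite !cat_take_drop.
Qed.

Lemma RL_take n s : RL n.+1 s -> RL n (take (delta n) s).
Proof.
move=> /(RL_prefix T_size_gt1 T_anti) [r [q [-> Hr _ _]]].
by rewrite -(RL_size Hr) take_size_cat.
Qed.

Lemma RL_last n s : RL n.+2 s -> T (take D (drop (delta n.+2 - D) s)).
Proof.
case: n => [|n] H.
  by rewrite (delta_even D A 1) mul1n subnn drop0 take_oversize ?(T_sizeD H).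
have sz := RL_size H.
case: H sz => r [p [u [_ _ -> [v [q [Tq e _]]] _]]]; rewrite e catA => sz.
have sq := T_sizeD Tq.
rewrite -sz size_cat sq addnK drop_size_cat //.
by rewrite take_oversize ?sq.
Qed.

Lemma take_drop_take i m (s : seq X) : (i + D <= m)%N ->
  take D (drop i (take m s)) = take D (drop i s).
Proof. by move=> h; rewrite !take_drop take_takel // addnC. Qed.

Lemma T_take i m s : T (take D (drop i (take m s))) -> T (take D (drop i s)).
Proof.
move=> H; have := T_take_size H; rewrite size_take_min => le.
by move: H; rewrite take_drop_take //; lia.
Qed.

(** The prefix of length [delta j] lies in R^j and ends in a relation. *)
Lemma RL_T n s j : RL n s -> (2 <= j <= n)%N -> T (take D (drop (delta j - D) s)).
Proof.
elim: n s => [|n IH] s H /andP[j2 jn]; first by lia.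
case: (ltngtP j n.+1) jn => // jn _.
  by apply: (@T_take _ (delta n)); apply: IH (RL_take H) _; lia.
by rewrite jn; case: n H jn IH => [|n] H jn IH; [lia|exact: RL_last].
Qed.

Lemma RL3_AD s : RL 3 s -> (A < D)%N.
Proof.
move=> H; have := RL_size H.
case: H => r [p [u [_ /T_sizeD srp -> [v [q [/T_sizeD sq e su]]] _]]].
rewrite catA size_cat srp (delta_odd D A 0); lia.
Qed.

(* All elements of R^3 have length D + A, so the first relation overlapping a
   given one starts A further on. *)
Lemma shift_T s i t : (0 < t < D)%N -> T (take D (drop i s)) ->
  T (take D (drop (i + t) s)) -> (A <= t)%N /\ T (take D (drop (i + A) s)).
Proof.
move=> bt; rewrite [(i + t)%N]addnC [(i + A)%N]addnC -!drop_drop.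
move: (drop i s) => {i}s T0 Tt.
have s0 : (D <= size s)%N by have := @T_take_size 0 s; rewrite drop0 add0n; exact.
have st := T_take_size Tt.
pose z := take t (drop D s).
have sz : size z = t by rewrite size_take_min size_drop; lia.
have elz : take (D + t) s = take D s ++ z by rewrite takeD.
have sl : size (take D s) = D by rewrite size_take_min; lia.
case: (take D s) T0 elz sl => [|a q] T0 elz /= sl; first by lia.
(* The first relation is cut into its first arrow, in R^1, and the rest [q]; the relation [t]
   further on overlaps [q], which yields an element of R^3 whose last piece is a prefix of [z]. *)
have [|||||u [z' [ez HR]]] // := @RL_ext X T 1 [:: a] q z.
- by move=> /bad_size; lia.
- have -> : q ++ z = drop 1 (take (D + t) s) by rewrite elz /= drop0.
  apply: (@bad_of_T (t - 1)).
  rewrite drop_drop (_ : (t - 1 + 1 = t)%N); last by lia.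
  by rewrite take_drop_take //; lia.
- by move=> /bad_size; lia.
have su : size u = A.
  have := RL_size HR; rewrite catA size_cat [size _]/= sl (delta_odd D A 0); lia.
have leA : (A <= t)%N by have := congr1 size ez; rewrite size_cat; lia.
split=> //.
have := RL_last HR; rewrite (delta_odd D A 0) (_ : 1 * D + A - D = A)%N; last by lia.
have -> : [:: a] ++ q ++ u = take (D + A) (take (D + t) s).
  by rewrite elz ez (catA (a :: q)) take_size_cat //= size_cat; lia.
by rewrite take_takel; [exact: T_take | lia].
Qed.

(** Relations start at A and at D, so [shift_T] gives [A <= D - A]; the inequality is strict because
    D is not 2A. *)
Lemma RL4_2AD s : RL 4 s -> (2 * A < D)%N.
Proof.
move=> H.
have AD : (A < D)%N := RL3_AD (RL_take H).
have := RL_T H (j := 3) isT; have := RL_T H (j := 4) isT.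
rewrite (delta_odd D A 0) (delta_even D A 2) => T4 T3.
have [] := @shift_T s A (D - A) ltac:(lia).
- by move: T3; rewrite (_ : 1 * D + A - D = A)%N //; lia.
- by move: T4; rewrite (_ : 2 * D - D = A + (D - A))%N //; lia.
by lia.
Qed.

Lemma RL_le m n s : RL n s -> (m <= n)%N -> RL m (take (delta m) s).
Proof.
elim: n s => [|n IH] s H; first by rewrite leqn0 => /eqP ->; rewrite (size0nil H).
case: (ltngtP m n.+1) => // mn _; last by rewrite mn take_oversize ?(RL_size H).
have Hn := RL_take H; have Hm := IH _ Hn mn.
have := RL_size Hn; have := RL_size Hm.
rewrite !size_take_min => e1 e2.
by move: Hm; rewrite take_takel //; lia.
Qed.

Lemma delta_step n : (A < D)%N -> (2 <= n)%N -> (delta n < delta n.+1 < delta n + D)%N.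
Proof.
move=> AD; case: (double_half_spec n) => ->; case: n./2 => [|k] // _.
  by rewrite delta_odd delta_even; lia.
by rewrite delta_odd -doubleS delta_even; lia.
Qed.

Lemma delta_step2 n : delta n.+2 = delta n + D \/ n = 1%N.
Proof.
case: (double_half_spec n) => ->; rewrite -doubleS; case: n./2 => [|k]; try by right.
- by left; rewrite !delta_even; lia.
- by left; rewrite !delta_even; lia.
- by left; rewrite !delta_odd; lia.
Qed.

(** The converse of [RL_T]. The prefix lies in R^n by induction, and the relation ending at
    [delta n.+1] overlaps its last step. Because [A < D], the letters added are too few to contain a
    relation, so [RL_ext] applies, and lengths show that it uses all of them. *)
Lemma RL_of_T n s : (A < D)%N -> (2 <= n)%N -> size s = delta n ->
  (forall j, (2 <= j <= n)%N -> T (take D (drop (delta j - D) s))) -> RL n s.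
Proof.
move=> AD; elim: n s => [|n IH] s // n2 ss H.
case: (ltngtP n 1) n2 => [n1 n2|n1 _|n1 _]; first (by lia); last first.
  have := H 2 ltac:(lia); move: ss; rewrite n1 (delta_even D A 1) mul1n subnn drop0 => ss.
  by rewrite take_oversize // ss.
have step := delta_step AD n1.
have Hr : RL n (take (delta n) s).
  apply: IH => //; first by rewrite size_take_min; lia.
  move=> j jn; have Tj := H j ltac:(lia).
  rewrite take_drop_take //.
  have le : (delta j <= delta n)%N.
    move: jn; clear -n1 AD D_gt2 A_gt1 D_neq2A; elim: n n1 => [|n IH] n1 jn; first by lia.
    case: (ltngtP j n.+1) jn => [jn j2|//|-> //]; last by rewrite andbF.
    have n1' : (1 < n)%N by lia.
    have := IH n1' ltac:(lia); have := delta_step AD n1'; lia.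
  have : (D <= delta j)%N.
    move: jn; clear -AD D_gt2; case: (double_half_spec j) => ->; case: j./2 => [|k] // _.
      by rewrite delta_even; lia.
    by rewrite delta_odd; lia.
  by lia.
case: n n1 ss H Hr step IH => [|[|n]] // n1 ss H Hr step _.
have [r [q [e Hr' nq sq]]] := RL_prefix T_size_gt1 T_anti Hr.
have sr := RL_size Hr'.
pose z := drop (delta n.+2) s.
have sz : (size z < D)%N by rewrite size_drop; lia.
have es : s = r ++ q ++ z by rewrite catA -e cat_take_drop.
rewrite e in Hr.
have [||u [z' [ez HR]]] := RL_ext Hr Hr' nq (z := z).
- have Tl := H n.+3 ltac:(lia).
  have -> : q ++ z = drop (delta n.+1) s by rewrite es drop_size_cat ?sr.
  apply: (@bad_of_T (delta n.+3 - D - delta n.+1)).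
  rewrite drop_drop subnK //.
  (* The relation must not start before [delta n.+1]. It starts exactly there, except for n = 0,
     where it starts at A and [delta 1] is 1. *)
  by case: (delta_step2 n.+1) => [->|[->]]; [lia|rewrite (delta_odd D A 0) {1}/Defs.delta /=; lia].
- by move=> /bad_size; lia.
have := RL_size HR; rewrite -ss es ez !size_cat => e0.
by move: HR; rewrite (_ : z' = [::]) ?cats0 //; apply: size0nil; lia.
Qed.

(** * Words in the generators of Delta *)

Section Letters.
Variable Y : Type.
Variables (deg : Y -> nat) (wd : Y -> seq X).
Hypothesis deg_le3 : forall y, (1 <= deg y <= 3)%N.
Hypothesis wdP : forall y, RL (deg y) (wd y).

Definition wdeg (w : seq Y) := \sum_(y <- w) deg y.
(** The reversal reflects that products of Ext classes compose right to left: the last letter gives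
    the first factor of the underlying path. *)
Definition wword (w : seq Y) := flatten [seq wd y | y <- rev w].
Definition word_in_R (w : seq Y) := RL (wdeg w) (wword w).
Definition ndeg i (w : seq Y) := count (fun y => deg y == i) w.

Lemma wdeg_cons x w : wdeg (x :: w) = (deg x + wdeg w)%N.
Proof. by rewrite /wdeg big_cons. Qed.
Lemma wdeg_cat u w : wdeg (u ++ w) = (wdeg u + wdeg w)%N.
Proof. by rewrite /wdeg big_cat. Qed.
Lemma wword_cat u w : wword (u ++ w) = wword w ++ wword u.
Proof. by rewrite /wword rev_cat map_cat flatten_cat. Qed.
Lemma wword_cons x w : wword (x :: w) = wword w ++ wd x.
Proof. by rewrite -cat1s wword_cat /wword /= cats0. Qed.

Lemma wdegE w : wdeg w = (ndeg 1 w + 2 * ndeg 2 w + 3 * ndeg 3 w)%N.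
Proof.
elim: w => [|x w IH]; first by rewrite /wdeg big_nil.
rewrite wdeg_cons IH /ndeg /=; have := deg_le3 x.
by case: (deg x) => [|[|[|[|?]]]] //= _; lia.
Qed.

Lemma wword_sizeE w : size (wword w) = (ndeg 1 w + ndeg 2 w * D + ndeg 3 w * (D + A))%N.
Proof.
elim: w => [|x w IH] //.
have e1 : delta 1 = 1%N by [].
have e2 : delta 2 = D by rewrite (delta_even D A 1) mul1n.
have e3 : delta 3 = (D + A)%N by rewrite (delta_odd D A 0) mul1n.
rewrite wword_cons size_cat IH (RL_size (wdP x)) /ndeg /=.
by case: (deg x) (deg_le3 x) => [|[|[|[|?]]]] // _; rewrite ?e1 ?e2 ?e3 /=; lia.
Qed.

Lemma size_ndeg w : size w = (ndeg 1 w + ndeg 2 w + ndeg 3 w)%N.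
Proof.
elim: w => [|x w IH] //=; rewrite IH /ndeg /=; have := deg_le3 x.
by case: (deg x) => [|[|[|[|?]]]] //= _; lia.
Qed.

(** The length of the word must be [delta] of its degree, and above degree 3 its prefix in R^4
    supplies [2 * A < D]. The rest is arithmetic on letter counts. *)
Lemma good_shape w : word_in_R w ->
  (exists2 x, w = [:: x] & deg x = 1%N) \/ (ndeg 1 w = 0 /\ ndeg 3 w <= 1)%N.
Proof.
move=> g; have := RL_size g; rewrite wword_sizeE wdegE => /stacked_shape_arith.
case=> // [n4|[n1 [n2 n3]]|]; last by right.
  have g4 : RL 4 (take (delta 4) (wword w)).
    by apply: (RL_le g); rewrite wdegE.
  exact: (RL4_2AD g4).
left; have := size_ndeg w; rewrite n1 n2 n3.
case: w n1 {g n2 n3} => [|x [|]] //; rewrite /ndeg /= => n1 _.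
by exists x => //; apply/eqP; move: n1; case: eqP.
Qed.

Lemma wword_size_bc w : ndeg 1 w = 0%N -> (ndeg 3 w <= 1)%N -> size (wword w) = delta (wdeg w).
Proof.
rewrite wword_sizeE wdegE => -> ; case: (ndeg 3 w) => [|[|]] // _.
  by rewrite (_ : 0 + 2 * _ + _ = (ndeg 2 w).*2)%N ?delta_even; lia.
by rewrite (_ : 0 + 2 * _ + _ = (ndeg 2 w).+1.*2.+1)%N ?delta_odd; lia.
Qed.
Lemma good_AD w : word_in_R w -> (3 <= wdeg w)%N -> (A < D)%N.
Proof.
move=> g w3; apply: (RL3_AD (s := take (delta 3) (wword w))).
exact: (RL_le g).
Qed.

Lemma size_le_wdeg w : (size w <= wdeg w)%N.
Proof. by elim: w => // x w IH; rewrite wdeg_cons /=; have := deg_le3 x; lia. Qed.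

(** [w] gives a prefix of the underlying word, where [RL_le] applies. [u] gives a suffix, whose
    relations must be found among those of the whole word, shifted by [delta (wdeg w)]. *)
Lemma good_factor u w : word_in_R (u ++ w) -> word_in_R u /\ word_in_R w.
Proof.
have good_nil : word_in_R [::] by rewrite /word_in_R /wdeg big_nil.
have [->|u0] : u = [::] \/ (0 < size u)%N by case: u; [left|right].
  by [].
have [->|w0] : w = [::] \/ (0 < size w)%N by case: w; [left|right].
  by rewrite cats0.
move=> g; have [[x e _]|[]] := good_shape g.
  by have := congr1 size e; rewrite size_cat /=; lia.
have nc i : ndeg i (u ++ w) = (ndeg i u + ndeg i w)%N by exact: count_cat.
rewrite !nc => n1 n3.
have su : size (wword u) = delta (wdeg u) by apply: wword_size_bc; lia.
have sw : size (wword w) = delta (wdeg w) by apply: wword_size_bc; lia.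
have du : (2 <= wdeg u)%N by have := size_ndeg u; rewrite wdegE; lia.
have dw : (2 <= wdeg w)%N by have := size_ndeg w; rewrite wdegE; lia.
have AD : (A < D)%N by apply: (good_AD g); rewrite wdeg_cat; lia.
move: (g); rewrite /word_in_R wdeg_cat wword_cat => g'.
split; last first.
  have := RL_le g' (leq_addl _ _).
  by rewrite -sw take_size_cat.
apply: RL_of_T => // j ju.
have -> : wword u = drop (delta (wdeg w)) (wword w ++ wword u) by rewrite drop_size_cat.
rewrite drop_drop; have gT := RL_T g'.
have jD := @delta_geD D A j ltac:(lia).
have [w3|w3] : ndeg 3 w = 0%N \/ ndeg 3 w = 1%N by lia.
  have ew : wdeg w = (ndeg 2 w).*2 by rewrite wdegE; lia.
  have := gT ((ndeg 2 w).*2 + j)%N ltac:(lia).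
  rewrite delta_shift; last by lia.
  by rewrite ew delta_even; congr (T (take D (drop _ _))); lia.
have ew : wdeg w = (ndeg 2 w).+1.*2.+1 by rewrite wdegE; lia.
have eu : wdeg u = (ndeg 2 u).*2 by rewrite wdegE; lia.
rewrite ew delta_odd; set k := ndeg 2 w in ew *.
case: (double_half_spec j) ju jD => ->; case: j./2 => [|i] // ju jD.
  have := gT (k + i.+1).+1.*2.+1 ltac:(lia).
  by rewrite delta_odd delta_even; congr (T (take D (drop _ _))); lia.
(* The relation needed starts 2A after [(k + i.+1) * D]. Relations are known A and D after that
   point, and [shift_T] across their gap D - A inserts one A after the first. *)
have := gT (k + i.+1).+1.*2.+1 ltac:(lia); have := gT (k + i.+2).+1.*2 ltac:(lia).
rewrite delta_odd delta_even => T2 T1.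
have [|||_] := @shift_T
  (wword w ++ wword u) ((k + i.+1) * D + A) (D - A); first by lia.
- by move: T1; congr (T (take D (drop _ _))); lia.
- by move: T2; congr (T (take D (drop _ _))); lia.
by rewrite delta_odd; congr (T (take D (drop _ _))); lia.
Qed.

(** The relations ending within [wword (y :: l)] come by induction. The others lie in the last two
    factors and are those of the pair [[:: x; y]], moved by [size l * D]. *)
Lemma good_chain x l : (2 <= deg x)%N -> ndeg 2 l = size l ->
  (forall l1 y z l2, x :: l = l1 ++ y :: z :: l2 -> word_in_R [:: y; z]) -> word_in_R (x :: l).
Proof.
elim: l x => [|y l IH] x dx nl H.
  by rewrite /word_in_R wdeg_cons wword_cons /wdeg big_nil addn0; exact: wdP.
have dy : deg y = 2%N.
  by apply/eqP; move: nl; rewrite /ndeg /=; case: eqP => //= _; have := count_size (fun y => deg y == 2) l; lia.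
have nl' : ndeg 2 l = size l by move: nl; rewrite /ndeg /= dy /=; lia.
have gxy : word_in_R [:: x; y] by exact: (H [::] x y l).
have gl : word_in_R (y :: l).
  apply: IH => //; first by rewrite dy.
  by move=> l1 y' z l2 e; apply: (H (x :: l1) y' z l2); rewrite e.
have AD : (A < D)%N by apply: (good_AD gxy); rewrite !wdeg_cons; lia.
have := size_ndeg l; rewrite nl' => nl0.
have n1 : ndeg 1 (x :: y :: l) = 0%N.
  by rewrite /ndeg /= dy -!/(ndeg _ _); case: eqP dx => [->|]; lia.
have n3 : (ndeg 3 (x :: y :: l) <= 1)%N.
  by rewrite /ndeg /= dy -!/(ndeg _ _); case: eqP; lia.
have dl : wdeg l = (size l).*2 by rewrite wdegE; lia.
have sl : size (wword l) = (size l * D)%N.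
  by rewrite wword_size_bc ?dl ?delta_even //; lia.
have dx3 := deg_le3 x.
rewrite /word_in_R; apply: RL_of_T => //.
- by rewrite !wdeg_cons; lia.
- exact: wword_size_bc.
move=> j; rewrite !wdeg_cons dl dy => jb.
rewrite wword_cons.
have [jl|jl] := leqP j (wdeg (y :: l)).
  have := RL_T gl (j := j) ltac:(lia).
  rewrite -{1}[wword (y :: l)](take_size_cat (wd x) (erefl _)).
  exact: T_take.
rewrite wdeg_cons dl dy in jl.
have := RL_T gxy (j := j - (size l).*2).
rewrite !wdeg_cons dy /wdeg big_nil => /(_ ltac:(lia)).
have -> : wword [:: x; y] = drop (size l * D) (wword (y :: l) ++ wd x).
  by rewrite !wword_cons -(catA (wword l)) drop_size_cat.
have := @delta_shift D A (size l) (j - (size l).*2) ltac:(lia).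
rewrite (_ : (size l).*2 + _ = j)%N; last by lia.
have := @delta_geD D A (j - (size l).*2) ltac:(lia).
by rewrite drop_drop => h1 h2; congr (T (take D (drop _ _))); lia.
Qed.

(** Relations start at 0, A, D and D + A; past the first D letters the last two start at 0 and A,
    which is an element of R^3. This rewrites a nonzero product bc as c'b'. *)
Lemma RL5_swap s : RL 5 s -> exists s1 s2, [/\ s = s1 ++ s2, RL 2 s1 & RL 3 s2].
Proof.
move=> H; have gT := RL_T H.
have sz := RL_size H; rewrite (delta_odd D A 1) in sz.
have AD : (A < D)%N.
  by have := RL_le H (m := 3) isT; exact: RL3_AD.
exists (take D s), (drop D s); split; first by rewrite cat_take_drop.
  by have := gT 2 isT; rewrite (delta_even D A 1) mul1n subnn drop0.
apply: RL_of_T => //.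
  by rewrite size_drop sz (delta_odd D A 0); lia.
move=> j jb; have [->|->] : j = 2%N \/ j = 3%N by lia.
  have := gT 4 isT; rewrite drop_drop (delta_even D A 2) (delta_even D A 1).
  by congr (T (take D (drop _ _))); lia.
have := gT 5 isT; rewrite drop_drop (delta_odd D A 1) (delta_odd D A 0).
by congr (T (take D (drop _ _))); lia.
Qed.

(** Degrees fix the lengths of the pieces, so the word is cut in only one way. *)
Lemma wword_inj w w' : wword w = wword w' -> map deg w = map deg w' ->
  map wd w = map wd w'.
Proof.
elim: w w' => [|x w IH] [|x' w'] //=; rewrite !wword_cons => e [dx dw].
have sx : size (wd x) = size (wd x') by rewrite (RL_size (wdP x)) dx (RL_size (wdP x')).
have [|e1 ->] := cat_size_inj _ e; first by have := congr1 size e; rewrite !size_cat; lia.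
by rewrite (IH w').
Qed.

Lemma map_deg2 w : ndeg 2 w = size w -> map deg w = nseq (size w) 2.
Proof.
elim: w => //= x w IH; rewrite /ndeg /=; have := count_size (fun y => deg y == 2) w.
by case: eqP => [-> _ /eqP|]; [rewrite eqSS => /eqP /IH ->|rewrite /=; lia].
Qed.

(** Apart from single arrows, a word in some R^n has at most one letter of degree 3, and the parity
    of the total degree decides whether it occurs. So the two words differ at most in the place of
    that letter, which in [p] can only be the first. *)
Lemma good_same_deg p w x l : word_in_R p -> word_in_R w -> wdeg p = wdeg w ->
  p = x :: l -> (2 <= deg x)%N -> ndeg 2 l = size l ->
  map deg p = map deg w \/
  exists x' l', [/\ w = x' :: l', size l' = size l, deg x' = 2%N & deg x = 3%N].
Proof.
move=> gp gw e ep dx nl; have dx3 := deg_le3 x.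
have dl : wdeg l = (size l).*2 by have := size_ndeg l; rewrite wdegE; lia.
have dp : wdeg p = (deg x + (size l).*2)%N by rewrite ep wdeg_cons dl.
case: (good_shape gw) => [[y ew dy]|[n1 n3]].
  by move: e; rewrite dp ew wdeg_cons dy /wdeg big_nil; lia.
have sw := size_ndeg w; have dw := wdegE w.
have [dx2|dx2] : deg x = 2%N \/ deg x = 3%N by lia.
  left; rewrite ep /= dx2 !map_deg2 //; last by lia.
  by rewrite (_ : size w = (size l).+1) //; lia.
case: w gw e n1 n3 sw dw => [|x' w] gw e n1 n3 sw dw.
  by move: e; rewrite dp /wdeg big_nil; lia.
have dx'3 := deg_le3 x'.
have [dx'|dx'] : deg x' = 2%N \/ deg x' = 3%N.
- by have : deg x' <> 1%N; [move=> d1; move: n1; rewrite /ndeg /= d1|lia].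
- right; exists x', w; split=> //.
  by move: e n1 n3 sw dw; rewrite dp /ndeg /= dx' dx2 /= => e n1 n3 sw dw; move: sw; rewrite /=; lia.
left; rewrite ep /= dx2 dx'.
have sw' := size_ndeg w; move: n1 n3 sw dw; rewrite /ndeg /= dx' /= -!/(ndeg _ _) => n1 n3 sw dw.
rewrite !map_deg2 //; last by lia.
by rewrite (_ : size w = size l) //; lia.
Qed.
End Letters.
End Stacked.

Import Defs GRing.Theory.
Local Open Scope ring_scope.

(** * Paths, monomial ideals and coefficients *)

Lemma ideal_gen_ind (R : pzRingType) (S : set R) (P : R -> Prop) :
  P 0 -> (forall x y, P x -> P y -> P (x - y)) ->
  (forall a x, P x -> P (a * x)) -> (forall a x, P x -> P (x * a)) ->
  (forall x, S x -> P x) -> forall x, x \in ideal_gen S -> P x.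
Proof.
move=> P0 PB Pl Pr PS x /asboolP H.
pose p : {pred R} := [pred x | `[<P x>]].
have zc : zmod_closed p.
  by split=> [|y z /asboolP hy /asboolP hz]; apply/asboolP; [exact: P0|exact: PB].
have ml a y : y \in p -> a * y \in p by move=> /asboolP h; apply/asboolP/Pl.
have mr a y : y \in p -> y * a \in p by move=> /asboolP h; apply/asboolP/Pr.
pose J : tsideal R := HB.pack p (GRing.isZmodClosed.Build R p zc)
  (isTwoSidedIdeal.Build R p ml mr).
by apply/asboolP; apply: (H J) => y /PS h; apply/asboolP.
Qed.

Lemma ideal_gen_sub (R : pzRingType) (S : set R) x : S x -> x \in ideal_gen S.
Proof. by move=> h; apply/asboolP => J; exact. Qed.

Section PathWords.
Variable Q : quiver.
Implicit Types p q r u v w : qpath Q.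

Lemma qpathP p q : pstart p = pstart q -> parrows p = parrows q -> p = q.
Proof.
case: p q => [[a s] ?] [[b t] ?]; rewrite /pstart /parrows /= => e1 e2.
by apply: val_inj; rewrite /= e1 e2.
Qed.

Lemma qpath_eq p q : parrows p = parrows q -> (0 < plen p)%N -> p = q.
Proof.
move=> e l; apply: qpathP => //.
have := pchain p; have := pchain q; rewrite -e; rewrite /plen in l.
by case: (parrows p) l => //= a s _ /andP[/eqP <- _] /andP[/eqP <- _].
Qed.

Lemma pcomp_parrows p q r : pcomp p q = Some r -> parrows r = parrows p ++ parrows q.
Proof. by case/pcompP. Qed.

Lemma pcomp_plen p q r : pcomp p q = Some r -> plen r = (plen p + plen q)%N.
Proof. by move=> /pcomp_parrows e; rewrite /plen e size_cat. Qed.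

Lemma pcomp_end p q r : pcomp p q = Some r -> pend p = pstart q.
Proof. by case/pcompP. Qed.

Lemma pcomp_start p q r : pcomp p q = Some r -> pstart r = pstart p.
Proof. by case/pcompP. Qed.

Lemma pcomp_take_drop i p : pcomp (ptake i p) (pdrop i p) = Some p.
Proof. by apply/pcompP; split=> //; rewrite /parrows /= cat_take_drop. Qed.

Lemma pcomp_inj_r p q q' r : pcomp p q = Some r -> pcomp p q' = Some r -> q = q'.
Proof.
case/pcompP => e1 _ a1 /pcompP [e2 _ a2]; apply: qpathP; first by rewrite -e1.
by move: a1; rewrite a2 => /(congr1 (drop (size (parrows p)))); rewrite !drop_size_cat.
Qed.

Lemma pcomp_inj_l p p' q r : pcomp p q = Some r -> pcomp p' q = Some r -> p = p'.
Proof.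
case/pcompP => e1 h1 a1 /pcompP [e2 h2 a2]; apply: qpathP; first by rewrite -h1.
have := congr1 size a1; rewrite {1}a2 !size_cat => /addIn ss.
by move: a1; rewrite a2 => /(congr1 (take (size (parrows p)))); rewrite take_size_cat // take_size_cat.
Qed.

Lemma pcomp_cut p s t : parrows p = s ++ t ->
  exists u v, [/\ pcomp u v = Some p, parrows u = s & parrows v = t].
Proof.
move=> e; exists (ptake (size s) p), (pdrop (size s) p); split.
- exact: pcomp_take_drop.
- by rewrite [LHS](_ : _ = take (size s) (parrows p)) // e take_size_cat.
- by rewrite [LHS](_ : _ = drop (size s) (parrows p)) // e drop_size_cat.
Qed.

Lemma pcomp_Some p q : pend p = pstart q ->
  exists2 r, pcomp p q = Some r & parrows r = parrows p ++ parrows q.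
Proof. by move=> /pcomp_some [r E]; exists r => //; exact: pcomp_parrows. Qed.

Lemma ptake_pcomp p q r : pcomp p q = Some r -> ptake (plen p) r = p.
Proof.
move=> E; apply: qpathP; first exact: pcomp_start E.
by rewrite [LHS](_ : _ = take (plen p) (parrows r)) // (pcomp_parrows E) take_size_cat.
Qed.

Lemma pdrop_pcomp p q r : pcomp p q = Some r -> pdrop (plen p) r = q.
Proof.
move=> E; apply: (pcomp_inj_r (p := p) _ E).
by rewrite -{1}(ptake_pcomp E) pcomp_take_drop.
Qed.

Lemma plen0 p : plen p = 0%N -> p = pvertex (pstart p).
Proof. by move=> /size0nil e; apply: qpathP. Qed.

Section Relations.
Variable R2 : set (qpath Q).

Definition relword (l : seq (arrow Q)) : Prop := exists2 r, R2 r & parrows r = l.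
(** When [R2] generates the ideal, these are exactly the paths that vanish in the quotient. *)
Definition badp (p : qpath Q) : bool := `[< bad relword (parrows p) >].

Hypothesis R2_len : forall r, R2 r -> (1 < plen r)%N.

Lemma relword_size l : relword l -> (1 < size l)%N.
Proof. by move=> [r /R2_len lr <-]. Qed.

Lemma relwordE p : relword (parrows p) <-> R2 p.
Proof.
split=> [[r Hr e]|]; last by exists p.
by rewrite -(qpath_eq e) //; apply: ltnW; exact: R2_len.
Qed.

Lemma badp_compr u p w : pcomp u p = Some w -> badp p -> badp w.
Proof.
move=> E /asboolP b; apply/asboolP; rewrite (pcomp_parrows E).
by rewrite -[parrows p]cats0; exact: bad_cat.
Qed.

Lemma badp_compl p v w : pcomp p v = Some w -> badp p -> badp w.
Proof.
move=> E /asboolP b; apply/asboolP; rewrite (pcomp_parrows E).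
by rewrite -[X in bad _ X]/([::] ++ _ ++ _); exact: bad_cat.
Qed.

Lemma badp_vertex (a : vertex Q) : badp (pvertex a) = false.
Proof.
apply/asboolP => -[l1 [l [l2 [/relword_size sl /(congr1 size)]]]].
by rewrite !size_cat /parrows /= => e; move: sl; case: (size l) e => // n; rewrite addnCA.
Qed.

(** Words forget vertices. They are recovered because cutting a path at prescribed arrows gives
    composable pieces, and a relation, having positive length, is determined by its arrows. *)
Lemma next_pathsE (P1 P2 : set (qpath Q)) (W1 W2 : seq (arrow Q) -> Prop) :
  (forall p, P1 p <-> W1 (parrows p)) -> (forall p, P2 p <-> W2 (parrows p)) ->
  forall p, next_paths R2 P1 P2 p <-> next_words relword W1 W2 (parrows p).
Proof.
move=> H1 H2 x; split.
  move=> [r [r' [p [u [pu [[Pr Pr' E1 E2 E3] [[q Rq [u0 [v [F1 F2 su]]]] mn]]]]]]].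
  have a1 := pcomp_parrows E1; have a2 := pcomp_parrows E2; have a3 := pcomp_parrows E3.
  have b1 := pcomp_parrows F1; have b2 := pcomp_parrows F2.
  have eu : u0 = u := pcomp_inj_r F1 E3; subst u0.
  exists (parrows r'), (parrows p), (parrows u); split.
  - exact/H1.
  - by rewrite -a1; apply/H2.
  - by rewrite a2 a1 catA.
  - by exists (parrows v), (parrows q); split; [exists q| rewrite -a3|].
  - move=> u1 u2 v' q' eu su2 [q0 Rq0 <-] e sq.
    move: (a3); rewrite eu catA => /pcomp_cut [y [z [C1 C2 C3]]].
    apply: (mn y q0) => //; first by exists z; rewrite /plen ?C3.
    have [w1 [w2 [G1 G2 G3]]] := pcomp_cut C2.
    have [w3 [w4 [G4 G5 G6]]] : exists w3 w4, [/\ pcomp w3 w4 = Some y,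
        parrows w3 = v' & parrows w4 = parrows q0].
      by apply: pcomp_cut; rewrite C2.
    exists w2, w3; split; last by rewrite /plen G3.
    + have -> : p = w1; last by [].
      apply: qpathP; last by rewrite G2.
      by rewrite -(pcomp_start E3) (pcomp_start C1) (pcomp_start G1).
    + have -> : q0 = w4; last by [].
      by apply: qpath_eq; [rewrite G6|exact: ltnW (R2_len Rq0)].
move=> [r' [p [u [Wr Wrp ex [v [q [[q0 Rq0 eq0] epu su]]] mn]]]].
have [x1 [xu [C1 C2 C3]]] : exists x1 xu, [/\ pcomp x1 xu = Some x,
    parrows x1 = r' ++ p & parrows xu = u] by apply: pcomp_cut; rewrite -catA.
have [xr [xp [C4 C5 C6]]] := pcomp_cut C2.
have [xpu E3 a3] : exists2 r, pcomp xp xu = Some r & parrows r = parrows xp ++ parrows xu.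
  by apply: pcomp_Some; rewrite -(pcomp_end C1) (pend_comp C4).
exists x1, xr, xp, xu, xpu; split.
  by split=> //; [apply/H2; rewrite C2|apply/H1; rewrite C5].
have a3' : parrows xpu = v ++ parrows q0 by rewrite a3 C6 C3 epu eq0.
split.
  exists q0 => //; have [w1 [w2 [G1 G2 G3]]] := pcomp_cut a3'.
  exists xu, w1; split=> //; last by rewrite /plen C3 eq0.
  have -> : q0 = w2; last by [].
  by apply: qpath_eq; [rewrite G3|exact: ltnW (R2_len Rq0)].
move=> y q1 [z Ez sz] Rq1 [u1 [v1 [F1 F2 su1]]].
have b1 := pcomp_parrows F1; have b2 := pcomp_parrows F2; have b3 := pcomp_parrows Ez.
apply: (mn (parrows u1) (parrows z) (parrows v1) (parrows q1)) => //.
- move: b3; rewrite b1 a3 -catA => /(congr1 (drop (size (parrows xp)))).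
  by rewrite !drop_size_cat // C3.
- by exists q1.
- by rewrite -C6 -b1 b2.
Qed.

Lemma RsetE n p : Rset R2 n p <-> RL relword n (parrows p).
Proof.
suff H : (forall p, Rset R2 n p <-> RL relword n (parrows p)) /\
  (forall p, Rset R2 n.+1 p <-> RL relword n.+1 (parrows p)) by case: H => H _; exact: H.
elim: n {p} => [|n [IH0 IH1]]; first by split.
split=> // p; case: n IH0 IH1 => [|n] IH0 IH1; first exact: iff_sym (relwordE p).
exact: (next_pathsE IH0 IH1).
Qed.
End Relations.
End PathWords.

(** * Coefficients of products in the path algebra *)

Section PathAlgebraCoef.
Variables (K : fieldType) (Q : quiver).
Implicit Types (p q r w z : qpath Q) (x y : pathalg K Q).

Lemma mcoeff_pelt_opt (o : option (qpath Q)) w : (pelt_opt K o)@_w = (o == Some w)%:R.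
Proof.
case: o => [p|] /=; last by rewrite mcoeff0.
rewrite pelt.unlock mcoeffU; have [->|n] := eqVneq p w; first by rewrite eqxx.
by rewrite (_ : Some p == Some w = false) //; apply/negP => /eqP [] /eqP; apply/negP.
Qed.

Lemma pelt_optE p : pelt K p = pelt_opt K (Some p). Proof. by []. Qed.

Lemma mcoeff_lin a x y w : (a *: x + y)@_w = a * x@_w + y@_w.
Proof. by rewrite mcoeffD mcoeffZ. Qed.

Lemma mcoeff_peltMl q z w y : pcomp q z = Some w -> (pelt K q * y)@_w = y@_z.
Proof.
move=> E; elim/pathalg_ind: y => [|a p y IH]; first by rewrite mulr0 !mcoeff0.
have -> : pelt K q * (a *: pelt K p + y) = a *: pelt_opt K (pcomp q p) + pelt K q * y.
  by rewrite -pamulU; exact: pamul_linr.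
rewrite !mcoeff_lin IH pelt_optE !mcoeff_pelt_opt; congr (_ * (nat_of_bool _)%:R + _).
apply/eqP/eqP => [E'|[->] //]; by rewrite (pcomp_inj_r E E').
Qed.

Lemma mcoeff_peltMr q z w y : pcomp z q = Some w -> (y * pelt K q)@_w = y@_z.
Proof.
move=> E; elim/pathalg_ind: y => [|a p y IH]; first by rewrite mul0r !mcoeff0.
have -> : (a *: pelt K p + y) * pelt K q = a *: pelt_opt K (pcomp p q) + y * pelt K q.
  by rewrite -pamulU; exact: pamul_linl.
rewrite !mcoeff_lin IH pelt_optE !mcoeff_pelt_opt; congr (_ * (nat_of_bool _)%:R + _).
apply/eqP/eqP => [E'|[->] //]; by rewrite (pcomp_inj_l E E').
Qed.

Lemma mcoeff_peltMl0 q w y : (forall z, pcomp q z <> Some w) -> (pelt K q * y)@_w = 0.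
Proof.
move=> E; elim/pathalg_ind: y => [|a p y IH]; first by rewrite mulr0 !mcoeff0.
have -> : pelt K q * (a *: pelt K p + y) = a *: pelt_opt K (pcomp q p) + pelt K q * y.
  by rewrite -pamulU; exact: pamul_linr.
by rewrite mcoeff_lin IH mcoeff_pelt_opt (negPf (introN eqP (E p))) mulr0 addr0.
Qed.

Lemma mcoeff_peltMr0 q w y : (forall z, pcomp z q <> Some w) -> (y * pelt K q)@_w = 0.
Proof.
move=> E; elim/pathalg_ind: y => [|a p y IH]; first by rewrite mul0r !mcoeff0.
have -> : (a *: pelt K p + y) * pelt K q = a *: pelt_opt K (pcomp p q) + y * pelt K q.
  by rewrite -pamulU; exact: pamul_linl.
by rewrite mcoeff_lin IH mcoeff_pelt_opt (negPf (introN eqP (E p))) mulr0 addr0.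
Qed.

Lemma msupp_peltMl q y w : w \in msupp (pelt K q * y) ->
  exists2 z, z \in msupp y & pcomp q z = Some w.
Proof.
move=> h; have [[z E]|n] := pselect (exists z, pcomp q z = Some w).
  by exists z => //; rewrite -mcoeff_neq0 -(mcoeff_peltMl _ E) mcoeff_neq0.
by move: h; rewrite -mcoeff_neq0 mcoeff_peltMl0 ?eqxx // => z E; apply: n; exists z.
Qed.

Lemma msupp_lin a x y w : w \in msupp (a *: x + y) -> w \in msupp x \/ w \in msupp y.
Proof.
rewrite -!mcoeff_neq0 mcoeff_lin => h.
have [e|n] := eqVneq (x@_w) 0; last by left.
by right; move: h; rewrite e mulr0 add0r.
Qed.

Lemma msuppM x y w : w \in msupp (x * y) ->
  exists p q, [/\ p \in msupp x, q \in msupp y & pcomp p q = Some w].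
Proof.
rewrite {1}[x]pathalgE.
have -> : (\sum_(p <- msupp x) x@_p *: pelt K p) * y =
   \sum_(p <- msupp x) x@_p *: (pelt K p * y).
  by rewrite mulr_suml; apply: eq_bigr => p _; exact: pamulZl.
rewrite big_seq_cond; elim/big_ind: _ => [|u v Hu Hv|p].
- by rewrite msupp0 in_fset0.
- by rewrite -[u]scale1r => /msupp_lin []; rewrite ?scale1r; auto.
- rewrite andbT => ps; rewrite -[_ *: _]addr0 => /msupp_lin [/msupp_peltMl [q]|].
    by exists p, q.
  by rewrite msupp0 in_fset0.
Qed.

Lemma pathalgP x y : (forall p, x@_p = y@_p) -> x = y.
Proof. by move=> H; apply/malgP. Qed.

Lemma ideal_msupp (I : tsideal (pathalg K Q)) x : (forall p, p \in msupp x -> pelt K p \in I) -> x \in I.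
Proof.
move=> H; rewrite [x]pathalgE big_seq_cond; apply: rpred_sum => p; rewrite andbT => /H h.
have -> : x@_p *: pelt K p = (x@_p *: paone K Q : pathalg K Q) * pelt K p.
  by rewrite [RHS]pamulZl; congr (_ *: _); symmetry; exact: mul1r.
exact: tsideal_mull.
Qed.

End PathAlgebraCoef.

(** * Membership in ideals generated by paths *)

Section MonomialIdeal.
Variables (K : fieldType) (Q : quiver) (I : tsideal (pathalg K Q)) (R2 : set (qpath Q)).
Local Notation badp := (badp R2).
Hypothesis R2_len : forall r, R2 r -> (1 < plen r)%N.

Lemma generated_badE : generated_by_paths I R2 ->
  forall x, (x \in I) <-> forall p, p \in msupp x -> badp p.
Proof.
move=> gen x; split.
  rewrite gen; refine (@ideal_gen_ind _ _ (fun x : pathalg K Q => forall p, p \in msupp x -> badp p) _ _ _ _ _ x).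
  - by move=> p; rewrite msupp0.
  - move=> y z hy hz p /(fsubsetP (msuppB_le _ _)); rewrite in_fsetU => /orP[/hy|/hz] //.
  - by move=> a y hy p /msuppM [u [v [_ /hy b E]]]; exact: badp_compr E b.
  - by move=> a y hy p /msuppM [u [v [/hy b _ E]]]; exact: badp_compl E b.
  - move=> y [r Rr ->] p; rewrite msupp_pelt in_fset1 => /eqP ->.
    by apply/asboolP; exists [::], (parrows r), [::]; rewrite cats0; split=> //; exists r.
move=> H; apply: ideal_msupp => p /H /asboolP [l1 [l [l2 [[r Rr er] e]]]].
have rI : pelt K r \in I by rewrite gen; apply: ideal_gen_sub; exists r.
move: l e er => l; rewrite catA => /pcomp_cut [u [v [E1 E2 _]]] er.
have [u1 [r' [F1 F2 F3]]] := pcomp_cut E2.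
have -> : pelt K p = pelt K u1 * pelt K r' * pelt K v.
  rewrite -[pelt K p]/(pelt_opt K (Some p)) -E1 -pamulU.
  by rewrite -[pelt K u]/(pelt_opt K (Some u)) -F1 -pamulU.
rewrite (_ : r' = r); first exact/tsideal_mulr/tsideal_mull.
by symmetry; apply: qpath_eq; [rewrite F3|exact: ltnW (R2_len Rr)].
Qed.

End MonomialIdeal.

Section Admissible.
Variables (K : fieldType) (Q : quiver) (I : tsideal (pathalg K Q)) (R2 : set (qpath Q)).
Hypotheses (adm : admissible I) (mgp : minimal_generating_paths I R2).

Lemma generator_mem r : R2 r -> pelt K r \in I.
Proof. by case: mgp => gen _ Rr; rewrite gen; apply: ideal_gen_sub; exists r. Qed.

Lemma generator_len r : R2 r -> (1 < plen r)%N.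
Proof.
by move=> /generator_mem /(adm.1 _); apply; rewrite msupp_pelt in_fset1.
Qed.

(** A relation properly containing another could be dropped from the generating set, against
    minimality. *)
Lemma generator_antichain l1 l l2 : relword R2 l -> relword R2 (l1 ++ l ++ l2) ->
  l1 = [::] /\ l2 = [::].
Proof.
move=> [r Rr <-] [r' Rr' e].
have [err|nrr] := pselect (r = r').
  have := congr1 size e; rewrite err !size_cat => /eqP.
  rewrite addnCA -[X in X == _]addn0 eqn_add2l eq_sym addn_eq0 => /andP[].
  by move=> /eqP /size0nil -> /eqP /size0nil ->.
case: mgp => gen mn; case: (mn (fun p => R2 p /\ p <> r') _ _ r' Rr') => //.
  by move=> p [].
move=> x; rewrite gen; apply/idP/idP.
  apply: (ideal_gen_ind (P := fun x => x \in _)); first exact: rpred0.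
  - by move=> y z hy hz; exact: rpredB.
  - by move=> a y hy; exact: tsideal_mull.
  - by move=> a y hy; exact: tsideal_mulr.
  move=> y [p Rp ->]; have [->|n] := pselect (p = r'); last first.
    by apply: ideal_gen_sub; exists p.
  move: e; rewrite catA => /pcomp_cut [u [v [E1 E2 _]]].
  have [u1 [r1 [F1 F2 F3]]] := pcomp_cut E2.
  have -> : pelt K r' = pelt K u1 * pelt K r1 * pelt K v.
    rewrite -[pelt K r']/(pelt_opt K (Some r')) -E1 -pamulU.
    by rewrite -[pelt K u]/(pelt_opt K (Some u)) -F1 -pamulU.
  rewrite (_ : r1 = r).
    by apply/tsideal_mulr/tsideal_mull; apply: ideal_gen_sub; exists r.
  by symmetry; apply: qpath_eq; [rewrite F3|exact: ltnW (generator_len Rr)].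
apply: (ideal_gen_ind (P := fun x => x \in _)); first exact: rpred0.
- by move=> y z hy hz; exact: rpredB.
- by move=> a y hy; exact: tsideal_mull.
- by move=> a y hy; exact: tsideal_mulr.
by move=> y [p [Rp _] ->]; apply: ideal_gen_sub; exists p.
Qed.

Lemma memI_badE x : (x \in I) <-> forall p, p \in msupp x -> badp R2 p.
Proof. by apply: generated_badE; [exact: generator_len|case: mgp]. Qed.
End Admissible.

Lemma qpi0 (R : pzRingType) (J : tsideal R) : qpi J 0 = 0.
Proof. by rewrite -[X in qpi J X](subrr 0) qpiB subrr. Qed.

Lemma pcomp_assoc (Q : quiver) (p q r a b : qpath Q) : pcomp p q = Some a -> pcomp q r = Some b ->
  exists2 c, pcomp a r = Some c & pcomp p b = Some c.
Proof.
move=> E F; have := pcompA p q r; rewrite E F /= => e.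
have [c Ec _] := pcomp_Some (etrans (pend_comp E) (pcomp_end F)).
by exists c; rewrite // e.
Qed.

(** * Coefficients in the quotient algebra *)

Section Monomial.
Variables (K : fieldType) (Q : quiver) (I : tsideal (pathalg K Q)) (R2 : set (qpath Q)).
Hypotheses (adm : admissible I) (mgp : minimal_generating_paths I R2).
Local Notation Lam := (quo I).
Local Notation badp := (badp R2).
Local Notation inLam p := (qpi I (pelt K p)).
Local Notation Rtype n := (set_type (Rset R2 n)).
Local Notation lam0 := (lam0 I).
Local Notation res n := (res I R2 n).
Local Notation res_d := (@res_d K Q I R2 _).
Local Notation "x $ k" := (mcoeff k (val x)) (at level 10).
Implicit Types (p q r w z : qpath Q) (x y : Lam).

Lemma badpF p q w : pcomp p q = Some w -> ~~ badp w -> ~~ badp p /\ ~~ badp q.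
Proof.
move=> E nw; split; apply: contra nw; first exact: badp_compl E.
exact: badp_compr E.
Qed.

(** Two representatives differ by paths containing relations, so at any other path the coefficient
    depends on the class alone. At paths containing a relation it would depend on the
    representative, hence the default 0. *)
Definition cf w x : K := if badp w then 0 else (quo_repr x)@_w.

Lemma cf_qpi w (y : pathalg K Q) : cf w (qpi I y) = if badp w then 0 else y@_w.
Proof.
rewrite /cf; case: ifPn => // nw; apply/eqP; rewrite -subr_eq0 -mcoeffB mcoeff_eq0.
by apply: contra nw => ws; apply: (memI_badE adm mgp _).1 (quo_reprB I y) _ ws.
Qed.

Lemma cfB w x y : cf w (x - y) = cf w x - cf w y.
Proof.
have [a ->] := qpi_surj x; have [b ->] := qpi_surj y.
by rewrite -qpiB !cf_qpi mcoeffB; case: ifP => //; rewrite subr0.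
Qed.
HB.instance Definition _ w := GRing.isZmodMorphism.Build Lam K (cf w) (@cfB w).

Lemma cfP x y : (forall w, cf w x = cf w y) -> x = y.
Proof.
have [a ->] := qpi_surj x; have [b ->] := qpi_surj y => H.
apply/qpi_eq/(memI_badE adm mgp) => w; apply: contraTT => nw.
have := H w; rewrite !cf_qpi (negPf nw) => e.
by rewrite -mcoeff_eq0 mcoeffB e subrr.
Qed.

Lemma cf_Ml q z w x : pcomp q z = Some w -> ~~ badp w -> cf w (inLam q * x) = cf z x.
Proof.
move=> E nw; have [a ->] := qpi_surj x; have [_ nz] := badpF E nw.
by rewrite -qpiM !cf_qpi (negPf nw) (negPf nz); exact: mcoeff_peltMl.
Qed.

Lemma cf_Ml0 q w x : (forall z, pcomp q z <> Some w) -> cf w (inLam q * x) = 0.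
Proof.
move=> E; have [a ->] := qpi_surj x.
by rewrite -qpiM cf_qpi; case: ifP => // _; exact: mcoeff_peltMl0.
Qed.

Lemma cf_Mr q z w x : pcomp z q = Some w -> ~~ badp w -> cf w (x * inLam q) = cf z x.
Proof.
move=> E nw; have [a ->] := qpi_surj x; have [nz _] := badpF E nw.
by rewrite -qpiM !cf_qpi (negPf nw) (negPf nz); exact: mcoeff_peltMr.
Qed.

Lemma cf_Mr0 q w x : (forall z, pcomp z q <> Some w) -> cf w (x * inLam q) = 0.
Proof.
move=> E; have [a ->] := qpi_surj x.
by rewrite -qpiM cf_qpi; case: ifP => // _; exact: mcoeff_peltMr0.
Qed.

Lemma cf_inLam w p : cf w (inLam p) = if badp w then 0 else (p == w)%:R.
Proof.
rewrite cf_qpi pelt_optE mcoeff_pelt_opt; case: ifP => // _; congr (nat_of_bool _)%:R.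
Qed.

Lemma quo_sumE x : x = \sum_(p <- msupp (quo_repr x)) qpi I ((quo_repr x)@_p *: pelt K p).
Proof.
rewrite -{1}[x]quo_reprK {1}[quo_repr x]pathalgE.
elim: (enum_fset _) => [|p s IH]; first by rewrite !big_nil qpi0.
by rewrite !big_cons -IH -qpiD.
Qed.

Lemma quo_repr_cf x p : ~~ badp p -> (quo_repr x)@_p = cf p x.
Proof. by rewrite /cf => /negPf ->. Qed.

Lemma qpi_bad c p : badp p -> qpi I (c *: pelt K p) = 0.
Proof.
move=> b; apply: cfP => w; rewrite cf_qpi raddf0 -[_ *: _]addr0 mcoeff_lin mcoeff0 addr0.
case: ifPn => // nw; rewrite pelt_optE mcoeff_pelt_opt.
by case: eqP => [[e]|]; rewrite ?mulr0 //; rewrite -e b in nw.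
Qed.

Lemma inLamM p q w : pcomp p q = Some w -> inLam p * inLam q = inLam w.
Proof. by move=> E; rewrite -qpiM; congr (qpi I _); rewrite [LHS]pamulU E. Qed.

Lemma inLamMc c p q w : pcomp p q = Some w ->
  inLam p * qpi I (c *: pelt K q) = qpi I (c *: pelt K w).
Proof.
move=> E; rewrite -qpiM; congr (qpi I _); rewrite -[pelt K w]/(pelt_opt K (Some w)) -E -pamulU.
exact: pamulZr.
Qed.

Lemma inLam_bad p : badp p -> inLam p = 0.
Proof. by move=> b; rewrite -(qpi_bad 1 b) scale1r. Qed.

Lemma quo_sum_ind (P : Lam -> Prop) x : (forall y1 y2, P y1 -> P y2 -> P (y1 + y2)) -> P 0 ->
  (forall p, ~~ badp p -> cf p x != 0 -> P (qpi I (cf p x *: pelt K p))) -> P x.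
Proof.
move=> PD P0 Pp; rewrite [x]quo_sumE; elim/big_ind: _ => // p _.
have [b|nb] := boolP (badp p); first by rewrite qpi_bad.
rewrite quo_repr_cf //; have [->|n] := eqVneq (cf p x) 0; last exact: Pp.
by rewrite scale0r qpi0.
Qed.

Lemma cfM_neq0 w x y : cf w (x * y) != 0 ->
  exists p q, [/\ pcomp p q = Some w, cf p x != 0 & cf q y != 0].
Proof.
rewrite -{1}[x]quo_reprK -{1}[y]quo_reprK -qpiM cf_qpi.
case: ifPn => [|nw]; first by rewrite eqxx.
rewrite mcoeff_neq0 => /msuppM [p [q [ps qs E]]]; exists p, q.
have [np nq] := badpF E nw.
by rewrite -!quo_repr_cf // !mcoeff_neq0.
Qed.

Lemma pcomp_vertex p q v : pcomp p q = Some (pvertex v) -> p = pvertex v /\ q = pvertex v.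
Proof.
move=> E; have := pcomp_plen E; rewrite (_ : plen (pvertex v) = 0%N) // => /esym/eqP.
rewrite addn_eq0 => /andP[/eqP/plen0 ep /eqP/plen0 eq].
have ev : pstart p = v by rewrite -(pcomp_start E).
have ew : pstart q = v by rewrite -(pcomp_end E) ep /pend /= ev.
by rewrite ep eq ev ew.
Qed.

(** A product of paths is a vertex only if both factors are, so having no vertex coefficient defines
    an ideal. *)
Lemma lam_radE x : x \in lam_rad I <-> forall v, cf (pvertex v) x = 0.
Proof.
split.
  apply: (@ideal_gen_ind Lam _ (fun x => forall v, cf (pvertex v) x = 0)).
  - by move=> v; rewrite raddf0.
  - by move=> y1 y2 hy hz v; rewrite cfB hy hz subr0.
  - move=> a y hy v; apply/eqP; apply: contraT => /cfM_neq0 [p [q [/pcomp_vertex[_ ->]]]].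
    by rewrite hy eqxx.
  - move=> a y hy v; apply/eqP; apply: contraT => /cfM_neq0 [p [q [/pcomp_vertex[-> _]]]].
    by rewrite hy eqxx.
  - move=> y [j j0 [z zs ->]] v; rewrite cf_qpi badp_vertex; last exact: generator_len adm mgp.
    apply/eqP; rewrite mcoeff_eq0; apply/negP => /zs.
    by rewrite /plen /parrows /= => e; rewrite -e in j0.
move=> H; apply: (quo_sum_ind (P := fun x => x \in lam_rad I)).
- by move=> y1 y2; exact: rpredD.
- exact: rpred0.
move=> p np n0; apply: ideal_gen_sub; exists (plen p).
  by rewrite lt0n; apply: contra n0 => /eqP/plen0 ->; rewrite H.
exists (cf p x *: pelt K p) => // w; rewrite -[_ *: _]addr0 => /msupp_lin [|].
  by rewrite msupp_pelt in_fset1 => /eqP ->.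
by rewrite msupp0 in_fset0.
Qed.

Lemma lam0_eq0 x : qpi (lam_rad I) x = 0 <-> forall v, cf (pvertex v) x = 0.
Proof.
rewrite -lam_radE -[x in x \in _]subr0; split=> [h|/qpi_eq ->]; last exact: qpi0.
by apply/qpi_eq; rewrite h qpi0.
Qed.

Lemma R2_len r : R2 r -> (1 < plen r)%N. Proof. exact: generator_len adm mgp _. Qed.

Lemma R2_antichain l1 l l2 : relword R2 l -> relword R2 (l1 ++ l ++ l2) ->
  l1 = [::] /\ l2 = [::].
Proof. exact: generator_antichain adm mgp _ _ _. Qed.

(** * The minimal resolution *)

Definition mkR n p (H : Rset R2 n p) : Rtype n := SigSub (mem_set H).

Lemma Rset_val n (k : Rtype n) : Rset R2 n (val k).
Proof. exact: set_mem (valP k). Qed.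

Lemma RL_val n (k : Rtype n) : RL (relword R2) n (parrows (val k)).
Proof. by apply/(RsetE R2_len)/Rset_val. Qed.

Lemma Rprefix_free n (k1 k2 : Rtype n) q1 q2 w :
  pcomp (val k1) q1 = Some w -> pcomp (val k2) q2 = Some w -> k1 = k2 /\ q1 = q2.
Proof.
move=> E1 E2; have := pcomp_parrows E1; rewrite (pcomp_parrows E2) => e.
have [e1 _] := RL_prefix_free R2_antichain (RL_val k1) (RL_val k2) (esym e).
have ek : val k1 = val k2.
  by apply: qpathP => //; rewrite -(pcomp_start E1) (pcomp_start E2).
have ek' : k1 = k2 by exact: val_inj.
by split=> //; subst k2; exact: pcomp_inj_r E1 E2.
Qed.

Lemma Rprefix n (k' : Rtype n.+1) : exists (k : Rtype n) q,
  [/\ pcomp (val k) q = Some (val k'), ~~ badp q & (0 < plen q)%N].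
Proof.
have [r [q [e Hr nq sq]]] := RL_prefix (relword_size R2_len) R2_antichain (RL_val k').
have [u [v [E e1 e2]]] := pcomp_cut e.
have Hu : Rset R2 n u by apply/(RsetE R2_len); rewrite e1.
by exists (mkR Hu), v; split=> //; [apply/asboolP; rewrite e2|rewrite /plen e2].
Qed.

Lemma Rext n (k : Rtype n) (k' : Rtype n.+1) q z w :
  pcomp (val k) q = Some (val k') -> pcomp q z = Some w -> badp w -> ~~ badp z ->
  exists (k'' : Rtype n.+2) u z', pcomp (val k') u = Some (val k'') /\ pcomp u z' = Some z.
Proof.
move=> E F /asboolP bw /asboolP nz.
have nq : ~ bad (relword R2) (parrows q).
  have [k1 [q1 [E1 /asboolP nq1 _]]] := Rprefix k'.
  have [_ <-] := @Rprefix_free n k1 k q1 q (val k') E1 E; exact: nq1.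
have e1 := pcomp_parrows E; have e2 := pcomp_parrows F.
have [|||u [z' [ez HR]]] := @RL_ext _ (relword R2) n (parrows (val k)) (parrows q) (parrows z) _ _ nq _ nz.
- by rewrite -e1; exact: RL_val.
- exact: RL_val.
- by rewrite -e2.
have [pu [pz [G1 G2 G3]]] := pcomp_cut ez.
have [r Er er] : exists2 r, pcomp (val k') pu = Some r & parrows r = parrows (val k') ++ parrows pu.
  by apply: pcomp_Some; rewrite (pend_comp E) (pcomp_end F) (pcomp_start G1).
have Hr : Rset R2 n.+2 r by apply/(RsetE R2_len); rewrite er e1 G2 -catA.
by exists (mkR Hr), pu, pz.
Qed.

Lemma Roverlap n (k : Rtype n) (k' : Rtype n.+1) (k'' : Rtype n.+2) q u :
  pcomp (val k) q = Some (val k') -> pcomp (val k') u = Some (val k'') ->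
  exists2 w, pcomp q u = Some w & badp w.
Proof.
move=> E F; have e1 := pcomp_parrows E; have e2 := pcomp_parrows F.
have [w W ew] : exists2 w, pcomp q u = Some w & parrows w = parrows q ++ parrows u.
  by apply: pcomp_Some; rewrite -(pend_comp E) (pcomp_end F).
exists w => //; apply/asboolP; rewrite ew.
have h1 := RL_val k'; have h0 := RL_val k; have h2 := RL_val k''; rewrite e1 in h1 e2; rewrite e2 -catA in h2.
by have [] := RL_next_size (relword_size R2_len) R2_antichain h1 h0 h2.
Qed.

Lemma resP n (x1 x2 : res n) : (forall k, x1 $ k = x2 $ k) -> x1 = x2.
Proof. by move=> H; apply: val_inj; apply/malgP. Qed.

Lemma res_coefL n (a : Lam^c) (x1 x2 : res n) k : (a *: x1 + x2) $ k = x1 $ k * (a : Lam) + x2 $ k.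
Proof. by rewrite [LHS]mcoeffD; congr (_ + _); exact: rfree_scaleE. Qed.

Lemma res_coefZ n (a : Lam^c) (x1 : res n) k : (a *: x1) $ k = x1 $ k * (a : Lam).
Proof. exact: rfree_scaleE. Qed.

Lemma res_vertex n (x1 : res n) k : inLam (pvertex (pend (val k))) * x1 $ k = x1 $ k.
Proof. by have /asboolP := valP x1. Qed.

Lemma res_coef_start n (x1 : res n) k z : cf z (x1 $ k) != 0 -> pend (val k) = pstart z.
Proof.
rewrite -res_vertex => h; apply/eqP; apply: contraT => n0; move: h.
rewrite cf_Ml0 ?eqxx // => z' E; move: n0.
by rewrite (pcomp_start E) eqxx.
Qed.

Definition gen_val n (k : Rtype n) : rfree Lam (Rtype n) :=
  << inLam (pvertex (pend (val k))) *g k >>.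
Lemma gen_subproof n (k : Rtype n) : gen_val k \in @res_pred K Q I R2 n.
Proof.
apply/asboolP => j; rewrite mcoeffU; case: eqP => [<-|_]; last by rewrite mulr0n mulr0.
by rewrite mulr1n (inLamM (w := pvertex (pend (val k)))) // pcomp_vl eqxx.
Qed.
Definition gen n (k : Rtype n) : res n := exist _ (gen_val k) (gen_subproof k).

Lemma gen_coef n (k j : Rtype n) : gen k $ j =
  if k == j then inLam (pvertex (pend (val k))) else 0.
Proof. by rewrite [LHS]mcoeffU; case: eqP. Qed.

Lemma res_sum_wid n (V : zmodType) (G : Rtype n -> Lam -> V) (x1 : res n) (d : {fset Rtype n}) :
  (forall k, G k 0 = 0) -> (msupp (val x1) `<=` d)%fset ->
  \sum_(k <- msupp (val x1)) G k (x1 $ k) = \sum_(k <- d) G k (x1 $ k).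
Proof.
by move=> G0 le; rewrite (big_fset_incl _ le) // => p _ /mcoeff_outdom ->.
Qed.

Lemma res_sum_lin n (V : lmodType Lam^c) (G : Rtype n -> Lam -> V) :
  (forall k (a x y : Lam), G k (x * a + y) = (a : Lam^c) *: G k x + G k y) ->
  forall (a : Lam^c) (x1 x2 : res n),
  \sum_(k <- msupp (val (a *: x1 + x2))) G k ((a *: x1 + x2) $ k) =
  a *: (\sum_(k <- msupp (val x1)) G k (x1 $ k)) + \sum_(k <- msupp (val x2)) G k (x2 $ k).
Proof.
move=> GL a x1 x2.
have G0 k : G k 0 = 0.
  by apply: (addrI (G k 0)); rewrite -[X in X + _](scale1r (G k 0)) -GL mul0r !addr0.
pose y0 : res n := a *: x1 + x2; rewrite -/y0.
pose d := (msupp (val y0) `|` (msupp (val x1) `|` msupp (val x2)))%fset.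
rewrite (@res_sum_wid _ _ _ _ d) ?fsubsetUl // (@res_sum_wid _ _ _ x1 d) //; last first.
  by rewrite /d; apply: fsubset_trans (fsubsetUr _ _); apply: fsubsetUl.
rewrite (@res_sum_wid _ _ _ x2 d) //; last first.
  by rewrite /d; apply: fsubset_trans (fsubsetUr _ _); apply: fsubsetUr.
rewrite scaler_sumr -big_split /=; apply: eq_bigr => k _.
by rewrite /y0 res_coefL GL.
Qed.

Definition rsingle n (k : Rtype n) x : rfree Lam (Rtype n) := << x *g k >>.

Lemma rsingle_coef n (k j : Rtype n) x : (rsingle k x)@_j = if k == j then x else 0.
Proof. by rewrite [LHS]mcoeffU; case: eqP. Qed.

Lemma rfree_coefZ n (a : Lam^c) (x1 : rfree Lam (Rtype n)) j : (a *: x1)@_j = x1@_j * (a : Lam).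
Proof. exact: rfree_scaleE. Qed.
Lemma rsingle_lin n (k : Rtype n) x y (b : Lam^c) :
  rsingle k (x * (b : Lam) + y) = b *: rsingle k x + rsingle k y.
Proof.
apply/malgP => j.
refine (etrans (rsingle_coef k j _) _).
refine (esym (etrans (mcoeffD _ _ _) _)).
refine (etrans (congr2 (fun u v : Lam => u + v) (etrans (rfree_coefZ b (rsingle k x) j) (congr1 (fun u : Lam => u * (b:Lam)) (rsingle_coef k j x))) (rsingle_coef k j y)) _).
by case: eqP => _; rewrite // mul0r addr0.
Qed.
(** The summand of [res_d_val] at [k] as a function of the coordinate, the form to which
    [res_sum_lin] applies. *)
Definition res_d_term n (k : Rtype n.+1) x : rfree Lam (Rtype n) :=
  \sum_(i < (plen (val k)).+1)
    if insub (ptake i (val k)) is Some k' then rsingle k' (inLam (pdrop i (val k)) * x) else 0.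

Lemma res_d_linear n : linear (@Defs.res_d K Q I R2 n).
Proof.
move=> a x1 x2; apply: val_inj.
apply: (@res_sum_lin _ (rfree Lam (Rtype n)) (@res_d_term n)) => k b y1 y2.
rewrite /res_d_term scaler_sumr -big_split /=; apply: eq_bigr => i _.
case: insubP => [k' _ _|_]; last by rewrite scaler0 addr0.
rewrite mulrDr mulrA.
exact: rsingle_lin.
Qed.
HB.instance Definition _ n := GRing.isLinear.Build Lam^c (res n.+1) (res n) *:%R
  (@Defs.res_d K Q I R2 n) (@res_d_linear n).

(** The matrix entry of the differential at R' and R: the path p with R = R' p, or 0 if R' is not a
    prefix of R. It absorbs the sum over cut positions. *)
Definition diff_coef n (k : Rtype n) (k' : Rtype n.+1) : Lam :=
  if ptake (plen (val k)) (val k') == val k then inLam (pdrop (plen (val k)) (val k')) else 0.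

Lemma plen_ptake i p : (i <= plen p)%N -> plen (ptake i p) = i.
Proof. by move=> le; rewrite /plen [parrows _]/(take i (parrows p)) size_takel. Qed.

Lemma res_d_termE n (k : Rtype n) (k' : Rtype n.+1) x :
  (res_d_term k' x)@_k = diff_coef k k' * x.
Proof.
rewrite /res_d_term raddf_sum /= /diff_coef; case: eqP => [e|n0].
  have le : (plen (val k) < (plen (val k')).+1)%N.
    by rewrite ltnS -{1}e /plen [parrows _]/(take _ (parrows (val k'))) size_take_min geq_minr.
  rewrite (bigD1 (Ordinal le)) //= big1 ?addr0 => [|i ni].
    case: insubP => [u _ eu|]; last by rewrite e (valP k).
    by rewrite (_ : u = k) ?mcoeffUU //; apply: val_inj; rewrite eu.
  case: insubP => [u _ eu|]; last by rewrite mcoeff0.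
  rewrite mcoeffU; case: eqP => // euk; case/eqP: ni; apply: val_inj => /=.
  by rewrite -euk eu plen_ptake // -ltnS.
rewrite mul0r big1 // => i _; case: insubP => [u _ eu|]; last by rewrite mcoeff0.
rewrite mcoeffU; case: eqP => // euk; case: n0.
by rewrite -euk eu plen_ptake // -ltnS.
Qed.

Lemma res_dE n (x1 : res n.+1) k : res_d x1 $ k =
  \sum_(k' <- msupp (val x1)) diff_coef k k' * x1 $ k'.
Proof.
rewrite [LHS]raddf_sum; apply: eq_bigr => k' _; exact: res_d_termE.
Qed.

Lemma res_coefD n (x1 x2 : res n) k : (x1 + x2) $ k = x1 $ k + x2 $ k.
Proof. exact: mcoeffD. Qed.

Lemma res_coef_sum n (J : Type) (r : seq J) (F : J -> res n) k :
  (\sum_(j <- r) F j) $ k = \sum_(j <- r) (F j $ k).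
Proof.
elim: r => [|j r IH]; first by rewrite !big_nil; exact: mcoeff0.
by rewrite !big_cons -IH; exact: mcoeffD.
Qed.

Lemma gen_scale_coef n (k j : Rtype n) (a : Lam) : ((a : Lam^c) *: gen k) $ j =
  if k == j then inLam (pvertex (pend (val k))) * a else 0.
Proof. by rewrite res_coefZ gen_coef; case: eqP => //; rewrite mul0r. Qed.

Lemma res_sumE n (x1 : res n) : x1 = \sum_(k <- msupp (val x1)) (x1 $ k : Lam^c) *: gen k.
Proof.
apply: resP => j; rewrite res_coef_sum.
under eq_bigr => k _ do rewrite gen_scale_coef.
have [js|js] := boolP (j \in msupp (val x1)); last first.
  rewrite (mcoeff_outdom js) big_seq_cond big1 // => k; rewrite andbT => ks.
  by case: eqP => // e; rewrite -e ks in js.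
rewrite (bigD1_seq j) //= eqxx res_vertex big1 ?addr0 // => k.
by case: eqP => // ->; rewrite eqxx.
Qed.

(** Projectivity in a form that needs preimages of the generators only, so that it also builds lifts
    along maps that are not surjective. *)
Lemma res_lift n (X Y : lmodType Lam^c) (g : {linear X -> Y}) (f : {linear res n -> Y}) :
  (forall k, exists a, g a = f (gen k)) -> exists h : {linear res n -> X}, forall m, g (h m) = f m.
Proof.
move=> /choice [v Hv].
pose h0 (x1 : res n) : X := \sum_(k <- msupp (val x1)) (x1 $ k : Lam^c) *: v k.
have lin : linear h0.
  apply: (@res_sum_lin n X (fun k x => (x : Lam^c) *: v k)) => k a y1 y2.
  by rewrite scalerA scalerDl.
pose h : {linear res n -> X} := HB.pack h0 (GRing.isLinear.Build _ _ _ _ h0 lin).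
exists h => m; rewrite {2}[m]res_sumE !linear_sum /=.
by apply: eq_bigr => k _; rewrite !linearZ /= Hv.
Qed.

Lemma res_linear_ext n (X : lmodType Lam^c) (f g : {linear res n -> X}) :
  (forall k, f (gen k) = g (gen k)) -> forall x1 : res n, f x1 = g x1.
Proof.
move=> H x1; rewrite [x1]res_sumE !linear_sum; apply: eq_bigr => k _.
by rewrite !linearZ /= H.
Qed.

Lemma diff_coef_prefix n (k : Rtype n) (k' : Rtype n.+1) q :
  pcomp (val k) q = Some (val k') -> diff_coef k k' = inLam q.
Proof. by move=> E; rewrite /diff_coef (ptake_pcomp E) eqxx (pdrop_pcomp E). Qed.

Lemma diff_coef_neq0 n (k : Rtype n) (k' : Rtype n.+1) : diff_coef k k' != 0 ->
  exists2 q, pcomp (val k) q = Some (val k') & diff_coef k k' = inLam q.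
Proof.
rewrite /diff_coef; case: ifP => [/eqP e _|_]; last by rewrite eqxx.
exists (pdrop (plen (val k)) (val k')) => //.
by have := pcomp_take_drop (plen (val k)) (val k'); rewrite e.
Qed.

Lemma res_d_gen n (k : Rtype n) (k' : Rtype n.+1) q :
  pcomp (val k) q = Some (val k') -> res_d (gen k') = (inLam q : Lam^c) *: gen k.
Proof.
move=> E; apply: resP => j; rewrite res_dE gen_scale_coef.
rewrite (@res_sum_wid n.+1 _ (fun k' x => diff_coef j k' * x) (gen k') [fset k']%fset); last 2 first.
- by move=> i; rewrite mulr0.
- by rewrite [val _]/(gen_val k'); exact: msuppU_le.
rewrite big_seq_fset1 gen_coef eqxx.
have eq0 : inLam q * inLam (pvertex (pend (val k'))) = inLam q.
  by apply: inLamM; rewrite pcomp_vr (pend_comp E) eqxx.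
case: (eqVneq k j) => [<-|n0].
  rewrite (diff_coef_prefix E) eq0 (inLamM (w := q)) // pcomp_vl.
  by rewrite (pcomp_end E) eqxx.
have [->|/diff_coef_neq0 [q' E' _]] := eqVneq (diff_coef j k') 0; first by rewrite mul0r.
by have [ej _] := Rprefix_free E E'; rewrite ej eqxx in n0.
Qed.

(** Distinct elements of R^(n+1) are not prefixes of the same path, so only the summand at [k']
    contributes to the coefficient of [w]. *)
Lemma res_d_cf n (x1 : res n.+1) (k : Rtype n) (k' : Rtype n.+1) q z w :
  pcomp (val k) q = Some (val k') -> pcomp q z = Some w -> ~~ badp w ->
  cf w (res_d x1 $ k) = cf z (x1 $ k').
Proof.
move=> E F nw; rewrite res_dE raddf_sum /=.
have other j : j != k' -> cf w (diff_coef k j * x1 $ j) = 0.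
  move=> nj; have [->|/diff_coef_neq0 [q' E' ->]] := eqVneq (diff_coef k j) 0; first by rewrite mul0r raddf0.
  apply: cf_Ml0 => z' F'.
  have [c C1 C2] := pcomp_assoc E F; have [c' C1' C2'] := pcomp_assoc E' F'.
  have cc : c = c' by move: C2; rewrite C2' => -[].
  by rewrite -cc in C1'; have [ej _] := Rprefix_free C1 C1'; rewrite ej eqxx in nj.
have [ks|ks] := boolP (k' \in msupp (val x1)); last first.
  rewrite (mcoeff_outdom ks) raddf0 big_seq_cond big1 // => j; rewrite andbT => js.
  by apply: other; apply: contra ks => /eqP <-.
rewrite (bigD1_seq k' ks (fset_uniq _)) /=; rewrite [X in _ + X]big1 ?addr0; last by move=> j; exact: other.
by rewrite (diff_coef_prefix E) (cf_Ml _ F nw).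
Qed.

Lemma res_d_d n (x1 : res n.+2) : res_d (res_d x1) = 0.
Proof.
pose f : {linear res n.+2 -> res n} := (@Defs.res_d K Q I R2 n) \o (@Defs.res_d K Q I R2 n.+1).
rewrite -[LHS]/(f x1) -[RHS]/((\0 : {linear res n.+2 -> res n}) x1).
apply: res_linear_ext => k''; rewrite /=.
have [k' [u [E _ _]]] := Rprefix k''; have [k [q [F _ _]]] := Rprefix k'.
rewrite (res_d_gen E) linearZ /= (res_d_gen F) scalerA.
have [w W b] := Roverlap F E.
have e0 : (inLam u : Lam^c) * inLam q = 0 by rewrite -(inLam_bad b); exact: inLamM W.
by rewrite e0 scale0r.
Qed.

Lemma gen_scale_im n (k : Rtype n) (k' : Rtype n.+1) u (c : Lam) :
  pcomp (val k) u = Some (val k') ->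
  exists y1 : res n.+1, ((inLam u * c : Lam) : Lam^c) *: gen k = res_d y1.
Proof.
by move=> E; exists ((c : Lam^c) *: gen k'); rewrite linearZ /= (res_d_gen E) scalerA.
Qed.

Lemma res_im_ind n (x1 : res n) :
  (forall k p, ~~ badp p -> cf p (x1 $ k) != 0 ->
    exists (k' : Rtype n.+1) u z, pcomp (val k) u = Some (val k') /\ pcomp u z = Some p) ->
  exists y1 : res _, x1 = res_d y1.
Proof.
move=> H; pose im (y0 : res n) := exists y1 : res n.+1, y0 = res_d y1.
have im0 : im 0 by exists 0; rewrite linear0.
have imD a b : im a -> im b -> im (a + b).
  by move=> [a1 ->] [b1 ->]; exists (a1 + b1); rewrite linearD.
rewrite -/(im x1) [x1]res_sumE; elim/big_ind: _ => // k _.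
apply: (@quo_sum_ind (fun a => im ((a : Lam^c) *: gen k))).
- by move=> a b ia ib; rewrite scalerDl; exact: imD.
- by rewrite scale0r.
move=> p np n0; have [k' [u [z [E F]]]] := H k p np n0.
exact: (eq_ind _ (fun a : Lam => im ((a : Lam^c) *: gen k)) (gen_scale_im _ E) _ (inLamMc _ F)).
Qed.

(** Let [p] occur at [k'] in a cycle, with [q] the step from [k] to [k']. If the composite of [q]
    and [p] survived in Lambda, [res_d_cf] would make it visible in the differential. So it contains
    a relation while [p] does not, and [Rext] splits the next step off [p]. *)
Lemma res_exact n (x1 : res n.+1) : res_d x1 = 0 <-> exists y1 : res _, x1 = res_d y1.
Proof.
split=> [dx|[y1 ->]]; last exact: res_d_d.
apply: res_im_ind => k' p np n0.
have [k [q [E nq _]]] := Rprefix k'.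
have [w W _] := pcomp_Some (etrans (esym (pend_comp E)) (res_coef_start n0)).
have [bw|nw] := boolP (badp w); last first.
  by move: n0; rewrite -(res_d_cf x1 E W nw) dx [_ $ _]mcoeff0 raddf0 eqxx.
by have [k'' [u [z' [G1 G2]]]] := Rext E W bw np; exists k'', u, z'.
Qed.

(** * The length grading of the resolution *)

Definition homog (j : int) x := forall p, cf p x != 0 -> (plen p)%:Z = j.

Lemma homog0 j : homog j 0.
Proof. by move=> p; rewrite raddf0 eqxx. Qed.

Lemma homogD j x y : homog j x -> homog j y -> homog j (x + y).
Proof.
move=> hx hy p; rewrite raddfD /=.
have [e|n] := eqVneq (cf p x) 0; last by move=> _; exact: hx.
by rewrite e add0r; exact: hy.
Qed.

Lemma homogM i j x y : homog i x -> homog j y -> homog (i + j) (x * y).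
Proof.
move=> hx hy w /cfM_neq0 [p [q [/pcomp_plen -> /hx ep /hy eq]]].
by rewrite PoszD ep eq.
Qed.

Lemma homog_qpi c p : homog (plen p)%:Z (qpi I (c *: pelt K p)).
Proof.
move=> w; rewrite cf_qpi; case: ifP => _; first by rewrite eqxx.
rewrite -[_ *: _]addr0 mcoeff_lin mcoeff0 addr0 pelt_optE mcoeff_pelt_opt.
by case: (Some p =P Some w) => [[->] //|_]; rewrite mulr0 eqxx.
Qed.

Lemma homog_inLam p : homog (plen p)%:Z (inLam p).
Proof. by have := @homog_qpi 1 p; rewrite scale1r. Qed.

Lemma lam_gr_homog j y : lam_gr (I := I) j y -> homog j%:Z y.
Proof.
move=> [a ha ->] p; rewrite cf_qpi; case: ifP => _; first by rewrite eqxx.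
by rewrite mcoeff_neq0 => /ha ->.
Qed.

(** The generator at [k] is placed in degree [plen (val k)], which makes the differential
    homogeneous of degree 0. *)
Definition res_gr n (i : int) : set (res n) :=
  fun x1 : res n => forall k, homog (i - (plen (val k))%:Z) (x1 $ k).

Lemma res_gr0 n i : res_gr i (0 : res n).
Proof. by move=> k; rewrite [_ $ _]mcoeff0; exact: homog0. Qed.

Lemma res_grD n i (x1 x2 : res n) : res_gr i x1 -> res_gr i x2 -> res_gr i (x1 + x2).
Proof. by move=> h1 h2 k; rewrite res_coefD; exact: homogD. Qed.

Lemma res_gr_gen n (k : Rtype n) c p :
  res_gr ((plen p)%:Z + (plen (val k))%:Z) ((qpi I (c *: pelt K p) : Lam^c) *: gen k).
Proof.
move=> j; rewrite gen_scale_coef; case: eqP => [<-|_]; last exact: homog0.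
rewrite addrK -[(plen p)%:Z]add0r; apply: homogM; last exact: homog_qpi.
exact: (@homog_inLam (pvertex _)).
Qed.

(** Distinctness of the degrees in [s] serves the induction: a new term in a degree already listed
    alters a single component. *)
Lemma res_gr_sum n (x1 : res n) : exists (s : seq int) (c : int -> res n),
  uniq s /\ (forall i, res_gr i (c i)) /\ x1 = \sum_(i <- s) c i.
Proof.
pose dec (x1 : res n) := exists (s : seq int) (c : int -> res n),
  uniq s /\ (forall i, res_gr i (c i)) /\ x1 = \sum_(i <- s) c i.
have decD j (y1 x2 : res n) : dec y1 -> res_gr j x2 -> dec (y1 + x2).
  move=> [s [c [us [gc ->]]]] gj.
  have [js|js] := boolP (j \in s).
    exists s, (fun i => if i == j then c i + x2 else c i); split=> //; split.
      by move=> i; case: eqP => [->|_] //; exact: res_grD.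
    rewrite !(bigD1_seq j js us) /= eqxx addrAC; congr (_ + _).
    by apply: eq_bigr => i /negPf ->.
  exists (j :: s), (fun i => if i == j then x2 else c i); split; first by rewrite /= js.
  split; first by move=> i; case: eqP => [->|_].
  rewrite big_cons eqxx addrC; congr (_ + _); rewrite big_seq [RHS]big_seq.
  by apply: eq_bigr => i; case: eqP => // ->; rewrite (negPf js).
rewrite -/(dec x1) [x1]res_sumE; elim/big_rec: _ => [|k y1 _].
  by exists [::], (fun=> 0); split=> //; split; [move=> i; exact: res_gr0|rewrite big_nil].
move: (x1 $ k) => a; rewrite addrC; move: y1.
apply: (@quo_sum_ind (fun a => forall y1 : res n, dec y1 -> dec (y1 + (a : Lam^c) *: gen k))).
- by move=> b b' hb hb' y1 dy; rewrite scalerDl addrA; apply: hb'; exact: hb.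
- by move=> y1 dy; rewrite scale0r addr0.
- by move=> p _ _ y1 dy; apply: decD dy _; exact: res_gr_gen.
Qed.

Lemma res_grading n : module_grading (@lam_gr K Q I) (@res_gr n).
Proof.
split.
- by move=> i; exact: res_gr0.
- by move=> i x1 x2; exact: res_grD.
- move=> i j x1 a gx ga k; rewrite res_coefZ addrAC.
  by apply: homogM; [exact: gx|exact: lam_gr_homog].
- by move=> x1; have [s [c [_ h]]] := res_gr_sum x1; exists s, c.
move=> s c us gc e i si; apply: resP => k; apply: cfP => z.
rewrite [RHS](_ : _ = 0); last by rewrite [_ $ _]mcoeff0 raddf0.
apply/eqP; apply: contraT => n0; have ei := gc i k z n0.
have := congr1 (fun x1 : res n => cf z (x1 $ k)) e.
rewrite /= res_coef_sum raddf_sum /= (bigD1_seq i si us) /= [X in _ + X]big1.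
  by rewrite addr0 [RHS](_ : _ = 0) => [h|]; [rewrite h eqxx in n0|rewrite mcoeff0 raddf0].
move=> j nj; apply/eqP; apply: contraT => n1; case/eqP: nj.
by have := gc j k z n1; rewrite ei => /addIr ->.
Qed.

Lemma res_d_degree n i (x1 : res n.+1) : res_gr i x1 -> res_gr i (res_d x1).
Proof.
move=> g k; rewrite res_dE; elim/big_ind: _ => [|a b|k' _].
- exact: homog0.
- exact: homogD.
have [->|/diff_coef_neq0 [q E ->]] := eqVneq (diff_coef k k') 0; first by rewrite mul0r; exact: homog0.
have -> : i - (plen (val k))%:Z = (plen q)%:Z + (i - (plen (val k'))%:Z).
  rewrite (pcomp_plen E) PoszD opprD [RHS]addrCA; congr (_ + _).
  by rewrite addrCA subrr addr0.
by apply: homogM; [exact: homog_inLam|exact: g].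
Qed.

(** * The augmentation onto Lambda_0 and minimality *)

Lemma res_eps_linear : linear (@res_eps K Q I R2).
Proof.
apply: (@res_sum_lin 0 lam0 (fun _ x => qpi (lam_rad I) x)) => k a x y.
by rewrite qpiD qpiM.
Qed.
HB.instance Definition _ := GRing.isLinear.Build Lam^c (res 0) lam0 *:%R
  (@res_eps K Q I R2) res_eps_linear.

Lemma res_eps_gen (k : Rtype 0) : res_eps (gen k) = qpi (lam_rad I) (inLam (pvertex (pend (val k)))).
Proof.
rewrite /res_eps (@res_sum_wid 0 _ (fun _ x => qpi (lam_rad I) x) (gen k) [fset k]%fset).
- by rewrite big_seq_fset1 gen_coef eqxx.
- by move=> _; exact: qpi0.
- by rewrite [val _]/(gen_val k); exact: msuppU_le.
Qed.

Lemma qpi_sum (J : Type) (r : seq J) (F : J -> Lam) :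
  qpi (lam_rad I) (\sum_(j <- r) F j) = \sum_(j <- r) qpi (lam_rad I) (F j).
Proof.
by elim: r => [|j r IH]; rewrite ?big_nil ?qpi0 // !big_cons qpiD IH.
Qed.

Lemma lam0_eq x y : (forall v, cf (pvertex v) x = cf (pvertex v) y) <->
  qpi (lam_rad I) x = qpi (lam_rad I) y.
Proof.
split=> [h|/qpi_eq /lam_radE h v].
  by apply/qpi_eq/lam_radE => v; rewrite cfB h subrr.
by have /eqP := h v; rewrite cfB subr_eq0 => /eqP.
Qed.

Lemma R0_vertex (k : Rtype 0) : val k = pvertex (pend (val k)).
Proof. by have e := plen0 (Rset_val k); rewrite e. Qed.

(** The coordinate at a vertex consists of paths starting there, so only the coordinate at [k] can
    contain its trivial path. *)
Lemma res_eps_cf (x1 : res 0) k a : res_eps x1 = qpi (lam_rad I) a ->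
  cf (pvertex (pend (val k))) (x1 $ k) = cf (pvertex (pend (val k))) a.
Proof.
rewrite /res_eps -qpi_sum => /lam0_eq <-; rewrite raddf_sum /=.
have other j : j != k -> cf (pvertex (pend (val k))) (x1 $ j) = 0.
  move=> nj; apply/eqP; apply: contraT => /res_coef_start e; case/eqP: nj.
  by apply: val_inj; rewrite (R0_vertex k) (R0_vertex j) e.
have [ks|ks] := boolP (k \in msupp (val x1)).
  by rewrite (bigD1_seq k ks (fset_uniq _)) /= [X in _ + X]big1 ?addr0 // => j; exact: other.
rewrite (mcoeff_outdom ks) raddf0 big_seq_cond big1 // => j; rewrite andbT => js.
by apply: other; apply: contra ks => /eqP <-.
Qed.

Lemma rad_inLam p : (0 < plen p)%N -> inLam p \in lam_rad I.
Proof.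
move=> l; apply/lam_radE => v; rewrite cf_inLam; case: ifP => // _; case: eqP => // e.
by rewrite e in l.
Qed.

Lemma lam0_scale_rad (a : Lam) (y0 : lam0) : a \in lam_rad I -> (a : Lam^c) *: y0 = 0.
Proof.
move=> ha; have [b ->] := qpi_surj y0; rewrite [LHS](_ : _ = qpi (lam_rad I) (b * a)).
  by apply/lam0_eq0/lam_radE; exact: tsideal_mull.
by rewrite qpiM.
Qed.

(** The differential has entries in the radical, which annihilates Lambda_0. Hence coboundaries
    vanish and equality in Ext is equality of maps. *)
Lemma res_lam0_d n (u : {linear res n -> lam0}) (x1 : res n.+1) : u (res_d x1) = 0.
Proof.
pose f : {linear res n.+1 -> lam0} := u \o (@Defs.res_d K Q I R2 n).
rewrite -[LHS]/(f x1) -[RHS]/((\0 : {linear res n.+1 -> lam0}) x1).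
apply: res_linear_ext => k'; rewrite /=.
have [k [q [E _ l]]] := Rprefix k'.
by rewrite (res_d_gen E) linearZ /= lam0_scale_rad // rad_inLam.
Qed.

(** An element of the kernel has no trivial path in its coordinates, and the first arrow of any
    other path is an element of R^1. *)
Lemma res_exact0 (x1 : res 0) : res_eps x1 = 0 <-> exists y1 : res _, x1 = res_d y1.
Proof.
split=> [e|[y1 ->]]; last exact: (res_lam0_d (@res_eps K Q I R2)).
apply: res_im_ind => k p np n0.
have st := res_coef_start n0.
have [s lp] : exists s, parrows p = s by exists (parrows p).
case: s lp => [|a s] lp.
  have ep := plen0 (congr1 size lp); move: n0.
  by rewrite ep -st (res_eps_cf k (a := 0)) ?raddf0 ?eqxx // e qpi0.
have [u [z [E eu _]]] := @pcomp_cut _ p [:: a] s lp.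
have Hu : Rset R2 1 u by rewrite /= /plen eu.
exists (mkR Hu), u, z; split=> //=.
rewrite (R0_vertex k) pcomp_vl -(pcomp_start E) st eqxx.
by [].
Qed.

Lemma res_minimal n (x1 : res n.+1) : in_mulrad (lam_rad I) (res_d x1).
Proof.
rewrite [x1]res_sumE linear_sum; elim/big_ind: _ => [|a b [s [hs ->]] [t [ht ->]]|k' _].
- by exists [::]; split=> //; rewrite big_nil.
- exists (s ++ t); split; last by rewrite big_cat.
  by move=> y; rewrite mem_cat => /orP[/hs|/ht].
have [k [q [E _ l]]] := Rprefix k'.
exists [:: (inLam q * x1 $ k', gen k)]; split.
  by move=> y; rewrite inE => /eqP -> /=; apply: tsideal_mulr; exact: rad_inLam.
by rewrite big_seq1 /= linearZ /= (res_d_gen E) scalerA.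
Qed.

Lemma vertex0P v : Rset R2 0 (pvertex v).
Proof. by []. Qed.

Lemma res_eps_surj (y0 : lam0) : exists x1 : res 0, res_eps x1 = y0.
Proof.
have [a ->] := qpi_surj y0.
(* This sum of all vertex generators is sent to the class of 1. *)
pose e0 : res 0 := \sum_v gen (mkR (vertex0P v)).
exists ((a : Lam^c) *: e0); rewrite linearZ /= /e0 linear_sum /=.
have -> : \sum_v res_eps (gen (mkR (vertex0P v))) = qpi (lam_rad I) 1.
  rewrite (_ : 1 = \sum_v inLam (pvertex v)) ?qpi_sum; first by apply: eq_bigr => v _; exact: res_eps_gen.
  have -> : 1 = qpi I 1 :> Lam by [].
  rewrite [1 in LHS]/(paone K Q) /paone.
  by elim: (index_enum _) => [|v r IH]; rewrite ?big_nil ?qpi0 // !big_cons qpiD IH.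
by rewrite -[a in RHS](mul1r a) qpiM.
Qed.

Lemma res_mgpr : @minimal_graded_projective_resolution Lam (@lam_gr K Q I) (lam_rad I)
  (fun n => res n) res_gr (fun n => (@Defs.res_d K Q I R2 n : {linear _ -> _}))
  (@res_eps K Q I R2 : {linear _ -> _}).
Proof.
split.
- exact: res_grading.
- move=> n X Y g f hg; apply: res_lift => k; exact: hg.
- exact: res_d_degree.
- move=> i x1 g ni; rewrite [LHS]/(res_eps x1) /res_eps; apply: big1 => k _; apply/lam0_eq0 => v.
  apply/eqP; apply: contraT => /(g k) e; case: ni; move: e.
  by rewrite (_ : plen (val k) = 0%N) ?subr0 // (Rset_val k).
- exact: res_eps_surj.
- exact: res_exact0.
- exact: res_exact.
- exact: res_minimal.
Qed.

(** [gen k] has a vertex in its coordinate at [k]. If it is a combination of elements of degree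
    [delta D A n], one of these must have a vertex there too, since only products of vertices are
    vertices. Homogeneity then identifies [plen (val k)] with that degree. *)
Lemma R_len D A n (k : Rtype n) : stacked I D A -> plen (val k) = delta D A n.
Proof.
move=> st; have [s [hs e]] := st _ _ _ _ res_mgpr n (gen k).
pose v := pend (val k).
have := congr1 (fun x1 : res n => cf (pvertex v) (x1 $ k)) e.
rewrite /= gen_coef eqxx cf_inLam badp_vertex; last exact: R2_len.
rewrite eqxx => h; have : (1 : K) != 0 by exact: oner_neq0.
rewrite -[1]/(true%:R) h res_coef_sum raddf_sum /= big_seq => n0.
have [y ys ny] : exists2 y, y \in s & cf (pvertex v) (((y.1 : Lam^c) *: y.2) $ k) != 0.
  apply: contrapT => no; case/eqP: n0; apply: big1 => y ys.
  by apply/eqP; apply: contraT => ny; case: no; exists y.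
move: ny; rewrite res_coefZ => /cfM_neq0 [p [q [/pcomp_vertex [-> _] /(hs y ys) e1 _]]].
by move: e1; rewrite (_ : plen (pvertex v) = 0%N) // => /esym/eqP; rewrite subr_eq0 => /eqP [].
Qed.

(** [RL] does not ask consecutive arrows to compose. They do, because each new relation shares at
    least one arrow with what precedes it. *)
Lemma RL_path n s : RL (relword R2) n.+1 s -> exists p, parrows p = s.
Proof.
elim: n s => [|[|n] IH] s.
- by case: s => [|a [|? ?]] //= _; exists (parrow a).
- by move=> [r _ <-]; exists r.
move=> [r [p [u [_ /IH [x1 ex] -> [v [q [[y1 _ ey] epu su]]] _]]]].
have sv : (size v <= size p)%N.
  by have := congr1 size epu; rewrite !size_cat; case/andP: su => _ su h; rewrite -(leq_add2r (size q)) -h leq_add2l ltnW.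
have [d [ed eq]] := cat_le_split (esym epu) sv.
have sd : (0 < size d)%N.
  by case/andP: su => _; rewrite eq size_cat -{1}[size u]add0n ltn_add2r.
rewrite ed catA in ex; have [x2 [x3 [E1 _ e3]]] := pcomp_cut ex.
rewrite eq in ey; have [y2 [y3 [F1 f2 f3]]] := pcomp_cut ey.
have e23 : x3 = y2 by apply: qpath_eq; rewrite ?e3 // /plen e3.
have [w _ ew] : exists2 w, pcomp x1 y3 = Some w & parrows w = parrows x1 ++ parrows y3.
  by apply: pcomp_Some; rewrite (pend_comp E1) e23 (pcomp_end F1).
by exists w; rewrite ew ex f3 ed -!catA.
Qed.

Lemma RL_len D A n s : stacked I D A -> RL (relword R2) n s -> size s = delta D A n.
Proof.
move=> st; case: n => [|n] H; first exact: H.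
have [p ep] := RL_path H; rewrite -ep in H *.
by rewrite -(R_len (mkR (proj2 (RsetE R2_len n.+1 p) H)) st).
Qed.

(** * Products in the Ext algebra *)

Lemma dual_basis_linear n (k : Rtype n) : linear (@dual_basis K Q I R2 n k).
Proof.
by move=> a x1 x2; rewrite /dual_basis res_coefL qpiD qpiM.
Qed.
HB.instance Definition _ n (k : Rtype n) := GRing.isLinear.Build Lam^c (res n) lam0 *:%R
  (@dual_basis K Q I R2 n k) (dual_basis_linear k).

Lemma chain_lift_ex n (f : {linear res n -> lam0}) :
  exists phi : forall k, {linear res (k + n) -> res k}, chain_lift f phi.
Proof.
(* The invariant of the comparison theorem: boundaries go to boundaries, which is what the next
   lifting requires. *)
pose P k (phi : {linear res (k + n) -> res k}) :=
  forall x1 : res (k + n).+1, exists y1 : res k.+1, phi (res_d x1) = res_d y1.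
have [phi0 phi0E] := res_lift (g := @res_eps K Q I R2) (f := f) (fun k => res_eps_surj _).
have P0 : P 0%N phi0.
  by move=> x1; apply/res_exact0; rewrite phi0E res_lam0_d.
have step k (phi : {phi | P k phi}) : exists phi' : {phi | P k.+1 phi},
    forall x1 : res (k.+1 + n), res_d (sval phi' x1) = sval phi (res_d x1).
  case: phi => phi Pk /=.
  pose fd : {linear res (k.+1 + n) -> res k} := phi \o (@Defs.res_d K Q I R2 (k + n)).
  have [phi' E] : exists h : {linear res (k.+1 + n) -> res k.+1}, forall m, res_d (h m) = fd m.
    by apply: (res_lift (g := @Defs.res_d K Q I R2 k) (f := fd)) => j;
      have [y1 e] := Pk (gen j); exists y1; exact: esym e.
  have P' : P k.+1 phi'.
    by move=> x1; apply/res_exact; rewrite E /fd /= res_d_d linear0.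
  by exists (exist _ phi' P').
pose seqphi := fix F k : {phi | P k phi} :=
  if k is k'.+1 then sval (cid (step k' (F k'))) else exist _ phi0 P0.
exists (fun k => sval (seqphi k)); split; first exact: phi0E.
by move=> k x1 /=; case: (cid (step k (seqphi k))).
Qed.

Lemma ext_mul_ex m n (g : Rtype m) (f : Rtype n) :
  exists h, ext_mul (m := m) (n := n) (@dual_basis K Q I R2 m g) (@dual_basis K Q I R2 n f) h.
Proof.
have [phi H] := chain_lift_ex (@dual_basis K Q I R2 n f).
by exists (fun x1 : res (m + n) => dual_basis g (phi m x1)), phi.
Qed.

Section Lift.
Variables (n : nat) (k0 : Rtype n) (phi : forall k, {linear res (k + n) -> res k}).
Hypothesis lift : chain_lift (@dual_basis K Q I R2 n k0) phi.

Lemma lift_cf0 (s : Rtype 0) (r : Rtype (0 + n)) :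
  cf (pvertex (pend (val s))) (phi 0%N (gen r) $ s) =
  ((k0 == r) && (pend (val r) == pend (val s)))%:R.
Proof.
have e := lift.1 (gen r); rewrite /dual_basis in e.
rewrite (res_eps_cf s e) gen_coef (eq_sym r).
case: (k0 =P r) => [<-|_]; last by rewrite raddf0.
rewrite cf_inLam badp_vertex; last exact: R2_len.
by congr (nat_of_bool _)%:R; apply/eqP/eqP => [/(congr1 (@pstart Q))|->].
Qed.

(** [res_d_cf] read backwards, together with the chain map identity. *)
Lemma lift_cfS k (s : Rtype k) (s' : Rtype k.+1) q (r : Rtype (k + n)) (r' : Rtype (k.+1 + n)) p z w :
  pcomp (val s) q = Some (val s') -> pcomp (val r) p = Some (val r') ->
  pcomp q z = Some w -> ~~ badp w ->
  cf z (phi k.+1 (gen r') $ s') = cf w (phi k (gen r) $ s * inLam p).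
Proof.
move=> Es Er Ez nw; rewrite -(res_d_cf _ Es Ez nw) lift.2.
by rewrite (@res_d_gen (k + n) r r' p Er) linearZ /= res_coefZ.
Qed.
End Lift.

Lemma small_good D A w : stacked I D A -> (plen w < D)%N -> ~~ badp w.
Proof.
move=> st lw; apply/asboolP => -[l1 [l [l2 [Tl e]]]].
have := RL_len (n := 2) st Tl; rewrite (delta_even D A 1) mul1n => sl.
by move: lw; rewrite /plen e !size_cat sl ltnNge addnCA leq_addr.
Qed.

(* Commutation with the differentials trades the coefficient of u at s for one a
   step lower, down to degree 0, where it is read off dual_basis. The length
   hypotheses keep every path met on the way out of I. *)
Lemma lift_cf D A n (k0 : Rtype n) (phi : forall k, {linear res (k + n) -> res k}) m :
  stacked I D A -> chain_lift (@dual_basis K Q I R2 n k0) phi ->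
  (forall j, (j < m)%N -> delta D A n + delta D A j <= delta D A (j + n))%N ->
  (forall j, (j < m)%N -> delta D A (j.+1 + n) = delta D A n + delta D A j.+1 \/
     delta D A (j.+1 + n) < delta D A n + delta D A j + D)%N ->
  forall (s : Rtype m) (r : Rtype (m + n)) u,
  pend (val s) = pstart u ->
  (plen (val r) = plen (val k0) + plen (val s) + plen u)%N ->
  cf u (phi m (gen r) $ s) =
    [&& pend (val k0) == pstart (val s), pstart (val k0) == pstart (val r) &
      parrows (val r) == parrows (val k0) ++ parrows (val s) ++ parrows u]%:R.
Proof.
move=> st lift; elim: m => [|m IH] H1 H2 s r u es el.
  have lr := R_len r st; have lk := R_len k0 st.
  have ls : plen (val s) = 0%N := Rset_val s.
  have lu : plen u = 0%N.
    by move/eqP: el; rewrite lr lk ls addn0 -[X in X == _]addn0 eqn_add2l eq_sym => /eqP.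
  rewrite (plen0 lu) -es (lift_cf0 lift s r); congr (nat_of_bool _)%:R.
  rewrite (size0nil ls) (_ : parrows (pvertex _) = [::]) // !cats0.
  have es' : pstart (val s) = pend (val s) by rewrite /pend (size0nil ls).
  rewrite es'; apply/idP/idP => [/andP[/eqP -> /eqP ->]|/and3P[/eqP e1 /eqP e2 /eqP e3]].
    by rewrite !eqxx.
  have e : k0 = r by apply: val_inj; apply: qpathP.
  by rewrite e eqxx -e1 e eqxx.
have [s0 [q [Es nq lq]]] := Rprefix s.
have [r0 [p [Er np lp]]] := @Rprefix (m + n) r.
have [w Ew ew] := pcomp_Some (etrans (esym (pend_comp Es)) es).
have sEs := pcomp_plen Es; have sEr : plen (val r) = (plen (val r0) + plen p)%N := pcomp_plen Er.
have sEw := pcomp_plen Ew.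
have ls := R_len s st; have lr := R_len r st; have lk := R_len k0 st.
have ls0 := R_len s0 st; have lr0 := R_len r0 st.
(* By lengths, either [u] is a vertex and [w] is the step [q], free of relations, or [w] has fewer
   than D arrows. *)
have nw : ~~ badp w.
  case: (H2 m (leqnn _)) => h; last by apply: (small_good st); lia.
  have lu : plen u = 0%N by lia.
  suff -> : w = q by [].
  by apply: qpathP; rewrite ?(pcomp_start Ew) // ew (size0nil lu) cats0.
rewrite (lift_cfS lift Es Er Ew nw).
have a1 := pcomp_parrows Es; have a2 : parrows (val r) = parrows (val r0) ++ parrows p := pcomp_parrows Er.
have b1 := pcomp_start Es; have b2 : pstart (val r) = pstart (val r0) := pcomp_start Er.
(* If [p] is not a final piece of [w], both sides vanish: by the first length condition [val k0] and
   [val s0] together are no longer than [val r0], so equality of the words would make [p] a final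
   piece of [w]. *)
have [[u' E']|no] := pselect (exists u', pcomp u' p = Some w); last first.
  rewrite cf_Mr0 => [|u' E']; last by apply: no; exists u'.
  case: and3P => // -[_ _ /eqP e]; case: no.
  move: e; rewrite a1 a2 -catA -[parrows q ++ _]ew catA => e.
  have h := H1 m (leqnn _).
  have [||d [_ ed]] := @cat_le_split _ (parrows (val k0) ++ parrows (val s0)) (parrows (val r0)) (parrows w) (parrows p).
  - by rewrite e.
  - by rewrite size_cat; move: h; rewrite -lk -ls0 -lr0.
  have [v1 [v2 [G1 G2 G3]]] := pcomp_cut ed; exists v1.
  suff -> : p = v2 by [].
  by apply: qpath_eq.
rewrite (cf_Mr _ E' nw) IH; first last.
- by have := pcomp_plen E'; lia.
- by rewrite -(pcomp_start E') (pcomp_start Ew) (pcomp_end Es).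
- by move=> j jm; apply: H2; exact: ltnW.
- by move=> j jm; apply: H1; exact: ltnW.
congr (nat_of_bool _)%:R; rewrite b1 b2; congr [&& _, _ & _].
rewrite a1 a2 -[in RHS]catA -[parrows q ++ _]ew (pcomp_parrows E') !catA.
apply/eqP/eqP => [->|e] //.
by have [|->] := cat_size_inj _ e; first by have := congr1 size e; rewrite size_cat [in RHS]size_cat => /addIn.
Qed.

Lemma dual_basis_coef n (k : Rtype n) (x1 : res n) a :
  (forall v, cf (pvertex v) (x1 $ k) = cf (pvertex v) a) -> dual_basis k x1 = qpi (lam_rad I) a.
Proof. by move=> h; rewrite /dual_basis; apply/lam0_eq. Qed.

Definition delta_steps D A m n :=
  (forall j, (j < m)%N -> delta D A n + delta D A j <= delta D A (j + n))%N /\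
  (forall j, (j < m)%N -> delta D A (j.+1 + n) = delta D A n + delta D A j.+1 \/
     delta D A (j.+1 + n) < delta D A n + delta D A j + D)%N.

(** This is [lift_cf] with [u] a vertex, allowed because the lengths add up; every other vertex
    coefficient is zero for reasons of endpoints. The value is therefore independent of the lift. *)
Lemma ext_mul_gen D A m n (g : Rtype m) (f : Rtype n) h (r : Rtype (m + n)) :
  stacked I D A -> delta_steps D A m n -> delta D A (m + n) = (delta D A n + delta D A m)%N ->
  ext_mul (m := m) (n := n) (@dual_basis K Q I R2 m g) (@dual_basis K Q I R2 n f) h ->
  h (gen r) = if pcomp (val f) (val g) == Some (val r)
    then qpi (lam_rad I) (inLam (pvertex (pend (val g)))) else 0.
Proof.
move=> st [H1 H2] e [phi lift ->].
have el : (plen (val r) = plen (val f) + plen (val g) + plen (pvertex (pend (val g))))%N.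
  by rewrite !(R_len _ st) e addn0.
have := lift_cf st lift H1 H2 (u := pvertex (pend (val g))) (erefl _) el.
rewrite [parrows (pvertex _)](_ : _ = [::]) // cats0.
have -> : [&& pend (val f) == pstart (val g), pstart (val f) == pstart (val r)
    & parrows (val r) == parrows (val f) ++ parrows (val g)] = (pcomp (val f) (val g) == Some (val r)).
  apply/and3P/eqP => [[/eqP e1 /eqP e2 /eqP e3]|/pcompP [-> -> ->]]; last by rewrite !eqxx.
  by apply/pcompP.
have other v : v != pend (val g) -> cf (pvertex v) (phi m (gen r) $ g) = 0.
  move=> nv; apply/eqP; apply: contraT => /res_coef_start e0.
  by rewrite e0 eqxx in nv.
case: eqP => _ ec.
  apply: dual_basis_coef => v; rewrite cf_inLam badp_vertex; last exact: R2_len.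
  have [->|nv] := eqVneq v (pend (val g)); first by rewrite ec eqxx.
  by rewrite other //; case: eqP => // e0; case/eqP: nv; rewrite -[v]/(pstart (pvertex v)) -e0.
rewrite -(qpi0 (lam_rad I)); apply: dual_basis_coef => v; rewrite raddf0.
by have [->|/other] := eqVneq v (pend (val g)).
Qed.

Lemma ext_mul_linear m n (g : Rtype m) (f : Rtype n) h :
  ext_mul (m := m) (n := n) (@dual_basis K Q I R2 m g) (@dual_basis K Q I R2 n f) h ->
  exists h' : {linear res (m + n) -> lam0}, forall x1 : res (m + n), h x1 = h' x1.
Proof.
move=> [phi _ e]; exists (@dual_basis K Q I R2 m g \o phi m) => x1; exact: e.
Qed.

Lemma lam0_vertex_neq0 v : qpi (lam_rad I) (inLam (pvertex v)) <> 0.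
Proof.
move=> /lam0_eq0 /(_ v); rewrite cf_inLam badp_vertex; last exact: R2_len.
by move/eqP; rewrite eqxx oner_eq0.
Qed.

Section ExtProducts.
Variables (D A m n : nat).
Hypotheses (st : stacked I D A) (steps : Rtype (m.+1 + n) -> delta_steps D A m.+1 n)
  (deltaD : delta D A (m.+1 + n) = (delta D A n + delta D A m.+1)%N).

(** The common shape of the three vanishing conditions in [H_Delta]. The degree is a successor
    because [ext_eq] refers to the preceding term of the resolution. *)
Definition mul_zero (g : Rtype m.+1) (f : Rtype n) := exists2 h,
  ext_mul (m := m.+1) (n := n) (@dual_basis K Q I R2 m.+1 g) (@dual_basis K Q I R2 n f) h &
  ext_eq (n := m + n) h (fun=> 0).

(** As coboundaries vanish, the product is zero exactly when it kills all generators. The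
    inequalities [steps] are supplied only when R^(m+1+n) is inhabited, since [A < D] is known only
    then; in the other case there is no generator to test. *)
Lemma mul_zeroE (g : Rtype m.+1) (f : Rtype n) :
  mul_zero g f <-> ~ exists2 p, pcomp (val f) (val g) = Some p & Rset R2 (m.+1 + n) p.
Proof.
split=> [[h hm [u hu]] [p E Rp]|no].
  have := hu (gen (mkR Rp)); rewrite res_lam0_d subr0.
  by rewrite (ext_mul_gen (mkR Rp) st (steps (mkR Rp)) deltaD hm) E eqxx; exact: lam0_vertex_neq0.
have [h hm] := ext_mul_ex g f; exists h => //; exists \0 => x1.
have [h' eh] := ext_mul_linear hm.
rewrite subr0 eh; apply: (@res_linear_ext _ _ h' \0) => r.
rewrite -eh (ext_mul_gen r st (steps r) deltaD hm).
by case: eqP => // E; case: no; exists (val r) => //; exact: Rset_val.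
Qed.
End ExtProducts.

Section StackedExt.
Variables D A : nat.
Hypotheses (st : stacked I D A) (D_gt2 : (2 < D)%N) (A_gt1 : (1 < A)%N) (D_neq2A : D <> (2 * A)%N).

Let RL_size n s (H : RL (relword R2) n s) : size s = delta D A n := RL_len st H.

Lemma Rset_A_lt_D n (r : Rtype n) : (2 < n)%N -> (A < D)%N.
Proof.
move=> n3; have H := RL_le D_gt2 A_gt1 D_neq2A R2_antichain RL_size (RL_val r) n3.
exact: (RL3_AD D_gt2 A_gt1 D_neq2A RL_size H).
Qed.

Lemma delta_values : [/\ delta D A 2 = D, delta D A 3 = D + A, delta D A 4 = 2 * D &
  delta D A 5 = 2 * D + A]%N.
Proof.
split; first by rewrite (delta_even D A 1) mul1n.
- by rewrite (delta_odd D A 0) mul1n.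
- exact: (delta_even D A 2).
- exact: (delta_odd D A 1).
Qed.

Lemma delta_steps22 : (A < D)%N -> delta_steps D A 2 2.
Proof.
case: delta_values => e2 e3 e4 e5 AD; split=> -[|[|j]] // _.
- by change (delta D A 2 + 0 <= delta D A 2)%N; rewrite addn0.
- by change (delta D A 2 + 1 <= delta D A 3)%N; rewrite e2 e3; lia.
- by right; change (delta D A 3 < delta D A 2 + 0 + D)%N; rewrite e2 e3; lia.
- by left; change (delta D A 4 = delta D A 2 + delta D A 2)%N; rewrite e2 e4; lia.
Qed.

Lemma delta_steps23 : (A < D)%N -> delta_steps D A 2 3.
Proof.
case: delta_values => e2 e3 e4 e5 AD; split=> -[|[|j]] // _.
- by change (delta D A 3 + 0 <= delta D A 3)%N; rewrite addn0.
- by change (delta D A 3 + 1 <= delta D A 4)%N; rewrite e3 e4; lia.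
- by right; change (delta D A 4 < delta D A 3 + 0 + D)%N; rewrite e3 e4; lia.
- by left; change (delta D A 5 = delta D A 3 + delta D A 2)%N; rewrite e2 e3 e5; lia.
Qed.

Lemma delta_steps32 : (A < D)%N -> delta_steps D A 3 2.
Proof.
case: delta_values => e2 e3 e4 e5 AD; split=> -[|[|[|j]]] // _.
- by change (delta D A 2 + 0 <= delta D A 2)%N; rewrite addn0.
- by change (delta D A 2 + 1 <= delta D A 3)%N; rewrite e2 e3; lia.
- by change (delta D A 2 + delta D A 2 <= delta D A 4)%N; rewrite e2 e4; lia.
- by right; change (delta D A 3 < delta D A 2 + 0 + D)%N; rewrite e2 e3; lia.
- by left; change (delta D A 4 = delta D A 2 + delta D A 2)%N; rewrite e2 e4; lia.
- by left; change (delta D A 5 = delta D A 2 + delta D A 3)%N; rewrite e2 e3 e5; lia.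
Qed.

Lemma mul_b_b_zeroE (b b' : Rtype 2) : mul_b_b_zero I b b' <->
  ~ exists2 p, pcomp (val b') (val b) = Some p & Rset R2 4 p.
Proof.
case: delta_values => e2 e3 e4 e5; apply: (@mul_zeroE D A 1 2) => //.
  by move=> r; apply: delta_steps22; exact: (Rset_A_lt_D r).
by rewrite e2; change (delta D A 4 = (D + D)%N); rewrite e4; lia.
Qed.

Lemma mul_b_c_zeroE (b : Rtype 2) (c : Rtype 3) : mul_b_c_zero I b c <->
  ~ exists2 p, pcomp (val c) (val b) = Some p & Rset R2 5 p.
Proof.
case: delta_values => e2 e3 e4 e5; apply: (@mul_zeroE D A 1 3) => //.
  by move=> r; apply: delta_steps23; exact: (Rset_A_lt_D r).
by rewrite e2 e3; change (delta D A 5 = (D + A + D)%N); rewrite e5; lia.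
Qed.

Lemma mul_c_b_zeroE (c : Rtype 3) (b : Rtype 2) : mul_c_b_zero I c b <->
  ~ exists2 p, pcomp (val b) (val c) = Some p & Rset R2 5 p.
Proof.
case: delta_values => e2 e3 e4 e5; apply: (@mul_zeroE D A 2 2) => //.
  by move=> r; apply: delta_steps32; exact: (Rset_A_lt_D r).
by rewrite e2 e3; change (delta D A 5 = (D + (D + A))%N); rewrite e5; lia.
Qed.

(** On the generator at [p] the first product is nonzero, so equality forces the second
    factorization of [p]. Conversely, equal underlying paths give equal values on every
    generator. *)
Lemma mul_b_c_eqE (b : Rtype 2) (c c' : Rtype 3) (b' : Rtype 2) p :
  pcomp (val c) (val b) = Some p -> Rset R2 5 p ->
  (mul_b_c_eq I b c c' b' <-> pcomp (val b') (val c') = Some p).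
Proof.
move=> E Rp; case: delta_values => e2 e3 e4 e5.
have AD := Rset_A_lt_D (mkR Rp) isT.
have s1 := delta_steps23 AD; have s2 := delta_steps32 AD.
have d1 : delta D A (2 + 3) = (delta D A 3 + delta D A 2)%N.
  by rewrite e2 e3; change (delta D A 5 = (D + A + D)%N); rewrite e5; lia.
have d2 : delta D A (3 + 2) = (delta D A 2 + delta D A 3)%N.
  by rewrite e2 e3; change (delta D A 5 = (D + (D + A))%N); rewrite e5; lia.
split=> [[h [h' [hm hm' [u hu]]]]|E'].
  have := hu (gen (mkR Rp)); rewrite res_lam0_d => /eqP; rewrite subr_eq0 => /eqP.
  rewrite (@ext_mul_gen D A 2 3 b c h (mkR Rp) st s1 d1 hm).
  rewrite (@ext_mul_gen D A 3 2 c' b' h' (mkR Rp) st s2 d2 hm').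
  by rewrite E eqxx; case: eqP => // _ /lam0_vertex_neq0.
have [h hm] := ext_mul_ex b c; have [h' hm'] := ext_mul_ex c' b'.
exists h, h'; split=> //; exists \0 => x1.
have [g eg] := ext_mul_linear hm; have [g' eg'] := ext_mul_linear hm'.
rewrite (eg x1) (eg' x1); apply/eqP; rewrite subr_eq0; apply/eqP.
apply: (@res_linear_ext 5 _ g g') => r.
rewrite -(eg (gen r)) -(eg' (gen r)).
rewrite (@ext_mul_gen D A 2 3 b c h r st s1 d1 hm).
rewrite (@ext_mul_gen D A 3 2 c' b' h' r st s2 d2 hm').
by rewrite E E' -(pend_comp E) -(pend_comp E').
Qed.
End StackedExt.
End Monomial.

(** * The Groebner basis *)

Section PathOrder.
Variables (Q : quiver) (gt : rel (vertex Q + arrow Q)).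
Hypotheses (gt_irr : irreflexive gt) (gt_trans : transitive gt)
  (gt_total : forall x y, x != y -> gt x y || gt y x).
Implicit Types p q r : qpath Q.

Lemma cat_cons_split (X : Type) (s s' t t' : seq X) x x' :
  s ++ x :: t = s' ++ x' :: t' ->
  [\/ [/\ s = s', x = x' & t = t'], exists d, s' = s ++ x :: d | exists d, s = s' ++ x' :: d].
Proof.
elim: s s' => [|a s IH] [|a' s'] //=.
- by case=> -> ->; constructor 1.
- by case=> -> _; constructor 2; exists s'.
- by case=> -> _; constructor 3; exists s.
case=> -> /IH [[-> -> ->]|[d ->]|[d ->]]; first by constructor 1.
- by constructor 2; exists d.
- by constructor 3; exists d.
Qed.

Lemma path_gt_trans p q r : path_gt gt p q -> path_gt gt q r -> path_gt gt p r.
Proof.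
move=> [l1|[e1 [s [x [y [t [u [ep eq g1]]]]]]]] [l2|[e2 [s' [x' [y' [t' [u' [eq' er g2]]]]]]]].
- by left; exact: ltn_trans l2 l1.
- by left; rewrite -e2.
- by left; rewrite e1.
right; split; first by rewrite e1.
case: (cat_cons_split (etrans (esym eq) eq')) => [[es exy _]|[d es]|[d es]].
- by exists s, x, y', t, u'; split=> //; [rewrite es|apply: gt_trans g1 _; rewrite exy].
- by exists s, x, y, t, (d ++ y' :: u'); split=> //; rewrite er es -catA.
- by exists s', x', y', (d ++ x :: t), u'; split=> //; rewrite ep es -catA.
Qed.

Lemma path_gt_irr p : ~ path_gt gt p p.
Proof.
case=> [|[_ [s [x [y [t [u [-> e g]]]]]]]]; first by rewrite ltnn.
case: (cat_cons_split e) => [[_ exy _]|[d /(congr1 size)]|[d /(congr1 size)]].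
- by rewrite exy gt_irr in g.
- by rewrite size_cat /=; lia.
- by rewrite size_cat /=; lia.
Qed.

Lemma first_difference (X : eqType) (s t : seq X) : size s = size t -> s != t ->
  exists l x y s' t', [/\ s = l ++ x :: s', t = l ++ y :: t' & x != y].
Proof.
elim: s t => [|a s IH] [|b t] //= [e]; have [->|n] := eqVneq a b.
  rewrite eqseq_cons eqxx /= => /(IH _ e) [l [x [y [s' [t' [-> -> h]]]]]].
  by exists (b :: l), x, y, s', t'.
by exists [::], a, b, s, t.
Qed.

Lemma path_gt_total p q : p <> q -> path_gt gt p q \/ path_gt gt q p.
Proof.
move=> npq; case: (ltngtP (plen p) (plen q)) => [l|l|e]; [by right; left|by left; left|].
have nl : letters p != letters q.
  apply/eqP => el; apply: npq; move: e el; rewrite /letters /plen.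
  case ep: (parrows p) => [|a s]; case eq: (parrows q) => [|b t] //= e.
    by case=> h; apply: qpathP => //; rewrite ep eq.
  case=> eab /(inj_map (@inr_inj _ _)) est; apply: qpath_eq; first by rewrite ep eq est eab.
  by rewrite /plen ep.
have sl : size (letters p) = size (letters q).
  move: e; rewrite /letters /plen.
  by case: (parrows p) => [|a s]; case: (parrows q) => [|b t] //= [e]; rewrite !size_map e.
have [s [x [y [t [u [ep eq nxy]]]]]] := first_difference sl nl.
case/orP: (gt_total nxy) => g; [left|right]; right; split=> //.
  by exists s, x, y, t, u.
by exists s, y, x, u, t.
Qed.

Lemma seq_path_max (s : seq (qpath Q)) : s != [::] ->
  exists2 p, p \in s & forall q, q \in s -> q <> p -> path_gt gt p q.
Proof.
elim: s => [|a s IH] // _; have [->|/IH [p ps pm]] := eqVneq s [::].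
  by exists a; rewrite ?mem_head // => q; rewrite inE => /eqP ->.
have [->|n] := eqVneq a p.
  exists p; first exact: mem_head.
  by move=> q; rewrite inE => /orP[/eqP -> //|/pm].
have /eqP na := n; case: (path_gt_total na) => g.
  exists a; first exact: mem_head.
  move=> q; rewrite inE => /orP[/eqP -> //|qs _].
  have [->|/eqP nq] := eqVneq q p; first exact: g.
  exact: path_gt_trans g (pm q qs nq).
exists p; first by rewrite inE ps orbT.
by move=> q; rewrite inE => /orP[/eqP -> //|/pm].
Qed.

Variable K : fieldType.

Lemma tip_exists (x : pathalg K Q) : x <> 0 -> exists p, is_tip gt x p.
Proof.
move=> nx; have ns : (msupp x : seq (qpath Q)) != [::].
  apply/eqP => e; apply: nx; apply: pathalgP => p; rewrite mcoeff0.
  by apply: mcoeff_outdom; rewrite -[_ \in _]/(p \in (msupp x : seq _)) e.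
by have [p ps pm] := seq_path_max ns; exists p.
Qed.

Lemma tip_unique (x : pathalg K Q) p q : is_tip gt x p -> is_tip gt x q -> p = q.
Proof.
move=> [ps pm] [qs qm]; apply: contrapT => n.
exact: path_gt_irr (path_gt_trans (pm q qs (nesym n)) (qm p ps n)).
Qed.

Lemma tip_pelt p : is_tip gt (pelt K p) p.
Proof. by split; rewrite msupp_pelt ?in_fset1 // => q; rewrite in_fset1 => /eqP. Qed.

Lemma mcoeff_peltB p q r : (pelt K p - pelt K q)@_r = (p == r)%:R - (q == r)%:R.
Proof.
rewrite mcoeffB (pelt_optE K p) (pelt_optE K q) !mcoeff_pelt_opt; congr (_ - _);
  by congr (nat_of_bool _)%:R; apply/eqP/eqP => [[]|->].
Qed.

Lemma msupp_peltB p q r : r \in msupp (pelt K p - pelt K q) -> r = p \/ r = q.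
Proof.
rewrite -mcoeff_neq0 mcoeff_peltB; case: (p =P r) => [->|_]; first by left.
by case: (q =P r) => [->|_]; [right|rewrite subrr eqxx].
Qed.

Lemma tip_peltB p q : path_gt gt p q -> is_tip gt (pelt K p - pelt K q) p.
Proof.
move=> g; have npq : q != p by apply/eqP => e; move: g; rewrite e; exact: path_gt_irr.
split; first by rewrite -mcoeff_neq0 mcoeff_peltB eqxx (negPf npq) subr0 oner_eq0.
by move=> r /msupp_peltB [->|->].
Qed.

End PathOrder.

Section Delta.
Variables (K : fieldType) (Q : quiver) (I : tsideal (pathalg K Q)) (R2 : set (qpath Q)) (D A : nat).
Hypotheses (adm : admissible I) (mgp : minimal_generating_paths I R2) (st : stacked I D A)
  (D_gt2 : (2 < D)%N) (A_gt1 : (1 < A)%N) (D_neq2A : D <> (2 * A)%N).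
Local Notation T := (relword R2).
Local Notation Rtype n := (set_type (Rset R2 n)).
Local Notation Dl := (Delta R2).
Local Notation deg := (@darrow_deg Q R2).
Local Notation wd := (fun x : delta_arrow R2 => parrows (darrow_path x)).
Local Notation good := (word_in_R T deg wd).
Implicit Types (u v w : qpath Dl) (x y : delta_arrow R2).

Let R2_len : forall r, R2 r -> (1 < plen r)%N := R2_len adm mgp.
Let T_anti : forall l1 l l2, T l -> T (l1 ++ l ++ l2) -> l1 = [::] /\ l2 = [::] :=
  R2_antichain adm mgp.
Let RL_size n s (H : RL T n s) : size s = delta D A n := RL_len adm mgp st H.

Lemma delta_arrow_deg x : (1 <= deg x <= 3)%N.
Proof. by case: x => [[]|]. Qed.

Lemma delta_arrow_word x : RL T (deg x) (wd x).
Proof. by case: x => [[k|k]|k]; exact: (RL_val adm mgp). Qed.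

Let good_shape := good_shape D_gt2 A_gt1 D_neq2A T_anti RL_size delta_arrow_deg delta_arrow_word.
Let good_factor := good_factor D_gt2 A_gt1 D_neq2A T_anti RL_size delta_arrow_deg delta_arrow_word.

Lemma delta_arrow_inj x y : deg x = deg y -> wd x = wd y -> x = y.
Proof.
have inj n (k k' : Rtype n) : (0 < n)%N -> parrows (val k) = parrows (val k') -> k = k'.
  move=> n0 e; apply: val_inj; apply: qpath_eq => //.
  have := RL_val adm mgp k; case: n k k' n0 e => [|n] // k k' _ _.
  by case/(RL_prefix (relword_size R2_len) T_anti) => r [q [e _ _ sq]]; rewrite /plen e size_cat; lia.
case: x y => [[k|k]|k] [[k'|k']|k'] // _ e.
- by rewrite (inj 1%N k k' isT e).
- by rewrite (inj 2 k k' isT e).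
- by rewrite (inj 3 k k' isT e).
Qed.

Lemma dpath_pathP w : exists P, [/\ dpath_path w = Some P, parrows P = wword wd (parrows w),
  pstart P = pend w & pend P = pstart w].
Proof.
rewrite /dpath_path {1 2}/pend; have := pchain w.
move: (pstart w) (parrows w) => v l.
elim: l v => [|x l IH] v /=; first by exists (pvertex (v : vertex Q)).
move=> /andP[/eqP <- /IH [P [-> eP sP tP]]] /=.
have [P' E e'] := pcomp_Some (tP : pend P = pstart (darrow_path x)).
exists P'; split=> //.
- by rewrite e' eP wword_cons.
- by rewrite (pcomp_start E).
- by rewrite (pend_comp E).
Qed.

Lemma dpath_pathE w w' : dpath_path w = dpath_path w' <->
  [/\ wword wd (parrows w) = wword wd (parrows w'), pstart w = pstart w' & pend w = pend w'].
Proof.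
have [P [-> eP sP tP]] := dpath_pathP w; have [P' [-> eP' sP' tP']] := dpath_pathP w'.
rewrite -eP -eP' -sP -sP' -tP -tP'; split=> [[->] //|[e _ s]].
by congr Some; exact: qpathP.
Qed.

Lemma dpath_degE w : dpath_deg w = wdeg deg (parrows w).
Proof. by []. Qed.

Lemma goodE w : good (parrows w) <-> exists2 p, dpath_path w = Some p & Rset R2 (dpath_deg w) p.
Proof.
have [P [-> eP _ _]] := dpath_pathP w; rewrite /word_in_R -dpath_degE -eP.
split=> [/(RsetE R2_len) h|[p [<-] /(RsetE R2_len)] //]; by exists P.
Qed.

Lemma good_lab w w' : dpath_path w = dpath_path w' -> dpath_deg w = dpath_deg w' ->
  good (parrows w) -> good (parrows w').
Proof. by move=> e1 e2 /goodE h; apply/goodE; rewrite -e1 -e2. Qed.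

Lemma delta_word_inj w w' : dpath_path w = dpath_path w' ->
  map deg (parrows w) = map deg (parrows w') -> w = w'.
Proof.
case/dpath_pathE => ew es _ ed; apply: qpathP => //.
have := wword_inj D_gt2 A_gt1 D_neq2A RL_size delta_arrow_word ew ed.
move: (parrows w) (parrows w') ed => s t {ew es}.
elim: s t => [|x s IH] [|y t] //= [d1 d2] [e1 e2].
by rewrite (delta_arrow_inj d1 e1) (IH t).
Qed.

(** * Functionals vanishing on I_Delta *)

Definition lab (P : qpath Q) n w := (dpath_path w == Some P) && (dpath_deg w == n).

(** Scalars are viewed in the module [K^o] so that linearity is an instance of [msum_lin]. *)
Definition labsum P n (z : pathalg K Dl) : K^o := \sum_(w <- msupp z) z@_w *: ((lab P n w)%:R : K^o).

Lemma labsum_lin P n a (z1 z2 : pathalg K Dl) :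
  labsum P n (a *: z1 + z2) = a *: labsum P n z1 + labsum P n z2.
Proof. exact: (@msum_lin K Dl K^o). Qed.

Lemma labsum0 P n : labsum P n 0 = 0.
Proof. by rewrite /labsum msupp0 big_seq_fset0. Qed.

Lemma labsum_pelt P n w : labsum P n (pelt K w) = (lab P n w)%:R.
Proof. by rewrite /labsum msupp_pelt big_seq_fset1 mcoeff_pelt scale1r. Qed.

Definition olab P n (o : option (qpath Dl)) := if o is Some w then lab P n w else false.

Lemma labsum_pelt_opt P n o : labsum P n (pelt_opt K o) = (olab P n o)%:R.
Proof. by case: o => [w|]; [exact: labsum_pelt|exact: labsum0]. Qed.

Lemma labsum_map P n (F : pathalg K Dl -> pathalg K Dl) (f : qpath Dl -> option (qpath Dl)) :
  (forall a z1 z2, F (a *: z1 + z2) = a *: F z1 + F z2) -> F 0 = 0 ->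
  (forall w, F (pelt K w) = pelt_opt K (f w)) ->
  forall z, labsum P n (F z) = \sum_(w <- msupp z) z@_w *: ((olab P n (f w))%:R : K^o).
Proof.
move=> FL F0 Fp z; elim/pathalg_ind: z => [|a p z IH].
  by rewrite F0 labsum0 msupp0 big_seq_fset0.
rewrite FL labsum_lin IH Fp labsum_pelt_opt.
rewrite (@msum_lin K Dl K^o (fun w => (olab P n (f w))%:R)); congr (_ + _).
by rewrite msupp_pelt big_seq_fset1 mcoeff_pelt scale1r.
Qed.

Definition in_kernel (z : pathalg K Dl) := forall P n, Rset R2 n P -> labsum P n z = 0.

(* With f the composition with a fixed path: as factors of elements of the R^n
   are again of this kind, the preimage under f of the fibre of a label is empty
   or a whole fibre. *)
Lemma in_kernel_map (F : pathalg K Dl -> pathalg K Dl) (f : qpath Dl -> option (qpath Dl)) :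
  (forall a z1 z2, F (a *: z1 + z2) = a *: F z1 + F z2) -> F 0 = 0 ->
  (forall w, F (pelt K w) = pelt_opt K (f w)) ->
  (forall w v, f w = Some v -> good (parrows v) -> good (parrows w)) ->
  (forall w w' v, f w = Some v -> (exists v', [/\ f w' = Some v',
     dpath_path v = dpath_path v' & dpath_deg v = dpath_deg v']) <->
     dpath_path w = dpath_path w' /\ dpath_deg w = dpath_deg w') ->
  forall z, in_kernel z -> in_kernel (F z).
Proof.
move=> FL F0 Fp fg fl z Jz P n RP; rewrite (labsum_map _ _ FL F0 Fp).
have [[w0]|no] := pselect (exists w, olab P n (f w)); last first.
  apply: big1 => w _; case E: (olab P n (f w)); last by rewrite scaler0.
  by case: no; exists w.
case E0: (f w0) => [v0|] //= /andP[/eqP ep /eqP en].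
have gv : good (parrows v0) by apply/goodE; exists P; rewrite ?en.
have /goodE [P' ep' RP'] := fg _ _ E0 gv.
rewrite -[RHS](Jz P' (dpath_deg w0) RP'); apply: eq_bigr => w _.
congr (_ *: (nat_of_bool _)%:R); apply/idP/idP.
  case E: (f w) => [v|] //= /andP[/eqP e1 /eqP e2].
  have [e3 e4] := (fl w0 w v0 E0).1 (ex_intro _ v (And3 E (etrans ep (esym e1)) (etrans en (esym e2)))).
  by rewrite /lab -e3 -e4 ep' !eqxx.
case/andP => /eqP e1 /eqP e2.
have [v [-> e3 e4]] := (fl w0 w v0 E0).2 (conj (etrans ep' (esym e1)) (esym e2)).
by rewrite /= /lab -e3 -e4 ep en !eqxx.
Qed.

Lemma dpath_deg_comp u w v : pcomp u w = Some v -> dpath_deg v = (dpath_deg u + dpath_deg w)%N.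
Proof. by move=> E; rewrite !dpath_degE (pcomp_parrows E) wdeg_cat. Qed.

Lemma in_kernel_mull u (z : pathalg K Dl) : in_kernel z -> in_kernel (pelt K u * z).
Proof.
apply: (@in_kernel_map (fun z => pelt K u * z) (fun w => pcomp u w)).
- by move=> a z1 z2; exact: pamul_linr.
- exact: mulr0.
- by move=> w; exact: pamulU.
- by move=> w v E; rewrite (pcomp_parrows E) => /good_factor [].
move=> w w' v E; have dE := dpath_deg_comp E; have aE := pcomp_parrows E; split.
  move=> [v' [E' /dpath_pathE [e1 e2 e3] e4]]; have dE' := dpath_deg_comp E'.
  have aE' := pcomp_parrows E'; split; last by move: e4; rewrite dE dE' => /addnI.
  apply/dpath_pathE; split.
  - move: e1; rewrite aE aE' !wword_cat => e1.
    have ss := congr1 size e1; rewrite !size_cat in ss; move/addIn: ss => ss.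
    by have [] := cat_size_inj ss e1.
  - by rewrite -(pcomp_end E) (pcomp_end E').
  - by rewrite -(pend_comp E) e3 (pend_comp E').
move=> [/dpath_pathE [e1 e2 e3] e4].
have [v' E' aE'] := pcomp_Some (etrans (pcomp_end E) e2).
exists v'; split=> //; last by rewrite dE (dpath_deg_comp E') e4.
apply/dpath_pathE; rewrite aE aE' !wword_cat e1 (pend_comp E) (pend_comp E') e3.
by rewrite (pcomp_start E) (pcomp_start E').
Qed.

Lemma in_kernel_mulr u (z : pathalg K Dl) : in_kernel z -> in_kernel (z * pelt K u).
Proof.
apply: (@in_kernel_map (fun z => z * pelt K u) (fun w => pcomp w u)).
- by move=> a z1 z2; exact: pamul_linl.
- exact: mul0r.
- by move=> w; exact: pamulU.
- by move=> w v E; rewrite (pcomp_parrows E) => /good_factor [].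
move=> w w' v E; have dE := dpath_deg_comp E; have aE := pcomp_parrows E; split.
  move=> [v' [E' /dpath_pathE [e1 e2 e3] e4]]; have dE' := dpath_deg_comp E'.
  have aE' := pcomp_parrows E'; split; last by move: e4; rewrite dE dE' => /addIn.
  apply/dpath_pathE; split.
  - move: e1; rewrite aE aE' !wword_cat => e1.
    have ss := congr1 size e1; rewrite !size_cat in ss; move/addnI: ss => ss.
    by have [] := cat_size_inj (erefl _) e1.
  - by rewrite -(pcomp_start E) e2 (pcomp_start E').
  - by rewrite (pcomp_end E) (pcomp_end E').
move=> [/dpath_pathE [e1 e2 e3] e4].
have [v' E' aE'] := pcomp_Some (etrans (esym e3) (pcomp_end E)).
exists v'; split=> //; last by rewrite dE (dpath_deg_comp E') e4.
apply/dpath_pathE; rewrite aE aE' !wword_cat e1 (pend_comp E) (pend_comp E').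
by rewrite (pcomp_start E) (pcomp_start E') e2.
Qed.

Lemma in_kernel0 : in_kernel 0.
Proof. by move=> P n _; exact: labsum0. Qed.

Lemma in_kernel_lin a z1 z2 : in_kernel z1 -> in_kernel z2 -> in_kernel (a *: z1 + z2).
Proof. by move=> h1 h2 P n RP; rewrite labsum_lin h1 // h2 // scaler0 addr0. Qed.

Lemma I_Delta_in_kernel z : z \in I_Delta R2 K -> in_kernel z.
Proof.
apply: (@ideal_gen_ind _ _ in_kernel).
- exact: in_kernel0.
- move=> z1 z2 h1 h2; have -> : z1 - z2 = (-1) *: z2 + z1 by rewrite scaleN1r addrC.
  exact: in_kernel_lin.
- move=> a z1 h1; elim/pathalg_ind: a => [|c p a IH]; first by rewrite mul0r; exact: in_kernel0.
  have -> : (c *: pelt K p + a) * z1 = c *: (pelt K p * z1) + a * z1 by exact: pamul_linl.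
  by apply: in_kernel_lin IH; exact: in_kernel_mull.
- move=> a z1 h1; elim/pathalg_ind: a => [|c p a IH]; first by rewrite mulr0; exact: in_kernel0.
  have -> : z1 * (c *: pelt K p + a) = c *: (z1 * pelt K p) + z1 * a by exact: pamul_linr.
  by apply: in_kernel_lin IH; exact: in_kernel_mulr.
move=> _ [w _ nw|w w' _ _ e1 e2] P n RP.
  rewrite labsum_pelt /lab; case: eqP => //= e1; case: eqP => // e2.
  by case: nw; exists P; rewrite ?e2.
have -> : pelt K w - pelt K w' = (-1) *: pelt K w' + pelt K w by rewrite scaleN1r addrC.
by rewrite labsum_lin !labsum_pelt /lab e1 e2 scaleN1r addNr.
Qed.

(** * The elements of H_Delta and their tips *)

Lemma path2_arrows x y w : path2 x y w -> parrows w = [:: x; y].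
Proof. by move/pcomp_parrows. Qed.

Lemma path2_dpath x y w : path2 x y w ->
  dpath_path w = pcomp (darrow_path y) (darrow_path x).
Proof.
move=> E; have [P [-> eP sP _]] := dpath_pathP w; symmetry; apply/pcompP; split.
- exact: esym (pcomp_end E).
- by rewrite sP (pend_comp E).
- by rewrite eP (path2_arrows E) !wword_cons.
Qed.

Lemma path2_deg x y w : path2 x y w -> dpath_deg w = (deg x + deg y)%N.
Proof.
by move=> E; rewrite dpath_degE (path2_arrows E) !wdeg_cons /wdeg big_nil addn0.
Qed.

Lemma good2E x y w : path2 x y w -> good [:: x; y] <->
  exists2 p, pcomp (darrow_path y) (darrow_path x) = Some p & Rset R2 (deg x + deg y) p.
Proof.
by move=> E; rewrite -(path2_dpath E) -(path2_deg E) -(path2_arrows E); exact: goodE.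
Qed.

Lemma good2_deg x y : good [:: x; y] ->
  (deg x = 2 /\ deg y = 2) \/ (deg x = 2 /\ deg y = 3) \/ (deg x = 3 /\ deg y = 2).
Proof.
case/good_shape => [[z //]|]; rewrite /ndeg /=.
by case: x y => [[?|?]|?] [[?|?]|?] //= [] // _ _; auto.
Qed.

Local Notation H := (@H_Delta Q R2 K I).
Local Notation bzeroE := (mul_b_b_zeroE adm mgp st D_gt2 A_gt1 D_neq2A).
Local Notation bczeroE := (mul_b_c_zeroE adm mgp st D_gt2 A_gt1 D_neq2A).
Local Notation cbzeroE := (mul_c_b_zeroE adm mgp st D_gt2 A_gt1 D_neq2A).
Local Notation bceqE := (mul_b_c_eqE adm mgp st D_gt2 A_gt1 D_neq2A).

(** Six of the nine pairs of degrees lie in [H_Delta] outright; for bb, bc and cb the Ext condition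
    has been translated into membership in R^n. *)
Lemma H_monomial x y w : path2 x y w -> ~ good [:: x; y] -> H (pelt K w).
Proof.
case: x y => [[a|b]|c] [[a'|b']|c'] E; rewrite (good2E E) => ng.
- exact: H_aa E.
- exact: H_ab E.
- exact: H_ac E.
- exact: H_ba E.
- by apply: (H_bb E); apply/bzeroE.
- by apply: (H_bc E); apply/bczeroE.
- exact: H_ca E.
- by apply: (H_cb E); apply/cbzeroE.
- exact: H_cc E.
Qed.

Lemma H_binomial b c c' b' w w' : path2 (arr2 b) (arr3 c) w -> path2 (arr3 c') (arr2 b') w' ->
  good [:: arr2 b; arr3 c] -> dpath_path w = dpath_path w' -> H (pelt K w - pelt K w').
Proof.
move=> E E' /(good2E E) [p Ep Rp] e; apply: (H_bccb E E').
  by move/bczeroE; apply; exists p.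
by apply/(bceqE c' b' Ep Rp); rewrite -Ep -(path2_dpath E) e (path2_dpath E').
Qed.

(** These two shapes describe [H_Delta] by the sets R^n alone, without Ext; [H_monomial],
    [H_binomial] and [H_inv] give both inclusions. *)
Definition monomial_rel (g : pathalg K Dl) := exists x y w,
  [/\ path2 x y w, ~ good [:: x; y] & g = pelt K w].
Definition binomial_rel (g : pathalg K Dl) := exists b c c' b' w w',
  [/\ path2 (arr2 b) (arr3 c) w, path2 (arr3 c') (arr2 b') w', good [:: arr2 b; arr3 c],
    dpath_path w = dpath_path w' & g = pelt K w - pelt K w'].

Lemma H_inv g : H g -> monomial_rel g \/ binomial_rel g.
Proof.
have bad2 x y : (deg x, deg y) \notin [:: (2, 2); (2, 3); (3, 2)] -> ~ good [:: x; y].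
  by move=> nin /good2_deg h; move: nin; case: h => [[-> ->]|[[-> ->]|[-> ->]]].
case=> [a a' w E|a b w E|b a w E|a c w E|c a w E|c c' w E|b b' w E z|b c w E z|c b w E z
  |b c c' b' w w' E E' nz e].
1-6: by left; do 3 eexists; split; [exact: E|exact: bad2|].
- by left; do 3 eexists; split; [exact: E|rewrite (good2E E); apply/bzeroE|].
- by left; do 3 eexists; split; [exact: E|rewrite (good2E E); apply/bczeroE|].
- by left; do 3 eexists; split; [exact: E|rewrite (good2E E); apply/cbzeroE|].
right; exists b, c, c', b', w, w'.
have [p Ep Rp] : exists2 p, pcomp (val c) (val b) = Some p & Rset R2 5 p.
  by apply: contrapT => no; apply: nz; apply/bczeroE.
split=> //; first by apply/(good2E E); exists p.
by rewrite (path2_dpath E) (path2_dpath E') [LHS]Ep; symmetry; apply/(bceqE c' b' Ep Rp).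
Qed.

Lemma H_sub_I g : H g -> g \in I_Delta R2 K.
Proof.
case/H_inv => [[x [y [w [E ng ->]]]]|[b [c [c' [b' [w [w' [E E' _ e ->]]]]]]]];
  apply: ideal_gen_sub.
  apply: DeltaZero; first by rewrite /plen (path2_arrows E).
  by rewrite -goodE (path2_arrows E).
apply: DeltaComm => //; try by rewrite /plen ?(path2_arrows E) ?(path2_arrows E').
by rewrite (path2_deg E) (path2_deg E').
Qed.

Lemma plen_path2 x y w : path2 x y w -> plen w = 2%N.
Proof. by move=> E; rewrite /plen (path2_arrows E). Qed.

Lemma H_plen g w : H g -> w \in msupp g -> plen w = 2%N.
Proof.
case/H_inv => [[x [y [v [E _ ->]]]]|[b [c [c' [b' [v [v' [E E' _ _ ->]]]]]]]].
  by rewrite msupp_pelt in_fset1 => /eqP ->; exact: plen_path2 E.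
by case/msupp_peltB => ->; [exact: plen_path2 E|exact: plen_path2 E'].
Qed.

Lemma subpath_plen u w : subpath u w -> plen u = plen w -> (0 < plen w)%N -> u = w.
Proof.
move=> [a [b [v [E F]]]] e l.
have lE := pcomp_plen E; have lF := pcomp_plen F.
have /size0nil ea : plen a = 0%N by lia.
have /size0nil eb : plen b = 0%N by lia.
apply: qpath_eq; last by rewrite e.
by rewrite (pcomp_parrows F) (pcomp_parrows E) ea eb cats0.
Qed.

Section Order.
Variable gt : rel (vertex Dl + arrow Dl).
Hypothesis ord : delta_letter_order gt.

Let gt_irr : irreflexive gt. Proof. by case: ord. Qed.
Let gt_trans : transitive gt. Proof. by case: ord. Qed.
Let gt_total : forall z z', z != z' -> gt z z' || gt z' z. Proof. by case: ord. Qed.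

Lemma path_gt_head x y l l' u w : parrows u = x :: l -> parrows w = y :: l' ->
  size l = size l' -> (deg x < deg y)%N -> path_gt gt u w.
Proof.
case: ord => _ _ _ gd _ eu ew es d; right; rewrite /plen eu ew /= es; split=> //.
exists [::], (inr x), (inr y), (map inr l), (map inr l').
by rewrite /letters eu ew; split=> //; exact: gd.
Qed.

(** Letters of degree 2 exceed letters of degree 3, so the path beginning with [b] wins. *)
Lemma binomial_tip b c c' b' w w' : path2 (arr2 b) (arr3 c) w -> path2 (arr3 c') (arr2 b') w' ->
  is_tip gt (pelt K w - pelt K w') w.
Proof.
move=> E E'; apply: tip_peltB => //.
exact: path_gt_head (path2_arrows E) (path2_arrows E') _ _.
Qed.

Lemma H_tip g : H g -> exists2 w, is_tip gt g w & g@_w = 1.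
Proof.
case/H_inv => [[x [y [w [E _ ->]]]]|[b [c [c' [b' [w [w' [E E' _ _ ->]]]]]]]].
  by exists w; [exact: tip_pelt|rewrite mcoeff_pelt].
have tw := binomial_tip E E'; exists w => //.
rewrite mcoeff_peltB eqxx; case: eqP => [e|_]; last by rewrite subr0.
by have := path2_arrows E; rewrite -e (path2_arrows E').
Qed.

Lemma H_tipE g w : H g -> is_tip gt g w ->
  (exists x y, [/\ path2 x y w, ~ good [:: x; y] & g = pelt K w]) \/
  (exists b c c' b' w', [/\ path2 (arr2 b) (arr3 c) w, path2 (arr3 c') (arr2 b') w',
     good [:: arr2 b; arr3 c], dpath_path w = dpath_path w' & g = pelt K w - pelt K w']).
Proof.
case/H_inv => [[x [y [v [E ng ->]]]]|[b [c [c' [b' [v [v' [E E' gd e ->]]]]]]]] tw.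
  have vw := tip_unique gt_irr gt_trans (tip_pelt gt K v) tw; rewrite vw in E *.
  by left; exists x, y.
have vw := tip_unique gt_irr gt_trans (binomial_tip E E') tw; rewrite vw in E e *.
by right; exists b, c, c', b', v'.
Qed.

(** All paths involved have length 2, so divisibility is equality. The tip of a monomial does not
    occur in a binomial, both of whose paths have their product in R^5. Two binomials with the same
    tip agree, since a path of Delta is determined by its underlying path and the degrees of its
    letters. *)
Lemma H_reduced : reduced gt H.
Proof.
split; first exact: H_tip.
move=> g h p q Hg Hh nhg ps tq sub.
have eqp : q = p.
  apply: (subpath_plen sub); first by rewrite (H_plen Hh tq.1) (H_plen Hg ps).
  by rewrite (H_plen Hg ps).
subst q => {sub}; apply: nhg.
case: (H_tipE Hh tq) => [[x [y [E ng ->]]]|[b [c [c' [b' [w' [E E' gd e ->]]]]]]].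
  case/H_inv: Hg ps => [[x1 [y1 [v [E1 _ ->]]]]|[b [c [c' [b' [v [v' [E1 E2 gd e ->]]]]]]]].
    by rewrite msupp_pelt in_fset1 => /eqP ->.
  have gv' : good (parrows v').
    by apply: (good_lab e); [rewrite (path2_deg E1) (path2_deg E2)|rewrite (path2_arrows E1)].
  case/msupp_peltB => ep; case: ng; rewrite -(path2_arrows E) ep //.
  by rewrite (path2_arrows E1).
case/H_inv: Hg ps => [[x1 [y1 [v [E1 ng ->]]]]|[b1 [c1 [c1' [b1' [v [v' [E1 E2 _ e1 ->]]]]]]]].
  rewrite msupp_pelt in_fset1 => /eqP ep; case: ng.
  by rewrite -(path2_arrows E1) -ep (path2_arrows E).
(* The second term of a binomial begins with a letter of degree 3, the tip with one of degree 2. *)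
case/msupp_peltB => ep; subst p; last first.
  by have := path2_arrows E; rewrite (path2_arrows E2).
congr (_ - pelt K _); apply: delta_word_inj; first by rewrite -e -e1.
by rewrite (path2_arrows E') (path2_arrows E2).
Qed.

Lemma pair_subpath w l1 x y l2 : parrows w = l1 ++ x :: y :: l2 ->
  exists2 v, path2 x y v & subpath v w.
Proof.
move=> e; have [u [v [E _ ev]]] := pcomp_cut e.
have [v1 [v2 [F ev1 _]]] : exists v1 v2, [/\ pcomp v1 v2 = Some v, parrows v1 = [:: x; y] & parrows v2 = l2].
  by apply: pcomp_cut; rewrite ev.
have [a [b [G ea eb]]] : exists a b, [/\ pcomp a b = Some v1, parrows a = [:: x] & parrows b = [:: y]].
  by apply: pcomp_cut; rewrite ev1.
have pa : a = parrow (x : arrow Dl) by apply: qpath_eq; rewrite /plen ea.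
have pb : b = parrow (y : arrow Dl) by apply: qpath_eq; rewrite /plen eb.
exists v1; first by rewrite /path2 -pa -pb.
have [c Ec _] : exists2 c, pcomp u v1 = Some c & parrows c = parrows u ++ parrows v1.
  by apply: pcomp_Some; rewrite (pcomp_end E) (pcomp_start F).
exists u, v2, c; split=> //.
have := pcompA u v1 v2; rewrite F Ec /= => <-; exact: E.
Qed.

Lemma bc_swap b c w : path2 (arr2 b) (arr3 c) w -> good [:: arr2 b; arr3 c] ->
  exists c' b' w', path2 (arr3 c') (arr2 b') w' /\ dpath_path w = dpath_path w'.
Proof.
move=> E g; have [P [ew eP sP tP]] := dpath_pathP w.
have RP : RL T 5 (parrows P).
  rewrite eP (path2_arrows E); move: g.
  by rewrite /word_in_R !wdeg_cons /wdeg big_nil.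
have [s1 [s2 [es R1 R3]]] := RL5_swap D_gt2 A_gt1 D_neq2A T_anti RL_size RP.
have [u [v [F eu ev]]] := pcomp_cut es.
have Ru : Rset R2 2 u by apply/(RsetE R2_len); rewrite eu.
have Rv : Rset R2 3 v by apply/(RsetE R2_len); rewrite ev.
pose c' : Rtype 3 := mkR Rv; pose b' : Rtype 2 := mkR Ru.
have [w' E' _] : exists2 w', pcomp (parrow (arr3 c')) (parrow (arr2 b')) = Some w' &
    parrows w' = parrows (parrow (arr3 c')) ++ parrows (parrow (arr2 b')).
  by apply: pcomp_Some; exact: esym (pcomp_end F).
by exists c', b', w'; split=> //; rewrite (path2_dpath E') ew [RHS]F.
Qed.

Section Normal.
Variable p : qpath Dl.
Hypothesis normal : forall g q, H g -> is_tip gt g q -> ~ subpath q p.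

(** A pair outside R^n is the tip of a monomial, and a nonzero bc is the tip of a binomial by
    [bc_swap]; only bb and cb remain. *)
Lemma normal_pair l1 x y l2 : parrows p = l1 ++ x :: y :: l2 ->
  [/\ good [:: x; y], (2 <= deg x)%N & deg y = 2%N].
Proof.
case/pair_subpath => v E sub.
have g : good [:: x; y].
  apply: contrapT => ng; apply: (normal (H_monomial E ng) _ sub); exact: tip_pelt.
case: (good2_deg g) => [[-> ->]|[[dx dy]|[-> ->]]] //.
case: x dx E g => [[a|b]|c] // _ E g; case: y dy E g => [[a'|b']|c] // _ E g.
have [c' [b' [w' [E' e]]]] := bc_swap E g.
by case: (normal (H_binomial E E' g e) (binomial_tip E E') sub).
Qed.

Lemma normal_tail x l : parrows p = x :: l -> ndeg deg 2 l = size l.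
Proof.
move=> ep; suff h s l1 x1 : parrows p = l1 ++ x1 :: s -> ndeg deg 2 s = size s.
  exact: (h l [::] x).
elim: s l1 x1 => [|y s IH] l1 x1 e //.
have [_ _ dy] := normal_pair e.
by rewrite /ndeg /= dy -/(ndeg _ _ _) (IH (rcons l1 x1) y) // cat_rcons.
Qed.

Lemma normal_good : good (parrows p).
Proof.
case ep: (parrows p) => [|x l]; first by rewrite /word_in_R /wdeg big_nil.
have tl := normal_tail ep.
case: l ep tl => [|y l] ep tl.
  by rewrite /word_in_R wdeg_cons wword_cons /wdeg big_nil addn0; exact: delta_arrow_word.
have [_ dx _] := @normal_pair [::] x y l ep.
apply: (good_chain D_gt2 A_gt1 D_neq2A T_anti RL_size delta_arrow_deg delta_arrow_word dx tl).
by move=> l1 y1 z1 l2 e; have [] := @normal_pair l1 y1 z1 l2 (etrans ep e).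
Qed.

(** Equal degree sequences in a fibre give equal paths. The only other possibility is that [p]
    begins with the letter of degree 3 and [w] with one of degree 2, a greater letter. *)
Lemma normal_least w : dpath_path w = dpath_path p -> dpath_deg w = dpath_deg p ->
  w <> p -> path_gt gt w p.
Proof.
move=> e1 e2 nwp.
have gp := normal_good; have gw := good_lab (esym e1) (esym e2) gp.
have same : map deg (parrows p) = map deg (parrows w) -> path_gt gt w p.
  by move=> h; case: nwp; apply: delta_word_inj.
case ep: (parrows p) gp same => [|x l] gp same.
  apply: same; have := size_le_wdeg D_gt2 A_gt1 D_neq2A delta_arrow_deg (parrows w).
  by rewrite -dpath_degE e2 dpath_degE ep /wdeg big_nil leqn0 => /eqP/size0nil ->.
have tl := normal_tail ep; rewrite !dpath_degE in e2.
(* No letter can follow one of degree 1, so [p] is a single letter, and so is any path of Delta of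
   degree 1. *)
have [dx|dx] := leqP 2 (deg x); last first.
  have dx1 : deg x = 1%N by have := delta_arrow_deg x; lia.
  have el : l = [::].
    by case: l ep {gp same tl} => [|y l] // ep; have [_] := @normal_pair [::] x y l ep; lia.
  apply: same; rewrite el /= dx1; rewrite ep el wdeg_cons dx1 /wdeg big_nil in e2.
  case: (parrows w) e2 => [|y [|z m]]; rewrite ?big_cons ?big_nil //=.
    by rewrite !addn0 => ->.
  by have := delta_arrow_deg y; have := delta_arrow_deg z; lia.
rewrite ep in e2.
case: (good_same_deg D_gt2 A_gt1 D_neq2A T_anti RL_size delta_arrow_deg delta_arrow_word
  gp gw (esym e2) erefl dx tl) => [/same //|[x' [l' [ew sl dx' dx3]]]].
by apply: (path_gt_head ew ep sl); rewrite dx' dx3.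
Qed.
End Normal.

Lemma I_Delta_tip z : z \in I_Delta R2 K -> z <> 0 ->
  exists g p q, [/\ H g, is_tip gt g q, is_tip gt z p & subpath q p].
Proof.
move=> zI nz; have [p tp] := tip_exists gt_trans gt_total nz.
apply: contrapT => no.
have normal g q : H g -> is_tip gt g q -> ~ subpath q p.
  by move=> Hg tq sub; apply: no; exists g, p, q.
have [P eP RP] := (goodE p).1 (normal_good normal).
have := I_Delta_in_kernel zI RP; rewrite /labsum (bigD1_seq p tp.1 (fset_uniq _)) /=.
(* Another path of the support with the label of [p] would exceed [p] by [normal_least], yet [p] is
   the tip. So the functional returns the coefficient of the tip, which is nonzero. *)
rewrite [X in _ + X]big1_seq => [|w /andP[nwp ws]].
  rewrite /lab eP !eqxx addr0 => /eqP; rewrite scaler_eq0 oner_eq0 orbF.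
  by rewrite mcoeff_eq0 tp.1.
rewrite /lab; case: eqP => [e1|]; last by rewrite scaler0.
case: eqP => [e2|]; last by rewrite scaler0.
have /eqP nwp' := nwp.
case: (@path_gt_irr _ gt gt_irr p).
apply: (path_gt_trans gt_trans (tp.2 w ws nwp')).
by apply: (normal_least normal) => //; rewrite e1 eP.
Qed.
End Order.
End Delta.

(* If Q has no path of length 2 then H_Delta is empty and I_Delta is zero; as a
   Groebner basis is non-empty by definition, this case is listed apart. *)
Theorem proposition5p6 (K : fieldType) (Q : quiver) (I : tsideal (pathalg K Q))
    (R2 : set (qpath Q)) (D A : nat)
    (gt : rel (vertex (Delta R2) + arrow (Delta R2))) :
  finite_quiver Q ->
  admissible I ->
  minimal_generating_paths I R2 ->
  stacked I D A ->
  (2 < D)%N -> (1 < A)%N -> D <> (2 * A)%N ->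
  delta_letter_order gt ->
  quadratic_reduced_groebner_basis gt (I_Delta R2 K) (H_Delta R2 I) \/
  ((forall g, ~ H_Delta R2 I g) /\ (forall x, x \in I_Delta R2 K -> x = 0)).
Proof.
move=> _ adm mgp st D2 A1 DA ord.
have [[g Hg]|no] := pselect (exists g, H_Delta R2 I g).
  left; split; last by move=> g0 Hg0 p; exact: (H_plen adm mgp st D2 A1 DA Hg0).
    split; first by exists g.
      by move=> g0; exact: (H_sub_I adm mgp st D2 A1 DA).
    by move=> x; exact: (I_Delta_tip adm mgp st D2 A1 DA ord).
  exact: (H_reduced adm mgp st D2 A1 DA ord).
(* A nonzero element of [I_Delta] would, through its tip, exhibit an element of [H_Delta]. *)
right; split=> [g Hg|x xI]; first by apply: no; exists g.
apply: contrapT => nx.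
have [g [p [q [Hg _ _ _]]]] := I_Delta_tip adm mgp st D2 A1 DA ord xI nx.
by apply: no; exists g.
Qed.
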